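(* Let $L>0$, let $f$ be a nonnegative log-concave function defined on $[0,L]$, and let $p>1$. Then $$\inf_{\substack{u\in W^{1,p}(0,L)\\ \int_0^L |u|^{p-2}u\,f\,dx=0}}\frac{\int_0^L |u'(x)|^p f(x)\,dx}{\int_0^L |u(x)|^p f(x)\,dx}\;\ge\;\min_{\substack{u\in W^{1,p}(0,L)\\ \int_0^L |u|^{p-2}u\,dx=0}}\frac{\int_0^L |u'(x)|^p\,dx}{\int_0^L |u(x)|^p\,dx}=\left(\frac{\pi_p}{L}\right)^p,$$ where $$\pi_p=2\int_0^{+\infty}\frac{1}{1+\frac{1}{p-1}s^p}\,ds=2\pi\,\frac{(p-1)^{1/p}}{p\,\sin(\pi/p)}.$$
   Context: A nonnegative function $f$ on $[0,L]$ is log-concave if $f((1-\theta)x+\theta y)\ge f(x)^{1-\theta}f(y)^{\theta}$ for all $x,y\in[0,L]$ and $\theta\in(0,1)$. The infimum and minimum are taken over functions $u$ for which the denominator of the quotient is nonzero. The expression $|u|^{p-2}u$ is understood to be $0$ where $u=0$. *)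

(* Defs.v *)
From HB Require Import structures.
From mathcomp Require Export all_boot all_order all_algebra.
From mathcomp Require Export all_classical all_reals all_analysis.
Export Order.TTheory GRing.Theory Num.Theory.
Export numFieldNormedType.Exports.

Set Implicit Arguments.
Unset Strict Implicit.
Unset Printing Implicit Defensive.

Local Open Scope classical_set_scope.
Local Open Scope ring_scope.

(* [0 `^ t = 0] for [t != 0], so the inequality is trivial where [f] vanishes
   at [x] or [y]. *)
Definition log_concave (R : realType) (L : R) (f : R -> R) : Prop :=
  forall x y t : R, x \in `[0, L] -> y \in `[0, L] -> t \in `]0, 1[ ->
    f x `^ (1 - t) * f y `^ t <= f ((1 - t) * x + t * y).

(* The space C_c^oo(0, L), as functions on the whole line. *)
Definition test_function (R : realType) (L : R) (phi : R -> R) : Prop :=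
  let supp := closure [set x | phi x != 0] in
  [/\ forall (n : nat) (x : R), derivable (derive1n n phi) x 1,
      compact supp & supp `<=` `]0, L[].

(* Only the values on ]0, L[ matter: [u] is extended by zero. *)
Definition Lp_itv (R : realType) (p L : R) (u : R -> R) : Prop :=
  u \_ `]0, L[ \in Lfun (@lebesgue_measure R) p%:E.

Definition weak_derivative (R : realType) (L : R) (u v : R -> R) : Prop :=
  forall phi : R -> R, test_function L phi ->
    \int[@lebesgue_measure R]_(x in `]0, L[) (u x * derive1 phi x)
    = - \int[@lebesgue_measure R]_(x in `]0, L[) (v x * phi x).

(* [u] is in W^{1,p}(0, L) and [v] is (a representative of) its weak
   derivative, which is unique up to a null set. *)
Definition sobolev_with_derivative (R : realType) (p L : R) (u v : R -> R)
    : Prop :=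
  [/\ Lp_itv p L u, Lp_itv p L v & weak_derivative L u v].

Definition p_energy (R : realType) (p L : R) (f w : R -> R) : \bar R :=
  (\int[@lebesgue_measure R]_(x in `]0%R, L[) (`|w x| `^ p * f x)%:E)%E.

(* Where [u] vanishes, so does [`|u| `^ (p - 2) * u], whatever [p] is. *)
Definition p_mean_zero (R : realType) (p L : R) (f u : R -> R) : Prop :=
  (\int[@lebesgue_measure R]_(x in `]0%R, L[)
     (`|u x| `^ (p - 2) * u x * f x)%:E = 0)%E.

(* The set is empty, with infimum +oo, when [f] is zero almost everywhere. *)
Definition rayleigh_quotients (R : realType) (p L : R) (f : R -> R)
    : set (\bar R) :=
  [set q | exists u v : R -> R,
     [/\ sobolev_with_derivative p L u v, p_mean_zero p L f u,
         p_energy p L f u != 0%E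
       & q = (p_energy p L f v / p_energy p L f u)%E]].

Definition pi_p (R : realType) (p : R) : R :=
  2 * \int[@lebesgue_measure R]_(s in `[0, +oo[) (1 / (1 + (p - 1)^-1 * s `^ p)).

(* Main.v *)
Require Import Defs.
From mathcomp Require Import ring lra measurable_realfun.

Set Implicit Arguments.
Unset Strict Implicit.
Unset Printing Implicit Defensive.

Local Open Scope classical_set_scope.
Local Open Scope ring_scope.

(** Write D(y) = 1 + |y|^p/(p-1) and let F be the primitive of 1/D with
F(0) = 0, so that pi_p is twice the limit of F at +oo.

Lower bound. Let v be the weak derivative of u, fix a centre m in ]0, L[ and
let W(x) be the integral of |v| between m and x. Some constant c satisfies
|u - c| <= W almost everywhere ([sobolev_control]). The constraint on u is the
Euler equation of the convex problem of minimizing the integral of |u - c|^p f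
over constants c, so c = 0 is optimal and the integral of |u|^p f is at most
that of W^p f ([p_energy_le_shift]). It remains to bound the Hardy operator
that maps |v| to W in the weighted L^p space. By the Schur test ([schur_test])
it is enough to find h > 0 and Phi such that the integral of h between m and x
is at most Phi(x), while the integral of Phi^(p-1) f over the points x beyond
t, as seen from m, is at most C h(t)^(p-1) f(t).

For f = exp(sigma x) such a pair comes from a scalar differential equation
([hardy_profile]): a phase Y increases from -N to N in time L and vanishes at
m, Phi = |Y| h / kappa, and C = kappa^(-p) with kappa = 2 F(N)/L for every
sigma. Only the place m of the zero depends on sigma. The equation for Y uses,
in place of 1/D, the weight [tilt] s; its inverse is at least D + s y, which
absorbs the exponential, and its sum with its mirror image is 2/D, which makes
the total time independent of s. For a general f the same pair works as soon as
f exp(-sigma x) is nondecreasing before m and nonincreasing after m. By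
log-concavity f exp(-sigma x) is unimodal, so at least one of these two
monotonicities holds for every sigma; as m moves continuously from 0 to L when
sigma runs over the line, some sigma has both ([exists_balance]). Letting N
tend to infinity, kappa tends to pi_p/L ([rayleigh_ge_pi_p]).

Equality for f = 1. The equation with s = 0 and N = oo is solved explicitly:
tau = F^(-1)(kappa (x - L/2)), and u = tau D(tau)^(-1/p), whose derivative is
kappa D(tau)^(-1/p), is extremal ([constant_weight_minimizer]). These functions
are analogues of the sine and the cosine.

Value of pi_p. Expanding 1/D in powers of |y|^p/(p-1) below the point where
this quantity is 1, and in powers of its inverse above, gives two alternating
series which together are the partial fractions of pi/sin(pi/p)
([arcpden_limE], [cosecant_partial_fractions]). *)


(** * Derivatives and primitives on the line *)
Section Calculus.
Context {R : realType}.
Implicit Types (f g : R -> R) (x y a b : R).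

(** Here and below the rules are stated for pointwise expressions rather than
for the ring of functions, so that explicit formulas can be differentiated
without rewriting them first. *)
Lemma is_derive_add f g a b x : is_derive x 1 f a -> is_derive x 1 g b ->
  is_derive x 1 (fun z => f z + g z) (a + b).
Proof. by move=> *; exact: is_deriveD. Qed.

Lemma is_derive_sub f g a b x : is_derive x 1 f a -> is_derive x 1 g b ->
  is_derive x 1 (fun z => f z - g z) (a - b).
Proof. by move=> *; exact: is_deriveB. Qed.

Lemma is_derive_opp f a x : is_derive x 1 f a ->
  is_derive x 1 (fun z => - f z) (- a).
Proof. by move=> *; exact: is_deriveN. Qed.

Lemma is_derive_mul f g a b x : is_derive x 1 f a -> is_derive x 1 g b ->
  is_derive x 1 (fun z => f z * g z) (a * g x + f x * b).
Proof.
move=> fa gb; apply: (@is_derive_eq _ _ _ _ _ _ _ _ (is_deriveM fa gb)).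
by rewrite /GRing.scale/= addrC [g x * a]mulrC.
Qed.

Lemma is_derive_mulc f a c x : is_derive x 1 f a ->
  is_derive x 1 (fun z => c * f z) (c * a).
Proof. by move=> fa; exact: is_deriveZ. Qed.

Lemma is_derive_linear c x : is_derive x 1 (fun z : R => c * z) c.
Proof.
by apply: is_derive_eq (is_derive_mulc c (is_derive_id x 1)) _; rewrite mulr1.
Qed.

Lemma is_derive_affine c b x : is_derive x 1 (fun z : R => c * (z - b)) c.
Proof.
have := is_derive_mulc c (is_derive_sub (is_derive_id x 1) (is_derive_cst b x 1)).
by rewrite subr0 mulr1.
Qed.

Lemma is_derive_comp f g a b x : is_derive (g x) 1 f a -> is_derive x 1 g b ->
  is_derive x 1 (fun z => f (g z)) (a * b).
Proof.
move=> /is_derive1_caratheodory[F [fE cF <-]].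
move=> dg; have cg := differentiable_continuous (iffLR (derivable1_diffP _ _) (@ex_derive _ _ _ _ _ _ _ dg)).
move: dg => /is_derive1_caratheodory[G [gE cG <-]].
apply/is_derive1_caratheodory; exists (fun z => F (g z) * G z); split => //.
  by move=> z; rewrite fE gE mulrA.
by apply: continuousM => //; apply: continuous_comp.
Qed.

Lemma is_derive_flip f a x : is_derive (- x) 1 f a ->
  is_derive x 1 (fun z => f (- z)) (- a).
Proof.
by move=> fa; rewrite -mulrN1; exact: is_derive_comp fa (is_deriveNid x 1).
Qed.

Lemma is_derive_continuous f a x : is_derive x 1 f a -> {for x, continuous f}.
Proof. by case=> df _; apply/differentiable_continuous/derivable1_diffP. Qed.

Lemma derive1_val f a x : is_derive x 1 f a -> derive1 f x = a.
Proof. by rewrite derive1E => -[]. Qed.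

Lemma derivable_val f a x : is_derive x 1 f a -> derivable f x 1.
Proof. by case. Qed.

Lemma continuous_within f a b : continuous f -> {within `[a, b], continuous f}.
Proof. exact: continuous_subspaceT. Qed.

Lemma is_derive_within f (df : R -> R) a b :
  (forall x, is_derive x 1 f (df x)) -> {within `[a, b], continuous f}.
Proof.
by move=> d; apply: continuous_subspaceT => x; apply: is_derive_continuous (d x).
Qed.

Lemma mean_value_le f (df : R -> R) c a b : a <= b ->
  {within `[a, b], continuous f} ->
  (forall x, a < x < b -> is_derive x 1 f (df x)) ->
  (forall x, a < x < b -> df x <= c) -> f b - f a <= c * (b - a).
Proof.
rewrite le_eqVlt => /predU1P[-> *|ab cf dfE dfc].
  by rewrite !subrr mulr0.
have dfE' x : x \in `]a, b[%R -> is_derive x 1 f (df x).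
  by rewrite in_itv; exact: dfE.
have [z] := MVT ab dfE' cf.
by rewrite in_itv/= => zab ->; rewrite ler_wpM2r ?dfc// subr_ge0 ltW.
Qed.

Lemma mean_value_ge f (df : R -> R) c a b : a <= b ->
  {within `[a, b], continuous f} ->
  (forall x, a < x < b -> is_derive x 1 f (df x)) ->
  (forall x, a < x < b -> c <= df x) -> c * (b - a) <= f b - f a.
Proof.
rewrite le_eqVlt => /predU1P[-> *|ab cf dfE dfc].
  by rewrite !subrr mulr0.
have dfE' x : x \in `]a, b[%R -> is_derive x 1 f (df x).
  by rewrite in_itv; exact: dfE.
have [z] := MVT ab dfE' cf.
by rewrite in_itv/= => zab ->; rewrite ler_wpM2r ?dfc// subr_ge0 ltW.
Qed.

Lemma mean_value_norm_le f (df : R -> R) c a b : a <= b ->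
  {within `[a, b], continuous f} ->
  (forall x, a < x < b -> is_derive x 1 f (df x)) ->
  (forall x, a < x < b -> `|df x| <= c) -> `|f b - f a| <= c * (b - a).
Proof.
move=> ab cf dfE dfc; rewrite ler_norml -mulNr (@mean_value_le f df)//=.
  rewrite (@mean_value_ge f df)// => x /dfc; first by rewrite ler_norml => /andP[].
by move=> x /dfc; rewrite ler_norml => /andP[].
Qed.

Lemma continuous_integrable_itv (g : R -> R) a b : continuous g ->
  lebesgue_measure.-integrable `[a, b] (EFin \o g).
Proof.
move=> cg; apply: continuous_compact_integrable; first exact: segment_compact.
exact: continuous_subspaceT.
Qed.

(** The integral from a is a primitive only to the right of a. Two such
primitives differ by a constant where both are defined, so the difference of
the values at x and 0 does not depend on the base point, which may be taken to
be -(|x| + 1). *)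
Lemma exists_primitive (g : R -> R) : continuous g ->
  exists G : R -> R, G 0 = 0 /\ forall x, is_derive x 1 G (g x).
Proof.
move=> cg; pose mu := @lebesgue_measure R.
pose P a x := \int[mu]_(t in `[a, x]) g t.
have dP a x : a < x -> is_derive x 1 (P a) (g x).
  move=> ax; have x1 : x < x + 1 by rewrite ltrDl.
  have [dF FE] := continuous_FTC1_closed x1 (continuous_integrable_itv _ _ cg) ax (cg x).
  exact: DeriveDef dF (etrans (esym (derive1E _ _)) FE).
have shiftP a b x y : a <= b -> b < x -> b < y ->
    P a x - P a y = P b x - P b y.
  move=> ab bx by_; wlog xy : x y bx by_ / x <= y.
    move=> H; case: (leP x y) => [/H|/ltW/H]; first exact.
    by move=> /(_ by_ bx) E; rewrite -[LHS]opprB E opprB.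
  rewrite -[LHS]opprB -[RHS]opprB; congr (- _).
  have H c : c <= b -> P c y - P c x = \int[mu]_(t in `]x, y]) g t.
    move=> cb; apply: Rintegral_itvB; last 2 first.
    - by rewrite bnd_simp (le_trans cb)// ltW.
    - by rewrite bnd_simp.
    exact: continuous_integrable_itv.
  by rewrite !H.
clearbody P.
pose G x := P (- (`|x| + 1)) x - P (- (`|x| + 1)) 0.
have GE a x : a < - (`|x| + 1) -> G x = P a x - P a 0.
  move=> ax; rewrite /G -(@shiftP a)//; first exact: ltW.
  by have := ler_norm (- x); rewrite normrN; lra.
exists G; split; first by rewrite /G subrr.
move=> x; pose a := - (`|x| + 3).
have -> : g x = g x - 0 by rewrite subr0.
have dH : is_derive x 1 (fun z => P a z - P a 0) (g x - 0).
  apply: (is_derive_sub (dP a x _) (is_derive_cst (P a 0) x 1)).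
  by rewrite /a; have := ler_norm (- x); rewrite normrN; lra.
apply: near_eq_is_derive dH => //.
near=> z; apply/esym/GE; rewrite /a.
have : `|x - z| < 1 by near: z; apply: nbhsx_ballx.
by have := ler_normB x (x - z); rewrite opprB addrC subrK; lra.
Unshelve. all: by end_near. Qed.

Lemma continuous_sub f g : continuous f -> continuous g ->
  continuous (fun x => f x - g x).
Proof. by move=> cf cg x; exact: (continuousB (cf x) (cg x)). Qed.

Lemma continuous_add f g : continuous f -> continuous g ->
  continuous (fun x => f x + g x).
Proof. by move=> cf cg x; exact: (continuousD (cf x) (cg x)). Qed.

Lemma continuous_mul f g : continuous f -> continuous g ->
  continuous (fun x => f x * g x).
Proof. by move=> cf cg x; exact: (continuousM (cf x) (cg x)). Qed.

Lemma continuous_cst (c : R) : continuous (fun _ : R => c).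
Proof. by move=> x; exact: cst_continuous. Qed.

Lemma continuous_sum n (h : nat -> R -> R) : (forall k, continuous (h k)) ->
  continuous (fun x => \sum_(k < n) h k x).
Proof.
move=> ch; elim: n => [|n IH].
  by under eq_fun do rewrite big_ord0; exact: continuous_cst.
by under eq_fun do rewrite big_ord_recr/=; exact: continuous_add.
Qed.

Lemma cvg_sum_ord (F : set_system R) (FF : Filter F) n (h : nat -> R -> R) (l : nat -> R) :
  (forall k, h k x @[x --> F] --> l k) ->
  \sum_(k < n) h k x @[x --> F] --> \sum_(k < n) l k.
Proof.
move=> ch; elim: n => [|n IH].
  by under eq_fun do rewrite big_ord0; rewrite big_ord0; exact: cvg_cst.
by under eq_fun do rewrite big_ord_recr/=; rewrite big_ord_recr/=; exact: cvgD.
Qed.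

Lemma is_derive_gt0_lt f (df : R -> R) : (forall x, is_derive x 1 f (df x)) ->
  (forall x, 0 < df x) -> {homo f : x y / x < y}.
Proof.
move=> dfE df0 a b ab.
have [|z _ /eqP] := MVT ab (fun x _ => dfE x); first exact: is_derive_within dfE.
by rewrite subr_eq => /eqP ->; rewrite ltrDr mulr_gt0// subr_gt0.
Qed.

(** The range of G may be a bounded interval; the inverse is left arbitrary
outside it. *)
Lemma exists_inverse (G k : R -> R) : (forall x, is_derive x 1 G (k x)) ->
  (forall x, 0 < k x) ->
  exists g : R -> R, cancel G g /\ forall x, is_derive (G x) 1 g (k x)^-1.
Proof.
move=> dG k0; have G_lt := is_derive_gt0_lt dG k0.
have G_inj : injective G by move=> x y E; case: (ltgtP x y) => // /G_lt; rewrite E ltxx.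
exists (fun y => xget 0 [set x | G x = y]).
have GK : cancel G (fun y => xget 0 [set x | G x = y]).
  by move=> x; case: xgetP => [z -> /G_inj//|/(_ x)/=]; exact: contra_notP.
split=> // x; apply: is_derive_inverse => //; last by rewrite gt_eqF.
- by near=> z; exact: GK.
- by near=> z; apply: is_derive_continuous (dG z).
Unshelve. all: by end_near. Qed.

Lemma surjective_itv f a b y : a <= b -> continuous f -> f a <= y <= f b ->
  exists2 x, a <= x <= b & f x = y.
Proof.
move=> ab cf /andP[ay yb].
have [||x] := @IVT R f a b y ab; first exact: continuous_subspaceT.
  by rewrite ge_min ay le_max yb orbT.
by rewrite in_itv/= => xab <-; exists x.
Qed.

End Calculus.

(** * The signed power *)
Section SignedPower.
Context {R : realType}.
Context (p : R) (p1 : 1 < p).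
Implicit Types x y z a b : R.

(** The derivative of |x|^p, divided by p. *)
Definition spow x : R := `|x| `^ (p - 2) * x.

Lemma spow0 : spow 0 = 0. Proof. by rewrite /spow mulr0. Qed.

Lemma spowN x : spow (- x) = - spow x.
Proof. by rewrite /spow normrN mulrN. Qed.

Lemma spow_ge0E x : 0 <= x -> spow x = x `^ (p - 1).
Proof.
rewrite le_eqVlt => /predU1P[<-|x0].
  by rewrite spow0 powR0// subr_eq0 gt_eqF.
rewrite /spow gtr0_norm// -[X in _ * X](powRr1 (ltW x0)) -powRD; last first.
  by apply/implyP => _; rewrite gt_eqF.
by congr (_ `^ _); ring.
Qed.

Lemma norm_spow x : `|spow x| = `|x| `^ (p - 1).
Proof.
by rewrite -spow_ge0E// /spow normrM normr_id ger0_norm// powR_ge0.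
Qed.

Lemma spow_mul x : spow x * x = `|x| `^ p.
Proof.
wlog x0 : x / 0 <= x.
  move=> H; case: (leP 0 x) => [/H//|x0].
  by rewrite -[x]opprK spowN mulrNN H ?normrN// oppr_ge0 ltW.
rewrite spow_ge0E// mulrC mulr_powRB1 ?ger0_norm//; have := p1; lra.
Qed.

Lemma spow_le : {homo spow : x y / x <= y}.
Proof.
have H x y : 0 <= x -> x <= y -> spow x <= spow y.
  move=> x0 xy; have y0 := le_trans x0 xy.
  by rewrite !spow_ge0E// ge0_ler_powR ?nnegrE//; have := p1; lra.
move=> x y xy; case: (leP 0 x) => x0; first exact: H.
case: (leP 0 y) => y0.
  apply: (@le_trans _ _ 0); last by rewrite -spow0 H.
  by rewrite -[x]opprK spowN oppr_le0 -spow0 H// oppr_ge0 ltW.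
rewrite -(opprK x) -(opprK y) (spowN (- x)) (spowN (- y)) lerN2.
by rewrite H ?lerN2// oppr_ge0 ltW.
Qed.

Lemma continuous_powR_pos q x : 0 < x -> {for x, continuous (fun z : R => z `^ q)}.
Proof. by move=> x0; apply: is_derive_continuous; exact: is_derive1_powR. Qed.

Lemma powR_small q (e : R) : 0 < q -> 0 < e ->
  exists2 d, 0 < d & forall z, `|z| < d -> `|z| `^ q < e.
Proof.
move=> q0 e0; exists (e `^ q^-1); first exact: powR_gt0.
move=> z zd; have -> : e = (e `^ q^-1) `^ q.
  by rewrite -powRrM mulVf ?gt_eqF// powRr1// ltW.
by rewrite gt0_ltr_powR// nnegrE ?powR_ge0.
Qed.

Lemma continuous_norm_powR_neq0 q x : x != 0 ->
  {for x, continuous (fun x : R => `|x| `^ q)}.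
Proof.
move=> x0; apply: (@continuous_comp _ _ _ (fun z : R => `|z|) (fun z => z `^ q)).
  exact: norm_continuous.
by apply: continuous_powR_pos; rewrite normr_gt0.
Qed.

Lemma continuous_norm_powR q : 0 < q -> continuous (fun x : R => `|x| `^ q).
Proof.
move=> q0 x; have [->|x0] := eqVneq x 0.
  apply/cvgrPdist_lt => e e0; have [d d0 H] := powR_small q0 e0.
  apply: (filterS _ (nbhsx_ballx (0 : R) d d0)) => z.
  rewrite /ball/= sub0r normrN => zd.
  by rewrite normr0 powR0 ?gt_eqF// sub0r normrN ger0_norm ?powR_ge0// H.
exact: continuous_norm_powR_neq0.
Qed.

Lemma continuous_spow : continuous spow.
Proof.
move=> x; have [->|x0] := eqVneq x 0.
  apply/cvgrPdist_lt => e e0; have [|d d0 H] := @powR_small (p - 1) e _ e0.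
    by rewrite subr_gt0.
  apply: (filterS _ (nbhsx_ballx (0 : R) d d0)) => z.
  rewrite /ball/= sub0r normrN => zd.
  by rewrite spow0 sub0r normrN norm_spow H.
suff : {for x, continuous spow} by [].
apply: continuousM; last exact: cvg_id.
exact: continuous_norm_powR_neq0.
Qed.

Lemma is_derive_norm_powR x : is_derive x 1 (fun z : R => `|z| `^ p) (p * spow x).
Proof.
have p0 : 0 < p by have := p1; lra.
have pos y : 0 < y -> is_derive y 1 (fun z : R => `|z| `^ p) (p * spow y).
  move=> y0; have d : is_derive y 1 (fun z : R => z `^ p) (p * spow y).
    by rewrite spow_ge0E ?ltW//; exact: is_derive1_powR.
  apply: near_eq_is_derive d => //; near=> z; rewrite gtr0_norm//.
  by near: z; exact: lt_nbhsr.
case: (ltgtP x 0) => [x0|/pos//|->].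
  have nx0 : 0 < - x by rewrite oppr_gt0.
  have := @is_derive_comp _ (fun z : R => `|z| `^ p) -%R _ _ x (pos _ nx0) (is_deriveNid x 1).
  under [X in is_derive _ _ X _ -> _]eq_fun do rewrite normrN.
  by rewrite spowN !mulrN mulr1 opprK.
(* At 0 the difference quotient of |z|^p is spow z itself. *)
apply/is_derive1_caratheodory; exists spow; split; last by rewrite spow0 mulr0.
- by move=> z; rewrite normr0 powR0 ?gt_eqF// !subr0 spow_mul.
- exact: continuous_spow.
Unshelve. all: by end_near. Qed.

(** Convexity of the p-th power as a tangent inequality. It shows that 0 is
the best constant for a function of p-mean zero, and, integrated, it gives the
Hoelder inequality behind the Schur test. *)
Lemma norm_powR_tangent a b : `|a| `^ p + p * spow a * (b - a) <= `|b| `^ p.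
Proof.
pose phi (t : R) : R := `|t| `^ p - p * spow a * t.
have dphi (t : R) : is_derive t 1 phi (p * spow t - p * spow a).
  apply: is_derive_sub; first exact: is_derive_norm_powR.
  exact: is_derive_linear.
suff : phi a <= phi b by rewrite /phi; lra.
have p0 : 0 < p by have := p1; lra.
rewrite -subr_ge0; case: (leP a b) => ab.
  rewrite -[X in X <= _](mul0r (b - a)).
  apply: (mean_value_ge ab (is_derive_within dphi)) => x /andP[ax _] //.
  by rewrite -mulrBr mulr_ge0 ?subr_ge0 ?spow_le ?ltW.
rewrite -oppr_le0 opprB -[X in _ <= X](mul0r (a - b)).
apply: (mean_value_le (ltW ab) (is_derive_within dphi)) => x /andP[_ ax] //.
by rewrite -mulrBr pmulr_rle0// subr_le0 spow_le// ltW.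
Qed.

End SignedPower.

(** * Partial fractions of the cosecant *)
Section Cosecant.
Context {R : realType}.
Implicit Types (a x : R) (N k : nat).

Lemma is_derive_sum_fun n (h dh : nat -> R -> R) x :
  (forall i, (i < n)%N -> is_derive x 1 (h i) (dh i x)) ->
  is_derive x 1 (fun z => \sum_(i < n) h i z) (\sum_(i < n) dh i x).
Proof.
elim: n => [_|n IH H].
  under eq_fun do rewrite big_ord0; rewrite big_ord0; exact: is_derive_cst.
under eq_fun do rewrite big_ord_recr/=.
rewrite big_ord_recr/=; apply: is_derive_add; last exact: H.
by apply: IH => i iN; apply: H; rewrite ltnS ltnW.
Qed.

Lemma is_derive_sin_scale c x :
  is_derive x 1 (fun z : R => sin (c * z)) (c * cos (c * x)).
Proof.
rewrite mulrC; apply: (@is_derive_comp _ sin (fun z => c * z)).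
exact: is_derive_linear.
Qed.

Lemma is_derive_cos_scale c x :
  is_derive x 1 (fun z : R => cos (c * z)) (- c * sin (c * x)).
Proof.
rewrite mulNr mulrC -mulNr; apply: (@is_derive_comp _ cos (fun z => c * z)).
exact: is_derive_linear.
Qed.

Lemma withinB (A : set R) (f g : R -> R) : {within A, continuous f} ->
  {within A, continuous g} -> {within A, continuous (fun x => f x - g x)}.
Proof. by move=> cf cg x; exact: (continuousB (cf x) (cg x)). Qed.

Lemma withinD (A : set R) (f g : R -> R) : {within A, continuous f} ->
  {within A, continuous g} -> {within A, continuous (fun x => f x + g x)}.
Proof. by move=> cf cg x; exact: (continuousD (cf x) (cg x)). Qed.

Lemma withinN (A : set R) (f : R -> R) : {within A, continuous f} ->
  {within A, continuous (fun x => - f x)}.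
Proof. by move=> cf x; exact: (continuousN (cf x)). Qed.

Lemma within_cst (A : set R) (c : R) : {within A, continuous (fun _ => c)}.
Proof. by move=> x; exact: cst_continuous. Qed.

Lemma withinM (A : set R) (f g : R -> R) : {within A, continuous f} ->
  {within A, continuous g} -> {within A, continuous (fun x => f x * g x)}.
Proof. by move=> cf cg x; exact: (continuousM (cf x) (cg x)). Qed.

Definition dirichlet N x : R := 1 + \sum_(k < N) 2 * cos (k.+1%:R * x).

Lemma dirichlet_sin N x :
  sin (2^-1 * x) * dirichlet N x = sin ((N%:R + 2^-1) * x).
Proof.
rewrite /dirichlet; elim: N => [|N IH].
  by rewrite big_ord0 addr0 mulr1 add0r.
rewrite big_ord_recr/= addrA mulrDr IH.
have -> : (N%:R + 2^-1) * x = N.+1%:R * x - 2^-1 * x by rewrite -natr1; field.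
have -> : (N.+1%:R + 2^-1) * x = N.+1%:R * x + 2^-1 * x by rewrite mulrDl.
by rewrite sinB sinD; ring.
Qed.

(** The primitive of cos(a x) times the Dirichlet kernel. Its value at pi is
sin(a pi) times a partial sum of the partial fractions of pi/sin(a pi). *)
Definition cosecant_prim N a x : R := sin (a * x) / a +
  \sum_(k < N) (sin ((a + k.+1%:R) * x) / (a + k.+1%:R)
              + sin ((a - k.+1%:R) * x) / (a - k.+1%:R)).

Definition dirichlet_prim N x : R := x + \sum_(k < N) 2 * sin (k.+1%:R * x) / k.+1%:R.

Definition cosecant_sum N a : R := a^-1 +
  \sum_(k < N) (-1) ^+ k.+1 * ((a + k.+1%:R)^-1 + (a - k.+1%:R)^-1).

Lemma is_derive_sin_scale_div c x : c != 0 ->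
  is_derive x 1 (fun z : R => sin (c * z) / c) (cos (c * x)).
Proof.
move=> c0; under eq_fun do rewrite mulrC.
have -> : cos (c * x) = c^-1 * (c * cos (c * x)) by rewrite mulrA mulVf ?mul1r.
by apply: is_derive_mulc; exact: is_derive_sin_scale.
Qed.

Lemma is_derive_cosecant_prim N a x : 0 < a < 1 ->
  is_derive x 1 (cosecant_prim N a) (cos (a * x) * dirichlet N x).
Proof.
move=> /andP[a0 a1].
rewrite /dirichlet mulrDr mulr1 mulr_sumr.
apply: is_derive_add; first by apply: is_derive_sin_scale_div; rewrite gt_eqF.
rewrite (eq_bigr (fun k : 'I_N => cos ((a + k.+1%:R) * x) + cos ((a - k.+1%:R) * x))); last first.
  by move=> k _; rewrite [(a + _) * x]mulrDl [(a - _) * x]mulrBl (cosB (a * x)) (cosD (a * x)); ring.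
apply: (@is_derive_sum_fun _ (fun k z => sin ((a + k.+1%:R) * z) / (a + k.+1%:R)
              + sin ((a - k.+1%:R) * z) / (a - k.+1%:R))
  (fun k x => cos ((a + k.+1%:R) * x) + cos ((a - k.+1%:R) * x))) => k kN.
have k1 : 1 <= k.+1%:R :> R by rewrite ler1n.
apply: is_derive_add; apply: is_derive_sin_scale_div.
  by rewrite gt_eqF//; lra.
by rewrite lt_eqF//; lra.
Qed.

Lemma is_derive_dirichlet_prim N x : is_derive x 1 (dirichlet_prim N) (dirichlet N x).
Proof.
apply: (is_derive_add (is_derive_id x 1)).
apply: (@is_derive_sum_fun _ (fun k z => 2 * sin (k.+1%:R * z) / k.+1%:R)
  (fun k x => 2 * cos (k.+1%:R * x))) => k kN.
under eq_fun do rewrite -mulrA.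
by apply: is_derive_mulc; apply: is_derive_sin_scale_div; rewrite pnatr_eq0.
Qed.

Lemma sin_pi_nat k : sin (k%:R * pi) = 0 :> R.
Proof.
elim: k => [|k IH]; first by rewrite mul0r sin0.
by rewrite -natr1 mulrDl mul1r sinDpi IH oppr0.
Qed.

Lemma cos_pi_nat k : cos (k%:R * pi) = (-1) ^+ k :> R.
Proof.
elim: k => [|k IH]; first by rewrite mul0r cos0.
by rewrite -natr1 mulrDl mul1r cosDpi IH exprS mulN1r.
Qed.

Lemma dirichlet_prim_pi N : dirichlet_prim N pi = pi.
Proof.
rewrite /dirichlet_prim big1 ?addr0// => k _.
by rewrite sin_pi_nat mulr0 mul0r.
Qed.

Lemma cosecant_prim_pi N a : cosecant_prim N a pi = sin (a * pi) * cosecant_sum N a.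
Proof.
rewrite /cosecant_prim /cosecant_sum [in RHS]mulrDr [in RHS]mulr_sumr; congr (_ + _).
apply: eq_bigr => k _.
by rewrite mulrDl mulrBl (sinD (a * pi)) (sinB (a * pi)) sin_pi_nat cos_pi_nat; ring.
Qed.

(** As cos(a x) - 1 = -2 sin(a x/2)^2, multiplying the Dirichlet kernel
sin(M x)/sin(x/2), M = N + 1/2, by cos(a x) changes it by -2 sin(M x) times
this function. Its bounded derivative makes the integral of the change of
order 1/M. *)
Definition cosecant_aux a x : R := sin (2^-1 * a * x) ^+ 2 / sin (2^-1 * x).

Definition cosecant_aux' a x : R :=
  (a * sin (2^-1 * a * x) * cos (2^-1 * a * x)) / sin (2^-1 * x)
  - 2^-1 * (sin (2^-1 * a * x) / sin (2^-1 * x)) ^+ 2 * cos (2^-1 * x).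

Lemma sin_half_gt0 x : 0 < x <= pi -> 0 < sin (2^-1 * x).
Proof.
move=> /andP[x0 xpi]; apply: sin_gt0_pi; have := @pi_gt0 R; lra.
Qed.

Lemma sin_half_le a x : 0 < a < 1 -> 0 <= x <= pi ->
  0 <= sin (2^-1 * a * x) <= sin (2^-1 * x).
Proof.
move=> /andP[a0 a1] /andP[x0 xpi]; have pi0 := @pi_gt0 R.
have ax : a * x <= x by rewrite ler_piMl// ltW.
have ax0 : 0 <= a * x by rewrite mulr_ge0// ltW.
apply/andP; split; first by apply: sin_ge0_pi; rewrite -mulrA; lra.
rewrite leNgt ltr_sin ?in_itv/= -?leNgt -?mulrA; lra.
Qed.

Lemma is_derive_cosecant_aux a x : 0 < x <= pi ->
  is_derive x 1 (cosecant_aux a) (cosecant_aux' a x).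
Proof.
move=> x0; have s0 := sin_half_gt0 x0.
have d1 : is_derive x 1 (fun z => sin (2^-1 * a * z) ^+ 2)
    (a * sin (2^-1 * a * x) * cos (2^-1 * a * x)).
  have -> : a * sin (2^-1 * a * x) * cos (2^-1 * a * x) =
    2^-1 * a * cos (2^-1 * a * x) * sin (2^-1 * a * x) +
    sin (2^-1 * a * x) * (2^-1 * a * cos (2^-1 * a * x)) by field.
  by apply: (@is_derive_mul _ (fun z => sin (2^-1 * a * z)));
    exact: is_derive_sin_scale.
have d2 : is_derive x 1 (fun z => (sin (2^-1 * z))^-1)
    (- (sin (2^-1 * x)) ^- 2 * (2^-1 * cos (2^-1 * x))).
  apply: is_deriveV; first by rewrite gt_eqF.
  exact: is_derive_sin_scale.
have := is_derive_mul d1 d2; congr (is_derive _ _ _ _).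
by rewrite /cosecant_aux'; field; rewrite gt_eqF.
Qed.

Lemma cosecant_aux'_le a x : 0 < a < 1 -> 0 < x <= pi ->
  `|cosecant_aux' a x| <= 3 / 2.
Proof.
move=> a01 x0; have s0 := sin_half_gt0 x0.
have x0' : 0 <= x <= pi by case/andP: x0 => /ltW -> ->.
have /andP[s1 s2] := sin_half_le a01 x0'.
rewrite /cosecant_aux'; set S := sin (2^-1 * a * x) in s1 s2 *.
set T := sin (2^-1 * x) in s0 s2 *.
set r := S / T.
have r01 : 0 <= r <= 1 by rewrite divr_ge0 ?(ltW s0)//= ler_pdivrMr// mul1r.
have -> : a * S * cos (2^-1 * a * x) / T = a * r * cos (2^-1 * a * x).
  by rewrite /r; field; rewrite gt_eqF.
clearbody r; have /andP[r0 r1] := r01; have /andP[a0 a1] := a01.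
apply: le_trans (ler_normB _ _) _.
have h1 : `|a * r * cos (2^-1 * a * x)| <= 1.
  rewrite !normrM (ger0_norm r0) (gtr0_norm a0).
  rewrite -[leRHS](mulr1 1) ler_pM// ?mulr_ge0 ?(ltW a0) ?cos_max//.
  by rewrite mulr_ile1 ?(ltW a0) ?(ltW a1).
have h2 : `|2^-1 * r ^+ 2 * cos (2^-1 * x)| <= 2^-1.
  rewrite normrM ger0_norm ?mulr_ge0 ?exprn_ge0 ?invr_ge0//.
  have r2 : r ^+ 2 <= 1 by rewrite expr_le1.
  apply: le_trans (_ : 2^-1 * r ^+ 2 <= _); last by rewrite ler_piMr// invr_ge0.
  by rewrite ler_piMr ?cos_max ?mulr_ge0 ?exprn_ge0 ?invr_ge0.
lra.
Qed.

Lemma cosecant_aux_le a x : 0 < a < 1 -> 0 <= x <= pi ->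
  0 <= cosecant_aux a x <= sin (2^-1 * x).
Proof.
move=> a01 /[dup] x0 /andP[]; rewrite le_eqVlt => /predU1P[<- _|x1 x2].
  by rewrite /cosecant_aux !mulr0 sin0 invr0 mulr0 lexx.
have s0 : 0 < sin (2^-1 * x) by apply: sin_half_gt0; rewrite x1.
have /andP[s1 s2] := sin_half_le a01 x0.
rewrite /cosecant_aux divr_ge0 ?sqr_ge0 ?(ltW s0)//=.
by rewrite ler_pdivrMr// expr2 ler_pM.
Qed.

Lemma within_cosecant_aux a : 0 < a < 1 -> {within `[0, pi], continuous (cosecant_aux a)}.
Proof.
move=> a01; have pi0 := @pi_gt0 R; apply/continuous_within_itvP => //; split.
- move=> x; rewrite in_itv/= => /andP[x0 x1].
  by apply: is_derive_continuous (@is_derive_cosecant_aux a x _); rewrite x0 ltW.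
- have -> : cosecant_aux a 0 = 0 by rewrite /cosecant_aux !mulr0 sin0 invr0 mulr0.
  apply: (@squeeze_cvgr _ _ _ _ (cst 0) (fun x => sin (2^-1 * x))).
  + near=> x; apply: cosecant_aux_le => //; apply/andP; split; near: x.
      exact: nbhs_right_ge.
    exact: nbhs_right_le.
  + exact: cvg_cst.
  + apply: cvg_at_right_filter.
    have E : (0 : R) = sin (2^-1 * 0) by rewrite mulr0 sin0.
    rewrite [X in _ --> X]E; exact: is_derive_continuous (is_derive_sin_scale 2^-1 0).
- apply: cvg_at_left_filter.
  by apply: is_derive_continuous (@is_derive_cosecant_aux a pi _); rewrite pi0 lexx.
Unshelve. all: by end_near. Qed.

(** One integration by parts, written without integrals: the difference of the
two primitives, corrected by the boundary term of order 1/M, has a derivative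
of order 1/M. *)
Lemma cosecant_partial_fractions N a : 0 < a < 1 -> (0 < N)%N ->
  `|sin (a * pi) * cosecant_sum N a - pi| <= (3 * pi + 2) / N%:R.
Proof.
move=> a01 N0; have pi0 := @pi_gt0 R; pose M : R := N%:R + 2^-1.
have N0' : 0 < N%:R :> R by rewrite ltr0n.
have M0 : 0 < M by rewrite /M; lra.
pose Z x := cosecant_prim N a x - dirichlet_prim N x -
  2 / M * (cosecant_aux a x * cos (M * x)).
have dZ x : 0 < x < pi -> is_derive x 1 Z (- (2 / M * (cosecant_aux' a x * cos (M * x)))).
  move=> /andP[x0 x1]; have x01 : 0 < x <= pi by rewrite x0 ltW.
  have := is_derive_sub (is_derive_sub (is_derive_cosecant_prim N x a01)
    (is_derive_dirichlet_prim N x))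
    (is_derive_mulc (2 / M) (is_derive_mul (is_derive_cosecant_aux a x01)
    (is_derive_cos_scale M x))).
  congr (is_derive _ _ _ _).
  have s0 := sin_half_gt0 x01.
  have -> : dirichlet N x = sin (M * x) / sin (2^-1 * x).
    by rewrite -dirichlet_sin mulrAC mulfV ?mul1r// gt_eqF.
  have -> : a * x = (2^-1 * a * x) *+ 2 by rewrite mulr2n; field.
  rewrite cos_mulr2n cos2sin2 /cosecant_aux mulr2n.
  by field; rewrite !gt_eqF.
have cZ : {within `[0, pi], continuous Z}.
  apply: withinB; first apply: withinB.
  - exact: (is_derive_within (fun y => is_derive_cosecant_prim N y a01)).
  - exact: (is_derive_within (is_derive_dirichlet_prim N)).
  apply: withinM; first exact: within_cst.
  apply: withinM; first exact: within_cosecant_aux.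
  exact: (is_derive_within (is_derive_cos_scale M)).
have Z0 : Z 0 = 0.
  rewrite /Z /cosecant_prim /dirichlet_prim /cosecant_aux !mulr0 sin0 invr0 !mulr0.
  by rewrite !mul0r !add0r mulr0 subr0 !big1 ?subrr// => k _; rewrite !mulr0 sin0 ?mulr0 !mul0r ?addr0.
have Zpi : `|Z pi - Z 0| <= 3 / M * (pi - 0).
  apply: (mean_value_norm_le (ltW pi0) cZ dZ) => x /andP[x0 x1].
  rewrite normrN !normrM normfV (gtr0_norm M0) ger0_norm// mulrAC.
  have x01 : 0 < x <= pi by rewrite x0 ltW.
  have := cosecant_aux'_le a01 x01.
  have := cos_max (M * x); have M1 : 0 < M^-1 by rewrite invr_gt0.
  move: (normr_ge0 (cosecant_aux' a x)).
  move: `|cosecant_aux' a x| `|cos _| => v u v0 u1 v1.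
  have uv : v * u <= 3 / 2 by apply: le_trans v1; rewrite ler_piMr.
  by rewrite ler_pM2r//; lra.
rewrite Z0 !subr0 in Zpi.
have -> : sin (a * pi) * cosecant_sum N a - pi =
    Z pi + 2 / M * (cosecant_aux a pi * cos (M * pi)).
  by rewrite /Z cosecant_prim_pi dirichlet_prim_pi; ring.
apply: le_trans (ler_normD _ _) _.
have h : `|2 / M * (cosecant_aux a pi * cos (M * pi))| <= 2 / M.
  have pi01 := introT andP (conj (ltW pi0) (lexx (pi : R))).
  have /andP[h0 h1] := cosecant_aux_le a01 pi01.
  have h2 : cosecant_aux a pi <= 1 by apply: le_trans h1 (sin_le1 _).
  rewrite normrM (@ger0_norm _ (2 / M)) ?divr_ge0 ?(ltW M0)//.
  rewrite ler_piMr ?divr_ge0 ?(ltW M0)// normrM (ger0_norm h0).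
  by rewrite mulr_ile1 ?cos_max.
have hM : (3 * pi + 2) / M <= (3 * pi + 2) / N%:R.
  rewrite ler_pM2l ?lef_pV2 ?posrE//; last lra.
  by rewrite /M lerDl.
apply: le_trans hM; rewrite [(3 * pi + 2) / M]mulrDl lerD//.
by apply: le_trans Zpi _; rewrite mulrAC.
Qed.

End Cosecant.

Lemma le_inv_nat_eq0 (R : realType) (K x : R) :
  (forall n : nat, (0 < n)%N -> `|x| <= K / n%:R) -> x = 0.
Proof.
move=> H; apply/eqP; rewrite -normr_eq0 eq_le normr_ge0 andbT.
apply/ler_addgt0Pr => e e0; rewrite add0r.
have K0 : 0 <= K by have := H 1%N isT; rewrite divr1; exact: le_trans.
have := archi_boundP (divr_ge0 K0 (ltW e0)); set n := Num.bound _ => Kn.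
have n0 : (0 : R) < n%:R by apply: le_lt_trans Kn; rewrite divr_ge0// ltW.
apply: le_trans (H n _) _; first by rewrite -(ltr0n R).
by rewrite ler_pdivrMr// mulrC -ler_pdivrMr// ltW.
Qed.

(** * The number pi_p *)
Section PiP.
Context {R : realType} (p : R) (p1 : 1 < p).
Implicit Types x y : R.

Let p0 : 0 < p. Proof. by apply: lt_trans p1. Qed.
Let p10 : 0 < p - 1. Proof. by rewrite subr_gt0. Qed.

Definition pden y : R := 1 + `|y| `^ p / (p - 1).

Lemma pden_ge1 y : 1 <= pden y.
Proof. by rewrite lerDl divr_ge0 ?powR_ge0// ltW. Qed.

Lemma pden_gt0 y : 0 < pden y.
Proof. exact: lt_le_trans (pden_ge1 y). Qed.

Lemma pdenN y : pden (- y) = pden y.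
Proof. by rewrite /pden normrN. Qed.

Lemma is_derive_pden y : is_derive y 1 pden (p * spow p y / (p - 1)).
Proof.
rewrite -[X in is_derive _ _ _ X]add0r mulrC; apply: is_derive_add.
under eq_fun do rewrite mulrC.
by apply: is_derive_mulc; exact: is_derive_norm_powR.
Qed.

Lemma continuous_pden : continuous pden.
Proof. by move=> y; apply: is_derive_continuous (is_derive_pden y). Qed.

Lemma continuous_pdenV : continuous (fun y => (pden y)^-1).
Proof.
by move=> y; apply: continuousV; [rewrite gt_eqF// pden_gt0|exact: continuous_pden].
Qed.

Lemma is_derive_norm_powR_pos q x : 0 < x ->
  is_derive x 1 (fun z : R => `|z| `^ q) (q * x `^ (q - 1)).
Proof.
move=> x0; have d : is_derive x 1 (fun z : R => z `^ q) (q * x `^ (q - 1)).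
  exact: is_derive1_powR.
apply: near_eq_is_derive d => //; near=> z; rewrite gtr0_norm//.
by near: z; exact: lt_nbhsr.
Unshelve. all: by end_near. Qed.

(** For a nondecreasing F this is the limit at +oo. For the primitive of
1/pden it is the analogue of pi/2, which is the case p = 2. *)
Definition arcpden_lim (F : R -> R) : R := sup (range F).

Section arctan.
Context (F : R -> R) (F0 : F 0 = 0) (dF : forall y, is_derive y 1 F (pden y)^-1).

Lemma arcpden_lt : {homo F : x y / x < y}.
Proof. by apply: is_derive_gt0_lt dF _ => x; rewrite invr_gt0 pden_gt0. Qed.

Lemma arcpden_le : {homo F : x y / x <= y}.
Proof. exact/ltW_homo/arcpden_lt. Qed.

Lemma arcpdenN y : F (- y) = - F y.
Proof.
have d x : is_derive x 1 (fun z => F z + F (- z)) 0.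
  have -> : (0 : R) = (pden x)^-1 + (pden (- x))^-1 * -1.
    by rewrite pdenN mulrN1 subrr.
  by apply: is_derive_add.
have := is_derive_0_is_cst y 0 d; rewrite oppr0 F0 addr0 => /eqP.
by rewrite addrC addr_eq0 => /eqP.
Qed.

(* c is the point where |y|^p/(p-1) equals 1, the radius of convergence of the
   geometric series of 1/pden. *)
Let c : R := (p - 1) `^ p^-1.
Let c0 : 0 < c. Proof. exact: powR_gt0. Qed.
Let cp : c `^ p = p - 1.
Proof. by rewrite -powRrM mulVf ?gt_eqF// powRr1// ltW. Qed.

Let alt_geom n (q : R) : 0 <= q ->
  (1 + q)^-1 - \sum_(k < n) (-1) ^+ k * q ^+ k = (-1) ^+ n * q ^+ n / (1 + q).
Proof.
move=> q0; have q1 : 1 + q != 0 by rewrite gt_eqF// ltr_wpDr.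
elim: n => [|n IH]; first by rewrite big_ord0 subr0 !expr0 mulr1 mul1r.
by rewrite big_ord_recr/= opprD addrA IH !exprS; field.
Qed.

(** Below c, integrate the geometric series of 1/pden term by term. The
remainder is dominated by the next term, by comparison of derivatives. *)
Lemma arcpden_near n :
  `|F c - c * \sum_(k < n) (-1) ^+ k * (p * k%:R + 1)^-1| <= c / (p * n%:R + 1).
Proof.
pose t (k : nat) x := (p * k%:R + 1)^-1 * (p - 1) ^- k * `|x| `^ (p * k%:R + 1).
have e0 (k : nat) : 0 < p * k%:R + 1 by rewrite ltr_wpDl ?mulr_ge0 ?ler0n// ltW.
have dt (k : nat) x : 0 < x -> is_derive x 1 (t k) ((x `^ p / (p - 1)) ^+ k).
  move=> x0; have := is_derive_mulc ((p * k%:R + 1)^-1 * (p - 1) ^- k)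
    (is_derive_norm_powR_pos (p * k%:R + 1) x0); congr (is_derive _ _ _ _).
  rewrite addrK powRrM powR_mulrn ?powR_ge0// exprMn exprVn.
  by field; rewrite ?expf_neq0 ?gt_eqF.
have t0 (k : nat) : t k 0 = 0 by rewrite /t normr0 powR0 ?mulr0// gt_eqF.
have tc (k : nat) : t k c = c * (p * k%:R + 1)^-1.
  rewrite /t gtr0_norm// powRD ?gt_eqF ?implybT// powRr1 ?(ltW c0)// powRrM.
  rewrite cp powR_mulrn ?(ltW p10)//; field; rewrite ?expf_neq0 ?gt_eqF//.
have ct (k : nat) : continuous (t k).
  by apply: continuous_mul; [exact: continuous_cst|exact: continuous_norm_powR].
pose A x := F x - \sum_(k < n) (-1) ^+ k * t k x.
have dA x : 0 < x -> is_derive x 1 A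
    ((-1) ^+ n * (x `^ p / (p - 1)) ^+ n / (1 + x `^ p / (p - 1))).
  move=> x0; have q0 : 0 <= x `^ p / (p - 1) by rewrite divr_ge0 ?powR_ge0// ltW.
  rewrite -(alt_geom n q0); apply: is_derive_sub.
    by have := dF x; rewrite /pden gtr0_norm.
  apply: (@is_derive_sum_fun _ n (fun k x => (-1) ^+ k * t k x)
    (fun k x => (-1) ^+ k * (x `^ p / (p - 1)) ^+ k)) => k _.
  by apply: is_derive_mulc; exact: dt.
have cF : continuous F by move=> x; apply: is_derive_continuous (dF x).
have cA : continuous A.
  apply: continuous_sub => //; apply: (continuous_sum (h := fun k x => (-1) ^+ k * t k x)).
  by move=> k; apply: continuous_mul; [exact: continuous_cst|exact: ct].
have A0 : A 0 = 0 by rewrite /A F0 big1 ?subrr// => k _; rewrite t0 mulr0.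
have H (e : bool) : 0 <= t n c - (-1) ^+ e * A c.
  pose B x := t n x - (-1) ^+ e * A x.
  have cB : {within `[0, c], continuous B}.
    apply/continuous_within/continuous_sub; first exact: ct.
    by apply: continuous_mul => //; exact: continuous_cst.
  have dB x : 0 < x < c -> is_derive x 1 B ((x `^ p / (p - 1)) ^+ n -
      (-1) ^+ e * ((-1) ^+ n * (x `^ p / (p - 1)) ^+ n / (1 + x `^ p / (p - 1)))).
    move=> /andP[x0 _].
    exact: (is_derive_sub (dt n x x0) (is_derive_mulc _ (dA x x0))).
  have -> : t n c - (-1) ^+ e * A c = B c - B 0 by rewrite /B A0 t0 mulr0 !subr0.
  rewrite -[X in X <= _](mul0r (c - 0)); apply: (mean_value_ge (ltW c0) cB dB).
  move=> x /andP[x0 _]; set q := x `^ p / (p - 1).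
  have q0 : 0 <= q by rewrite divr_ge0 ?powR_ge0// ltW.
  rewrite subr_ge0; apply: le_trans (ler_norm _) _.
  rewrite !normrM !normrX !normrN !normr1 !expr1n !mul1r normfV.
  rewrite !ger0_norm ?addr_ge0// ler_pdivrMr ?ltr_wpDr//.
  by rewrite ler_peMr ?exprn_ge0// lerDl.
have -> : F c - c * \sum_(k < n) (-1) ^+ k * (p * k%:R + 1)^-1 = A c.
  rewrite /A mulr_sumr; congr (_ - _); apply: eq_bigr => k _.
  by rewrite tc mulrCA.
rewrite -tc ler_norml; have := H false; have := H true.
rewrite expr0 expr1; lra.
Qed.

(* Its derivative is -((p-1)/y^p)^(k+1): up to sign, a term of the expansion of
   1/pden in powers of (p-1)/y^p, valid for y > c. *)
Let far_term (k : nat) x :=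
  (p - 1) ^+ k.+1 / (p * k.+1%:R - 1) * `|x| `^ (1 - p * k.+1%:R).

Let pk0 (k : nat) : 0 < p * k.+1%:R - 1.
Proof. by rewrite subr_gt0 (lt_le_trans p1)// ler_peMr ?ler1n// ltW. Qed.

Let far_term_c (k : nat) : far_term k c = c / (p * k.+1%:R - 1).
Proof.
rewrite /far_term gtr0_norm// powRD; last by apply/implyP => _; rewrite gt_eqF.
rewrite powRr1 ?(ltW c0)//.
rewrite powRN powRrM cp powR_mulrn ?(ltW p10)//.
move: (pk0 k) (_ ^+ k.+1) (@expf_neq0 _ (p - 1) k.+1 (lt0r_neq0 p10)).
by move: (_.+1%:R) => m pkm q q0; field; rewrite q0 gt_eqF.
Qed.

Let far_term_ge0 (k : nat) x : 0 <= far_term k x.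
Proof. by rewrite mulr_ge0 ?powR_ge0 ?divr_ge0 ?exprn_ge0 ?ltW. Qed.

Let far_term_lim (k : nat) : far_term k x @[x --> +oo] --> 0.
Proof.
rewrite -[X in _ --> X](mulr0 ((p - 1) ^+ k.+1 / (p * k.+1%:R - 1))).
apply: cvgM; first exact: cvg_cst.
apply/cvgrPdist_lt => e e0; near=> x; rewrite sub0r normrN ger0_norm ?powR_ge0//.
have x0 : 0 < x by near: x; exact: nbhs_pinfty_gt.
rewrite gtr0_norm// -opprB powRN invf_plt ?posrE ?powR_gt0//.
have -> : e^-1 = (e^-1 `^ (p * k.+1%:R - 1)^-1) `^ (p * k.+1%:R - 1).
  by rewrite -powRrM mulVf ?gt_eqF// powRr1// invr_ge0 ltW.
have xe : e^-1 `^ (p * k.+1%:R - 1)^-1 < x.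
  by near: x; apply: nbhs_pinfty_gt; exact: num_real.
by rewrite gt0_ltr_powR ?nnegrE ?powR_ge0 ?(ltW x0).
Unshelve. all: by end_near. Qed.

(** The same as [arcpden_near] above c, where the expansion is in negative
powers. *)
Lemma arcpden_far n x : c <= x ->
  `|F x + \sum_(k < n) (-1) ^+ k * far_term k x -
    (F c + \sum_(k < n) (-1) ^+ k * far_term k c)| <= c / (p * n.+1%:R - 1).
Proof.
move=> cx.
pose r y := (p - 1) * y `^ (- p).
have dt (k : nat) y : 0 < y -> is_derive y 1 (far_term k) (- r y ^+ k.+1).
  move=> y0; have := is_derive_mulc ((p - 1) ^+ k.+1 / (p * k.+1%:R - 1))
    (is_derive_norm_powR_pos (1 - p * k.+1%:R) y0); congr (is_derive _ _ _ _).
  have -> : 1 - p * k.+1%:R - 1 = - p * k.+1%:R by ring.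
  rewrite powRrM powR_mulrn ?powR_ge0// /r exprMn.
  move: (pk0 k); move: (_.+1%:R) => m pkm; field; rewrite ?gt_eqF//.
pose A y := F y + \sum_(k < n) (-1) ^+ k * far_term k y.
have r0 y : 0 <= r y by rewrite mulr_ge0 ?powR_ge0// ltW.
have dA y : 0 < y -> is_derive y 1 A ((-1) ^+ n * r y ^+ n.+1 / (1 + r y)).
  move=> y0; have -> : (-1) ^+ n * r y ^+ n.+1 / (1 + r y) =
      (pden y)^-1 + \sum_(k < n) (-1) ^+ k * (- r y ^+ k.+1).
    have -> : (-1) ^+ n * r y ^+ n.+1 / (1 + r y) =
        r y * ((-1) ^+ n * r y ^+ n / (1 + r y)) by rewrite exprS; ring.
    rewrite -(alt_geom n (r0 y)) mulrBr mulr_sumr -sumrN; congr (_ + _).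
      rewrite /pden gtr0_norm// /r powRN.
      have yp : 0 < y `^ p by rewrite powR_gt0.
      move: p10 yp; move: (p - 1) (_ `^ _) => m z m0 z0.
      by field; rewrite !gt_eqF//= ?addr_gt0.
    by apply: eq_bigr => k _; rewrite exprS; ring.
  apply: is_derive_add => //.
  apply: (@is_derive_sum_fun _ n (fun k x => (-1) ^+ k * far_term k x)
    (fun k y => (-1) ^+ k * (- r y ^+ k.+1))) => k _.
  by apply: is_derive_mulc; exact: dt.
have H (e : bool) : 0 <= (far_term n c - far_term n x) - (-1) ^+ e * (A x - A c).
  pose B y := - far_term n y - (-1) ^+ e * A y.
  have dB y : 0 < y -> is_derive y 1 B
      (- - r y ^+ n.+1 - (-1) ^+ e * ((-1) ^+ n * r y ^+ n.+1 / (1 + r y))).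
    move=> y0; exact: (is_derive_sub (is_derive_opp (dt n y y0)) (is_derive_mulc _ (dA y y0))).
  have cB : {within `[c, x], continuous B}.
    apply: derivable_within_continuous => y; rewrite in_itv/= => /andP[cy _].
    exact: (derivable_val (dB y (lt_le_trans c0 cy))).
  have -> : far_term n c - far_term n x - (-1) ^+ e * (A x - A c) = B x - B c.
    by rewrite /B; ring.
  have dB' y : c < y < x -> is_derive y 1 B
      (- - r y ^+ n.+1 - (-1) ^+ e * ((-1) ^+ n * r y ^+ n.+1 / (1 + r y))).
    by move=> /andP[cy _]; apply: dB; exact: lt_trans cy.
  rewrite -[X in X <= _](mul0r (x - c)); apply: (mean_value_ge cx cB dB').
  move=> y _; rewrite opprK subr_ge0; apply: le_trans (ler_norm _) _.
  rewrite !normrM !normrX !normrN !normr1 !expr1n !mul1r normfV.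
  rewrite !ger0_norm ?addr_ge0// ler_pdivrMr ?ltr_wpDr//.
  by rewrite ler_peMr ?exprn_ge0// lerDl.
rewrite -far_term_c ler_norml -/(A x) -/(A c); have := H false; have := H true.
have := far_term_ge0 n x; rewrite expr0 expr1; lra.
Qed.

Lemma arcpden_cvg : F x @[x --> +oo] --> arcpden_lim F.
Proof.
apply: nondecreasing_cvgr; first exact: arcpden_le.
exists (F c + c / (p - 1)) => _ [x _ <-].
case: (leP c x) => cx; last first.
  by rewrite ler_wpDr ?divr_ge0 ?(ltW c0) ?(ltW p10)// arcpden_le// ltW.
have := @arcpden_far 0 x cx; rewrite !big_ord0 !addr0 mulr1 ler_norml; lra.
Qed.

Lemma arcpden_lt_lim y : F y < arcpden_lim F.
Proof.
apply: lt_le_trans (_ : F (y + 1) <= _); first by apply: arcpden_lt; rewrite ltrDl.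
rewrite -(cvg_lim _ arcpden_cvg)//; apply: limr_ge; first exact: cvgP arcpden_cvg.
near=> z; apply: arcpden_le; near: z; apply: nbhs_pinfty_ge; exact: num_real.
Unshelve. all: by end_near. Qed.

Lemma arcpden_far_lim n :
  `|arcpden_lim F - (F c + c * \sum_(k < n) (-1) ^+ k * (p * k.+1%:R - 1)^-1)|
    <= c / (p * n.+1%:R - 1).
Proof.
have H : `|F x + \sum_(k < n) (-1) ^+ k * far_term k x -
    (F c + \sum_(k < n) (-1) ^+ k * far_term k c)| @[x --> +oo] -->
    `|arcpden_lim F + \sum_(k < n) (-1) ^+ k * 0 -
    (F c + \sum_(k < n) (-1) ^+ k * far_term k c)|.
  apply: cvg_norm; apply: cvgB; last exact: cvg_cst.
  apply: cvgD; first exact: arcpden_cvg.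
  apply: (@cvg_sum_ord _ _ _ n (fun k x => (-1) ^+ k * far_term k x)
    (fun k => (-1) ^+ k * 0)) => k.
  apply: cvgM; first exact: cvg_cst.
  exact: far_term_lim.
have E0 : \sum_(k < n) (-1) ^+ k * 0 = 0 :> R by apply: big1 => k _; rewrite mulr0.
move: H; rewrite E0 addr0.
have -> : \sum_(k < n) (-1) ^+ k * far_term k c =
    c * \sum_(k < n) (-1) ^+ k * (p * k.+1%:R - 1)^-1.
  rewrite mulr_sumr; apply: eq_bigr => k _.
  by rewrite far_term_c mulrCA.
move=> H; rewrite -(cvg_lim _ H)//; apply: limr_le; first exact: cvgP H.
near=> x.
have cx : c <= x by near: x; apply: nbhs_pinfty_ge; exact: num_real.
have := arcpden_far n cx; congr (`|_ - (_ + _)| <= _).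
rewrite mulr_sumr; apply: eq_bigr => k _.
by rewrite far_term_c mulrCA.
Unshelve. all: by end_near. Qed.

(** With a = 1/p the expansions on both sides of c combine to the partial
fractions of pi/sin(a pi): p k + 1 = p (a + k) and p (k+1) - 1 = p ((k+1) - a).
The convergence is of order 1/n, which is what the estimate below records. *)
Lemma arcpden_limE : arcpden_lim F = c * p^-1 * (pi / sin (pi / p)).
Proof.
set l := arcpden_lim F; pose a := p^-1.
have a01 : 0 < a < 1 by rewrite invr_gt0 p0 invf_lt1.
have /andP[a0 a1] := a01.
have s0 : 0 < sin (a * pi).
  apply: sin_gt0_pi; rewrite mulr_gt0 ?pi_gt0//=.
  by rewrite gtr_pMl ?pi_gt0.
have ca n : \sum_(k < n) (-1) ^+ k * (p * k%:R + 1)^-1 +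
    \sum_(k < n) (-1) ^+ k * (p * k.+1%:R - 1)^-1 =
    a * (cosecant_sum n a - (-1) ^+ n * (a + n%:R)^-1).
  rewrite /cosecant_sum; elim: n => [|n IH].
    by rewrite !big_ord0 !addr0 expr0 mul1r subrr mulr0.
  rewrite !big_ord_recr/= addrACA IH.
  have pn : p * n%:R + 1 = p * (a + n%:R).
    by rewrite mulrDr addrC /a mulfV// gt_eqF.
  have pn1 : p * n.+1%:R - 1 = - p * (a - n.+1%:R).
    by rewrite mulrBr !mulNr opprK addrC /a mulfV// gt_eqF.
  rewrite pn pn1 [in RHS]exprS.
  have n0 : 0 < a + n%:R by rewrite ltr_pwDl// ler0n.
  have n1 : 0 < a + n.+1%:R by rewrite ltr_pwDl// ler0n.
  have n2 : a - n.+1%:R < 0 by rewrite subr_lt0 (lt_le_trans a1)// ler1n.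
  have pE : p = a^-1 by rewrite /a invrK.
  rewrite pE; move: (\sum_(k < n) _) (_ ^+ n) n0 n1 n2.
  move: (a + n%:R) (a + n.+1%:R) (a - n.+1%:R) => x y z w e x0 y0 z0.
  by field; rewrite ?(gt_eqF x0) ?(gt_eqF y0) ?(lt_eqF z0) ?(gt_eqF a0).
have E : l * sin (a * pi) - c * a * pi = 0.
  apply: (@le_inv_nat_eq0 _ (c * a * (3 * pi + 2) + c * a + 2 * c)) => n n0.
  have n0' : 0 < n%:R :> R by rewrite ltr0n.
  have pn : n%:R <= p * n%:R by rewrite ler_peMl// ltW.
  have ca0 : 0 <= c * a by rewrite mulr_ge0 ?ltW.
  have := arcpden_near n; have := arcpden_far_lim n; have := ca n.
  set S1 := \sum_(k < n) _; set S2 := \sum_(k < n) _ => caE far near.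
  have {}near : `|F c - c * S1| <= c / n%:R.
    apply: le_trans near _; rewrite ler_pM2l// lef_pV2 ?posrE//; lra.
  have {}far : `|l - (F c + c * S2)| <= c / n%:R.
    apply: le_trans far _; rewrite ler_pM2l// lef_pV2 ?posrE//.
    rewrite -natr1 mulrDr; have := p1; lra.
  have last_term : `|(-1) ^+ n * (a + n%:R)^-1| <= n%:R^-1.
    rewrite normrM normrX normrN normr1 expr1n mul1r normfV gtr0_norm; last lra.
    rewrite lef_pV2 ?posrE//; lra.
  have csc := cosecant_partial_fractions a01 n0.
  have -> : l * sin (a * pi) - c * a * pi =
      sin (a * pi) * ((l - (F c + c * S2)) + (F c - c * S1))
      - sin (a * pi) * (c * a * ((-1) ^+ n * (a + n%:R)^-1))
      + c * a * (sin (a * pi) * cosecant_sum n a - pi).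
    have -> : c * S1 = c * a * (cosecant_sum n a - (-1) ^+ n / (a + n%:R)) - c * S2.
      by rewrite -mulrA -caE; ring.
    ring.
  have s1 : `|sin (a * pi)| <= 1 by exact: sin_max.
  have h1 : `|sin (a * pi) * (l - (F c + c * S2) + (F c - c * S1))| <= 2 * c / n%:R.
    rewrite normrM; apply: le_trans (ler_piMl (normr_ge0 _) s1) _.
    apply: le_trans (ler_normD _ _) _.
    have -> : 2 * c / n%:R = c / n%:R + c / n%:R by ring.
    exact: lerD.
  have h2 : `|sin (a * pi) * (c * a * ((-1) ^+ n * (a + n%:R)^-1))| <= c * a / n%:R.
    rewrite normrM; apply: le_trans (ler_piMl (normr_ge0 _) s1) _.
    by rewrite normrM (ger0_norm ca0) ler_wpM2l.
  have h3 : `|c * a * (sin (a * pi) * cosecant_sum n a - pi)| <=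
      c * a * (3 * pi + 2) / n%:R.
    by rewrite normrM (ger0_norm ca0) -[leRHS]mulrA ler_wpM2l.
  have -> : (c * a * (3 * pi + 2) + c * a + 2 * c) / n%:R =
    2 * c / n%:R + c * a / n%:R + c * a * (3 * pi + 2) / n%:R by ring.
  apply: le_trans (ler_normD _ _) _; apply: lerD => //.
  by apply: le_trans (ler_normB _ _) _; exact: lerD.
have -> : pi / p = a * pi by rewrite mulrC.
by rewrite mulrA -[c / p]/(c * a) -(subr0_eq E) mulfK// gt_eqF.
Qed.

Lemma pi_pE : pi_p p = 2 * arcpden_lim F.
Proof.
rewrite /pi_p; congr (2 * _).
have H : F x @[x --> +oo] --> arcpden_lim F := arcpden_cvg.
have -> : arcpden_lim F = arcpden_lim F - F 0 by rewrite F0 subr0.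
under eq_Rintegral => x.
  rewrite inE/= in_itv/= andbT => x0.
  have -> : 1 / (1 + (p - 1)^-1 * x `^ p) = (pden x)^-1.
    by rewrite /pden div1r mulrC ger0_norm.
  over.
apply: (Rintegral_ge0_continuous_FTC2y (F := F)) => //.
- by move=> x _; rewrite invr_ge0 ltW// pden_gt0.
- by apply: continuous_subspaceT; exact: continuous_pdenV.
- by apply: cvg_at_right_filter; apply: is_derive_continuous (dF 0).
- by move=> x _; exact: derive1_val (dF x).
Qed.

End arctan.

Lemma pi_p_formula :
  pi_p p = 2 * pi * ((p - 1) `^ (p^-1) / (p * sin (pi / p))).
Proof.
have [F [F0 dF]] := exists_primitive continuous_pdenV.
by rewrite (pi_pE F0 dF) (arcpden_limE F0 dF) invfM; ring.
Qed.

End PiP.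

(** * Integrals of derivatives *)
Section FtcLe.
Context {R : realType}.
Implicit Types (g F dF : R -> R) (a b : R).
Let mu := @lebesgue_measure R.

Lemma within_measurable g a b : {within `[a, b], continuous g} ->
  measurable_fun `[a, b] g.
Proof. by move=> cg; apply: subspace_continuous_measurable_fun. Qed.

Lemma continuous_inv g : continuous g -> (forall x, g x != 0) ->
  continuous (fun x => (g x)^-1).
Proof. by move=> cg g0 x; exact: (continuousV (g0 x) (cg x)). Qed.

Lemma integral_derive F dF a b : a <= b ->
  (forall x, a <= x <= b -> is_derive x 1 F (dF x)) ->
  {within `[a, b], continuous dF} ->
  (\int[mu]_(x in `[a, b]) (dF x)%:E = (F b - F a)%:E)%E.
Proof.
rewrite le_eqVlt => /predU1P[-> _ _|ab dFE cdF].
  by rewrite set_itv1 integral_set1 subrr.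
rewrite EFinB; apply: continuous_FTC2 => //.
- split.
  + by move=> x; rewrite in_itv/= => /andP[/ltW ax /ltW xb];
      apply: derivable_val (dFE x _); rewrite ax.
  + by apply: cvg_at_right_filter; apply: is_derive_continuous (dFE a _); rewrite lexx ltW.
  + by apply: cvg_at_left_filter; apply: is_derive_continuous (dFE b _); rewrite lexx ltW.
- by move=> x; rewrite in_itv/= => /andP[/ltW ax /ltW xb];
    apply: derive1_val (dFE x _); rewrite ax.
Qed.

Lemma integral_le_derive g F dF a b : a <= b ->
  (forall x, a <= x <= b -> is_derive x 1 F (dF x)) ->
  {within `[a, b], continuous dF} -> {within `[a, b], continuous g} ->
  (forall x, a <= x <= b -> 0 <= g x <= dF x) ->
  (\int[mu]_(x in `[a, b]) (g x)%:E <= (F b - F a)%:E)%E.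
Proof.
move=> ab dFE cdF cg gdF; rewrite -(integral_derive ab dFE cdF).
apply: ge0_le_integral => //.
- by move=> x; rewrite /= in_itv/= => /gdF /andP[? _]; rewrite lee_fin.
- by apply/measurable_EFinP; exact: within_measurable.
- by apply/measurable_EFinP; exact: within_measurable.
- by move=> x; rewrite /= in_itv/= => /gdF /andP[_ ?]; rewrite lee_fin.
Qed.

Lemma is_derive_itv_within F dF a b :
  (forall x, a <= x <= b -> is_derive x 1 F (dF x)) -> {within `[a, b], continuous F}.
Proof.
move=> d; apply: derivable_within_continuous => x; rewrite in_itv/= => xab.
exact: derivable_val (d x xab).
Qed.

Lemma within_comp g F a b : continuous g -> {within `[a, b], continuous F} ->
  {within `[a, b], continuous (fun x => g (F x))}.
Proof. by move=> cg cF x; apply: (continuous_comp (cF x)); exact: cg. Qed.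

End FtcLe.

(** * Tilted weights and the splitting point *)
Section Tilt.
Context {R : realType} (p : R) (p1 : 1 < p).
Implicit Types (s y x : R).

Let p0 : 0 < p. Proof. by apply: lt_trans p1. Qed.
Let p10 : 0 < p - 1. Proof. by rewrite subr_gt0. Qed.

(** The weight 1/pden deformed by a slope s. Its inverse dominates
pden y + s y ([tiltV_ge]), and the deformations at y and -y compensate each
other ([tiltD]). *)
Definition tilt s y : R := (pden p y)^-1 * (1 - s * y / (pden p y + `|s * y|)).

Let den0 s y : 0 < pden p y + `|s * y|.
Proof. by rewrite ltr_wpDr// pden_gt0. Qed.

Lemma tilt_gt0 s y : 0 < tilt s y.
Proof.
rewrite mulr_gt0 ?invr_gt0 ?pden_gt0// subr_gt0 ltr_pdivrMr// mul1r.
by rewrite (le_lt_trans (ler_norm _))// ltrDr pden_gt0.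
Qed.

Lemma tilt_sym s y : tilt s (- y) = tilt (- s) y.
Proof. by rewrite /tilt pdenN (mulrN s) (mulNr s). Qed.

Lemma tiltD s y : tilt s y + tilt s (- y) = 2 * (pden p y)^-1.
Proof. by rewrite tilt_sym /tilt !mulNr normrN; ring. Qed.

Lemma continuous_tilt s : continuous (tilt s).
Proof.
have cs : continuous (fun y : R => s * y).
  by apply: continuous_mul; [exact: continuous_cst|move=> y; exact: cvg_id].
apply: continuous_mul; first exact: continuous_pdenV.
apply: continuous_sub; first exact: continuous_cst.
apply: continuous_mul => //; apply: continuous_inv; last by move=> y; rewrite gt_eqF.
apply: continuous_add; first exact: continuous_pden.
by move=> y; exact: (continuous_comp (cs y) (@norm_continuous _ _ _)).
Qed.

(** With D = pden y and r = s y, the inverse is D (D + |r|)/(D + |r| - r), and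
(D + r)(D + |r| - r) = D (D + |r|) + r (|r| - r) with r (|r| - r) <= 0. *)
Lemma tiltV_ge s y : pden p y + s * y <= (tilt s y)^-1.
Proof.
rewrite /tilt; have := pden_gt0 p1 y; set D := pden p y; move: (s * y) => r D0.
have Dr0 : 0 < D + `|r| by rewrite ltr_wpDr.
have -> : 1 - r / (D + `|r|) = (D + `|r| - r) / (D + `|r|).
  by field; rewrite gt_eqF.
have Drr : 0 < D + `|r| - r by have := ler_norm r; lra.
have -> : (D^-1 * ((D + `|r| - r) / (D + `|r|)))^-1 = D * (D + `|r|) / (D + `|r| - r).
  by field; rewrite !gt_eqF.
rewrite ler_pdivlMr//.
by have [r0|r0] := leP 0 r; rewrite ?(ger0_norm r0) ?(ltr0_norm r0); nra.
Qed.

Lemma tilt_le1 s y : 0 <= s -> 0 <= y -> tilt s y <= 1.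
Proof.
move=> s0 y0; rewrite /tilt; apply: mulr_ile1.
- by rewrite invr_ge0 ltW// pden_gt0.
- rewrite subr_ge0 ler_pdivrMr// mul1r (le_trans (ler_norm _))// lerDr.
  by rewrite ltW// pden_gt0.
- by rewrite invf_le1 ?pden_gt0// pden_ge1.
- by rewrite gerBl divr_ge0 ?mulr_ge0// ltW.
Qed.

Lemma tilt_le s y : 0 < s -> 0 < y -> tilt s y <= (s * y)^-1.
Proof.
move=> s0 y0; have sy0 : 0 < s * y by rewrite mulr_gt0.
rewrite -[leLHS]invrK lef_pV2 ?posrE ?invr_gt0 ?tilt_gt0//.
apply: le_trans (tiltV_ge s y); rewrite lerDr.
by rewrite ltW// pden_gt0.
Qed.

Lemma tilt_lipschitz s t y : `|tilt s y - tilt t y| <= `|s - t| * `|y|.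
Proof.
rewrite /tilt -mulrBr -normrM mulrBl.
have : 1 <= pden p y by exact: pden_ge1.
move: (s * y) (t * y) (pden p y) => r q D D1.
have D0 : 0 < D by lra.
have Dr (z : R) : 0 < D + `|z| by rewrite ltr_wpDr.
suff H : `|r / (D + `|r|) - q / (D + `|q|)| <= `|r - q|.
  rewrite normrM gtr0_norm ?invr_gt0//.
  have -> : 1 - r / (D + `|r|) - (1 - q / (D + `|q|)) =
    - (r / (D + `|r|) - q / (D + `|q|)) by ring.
  rewrite normrN; apply: le_trans H; rewrite ler_piMl// invf_le1//.
(* Both r/(D + |r|) and r - r/(D + |r|) are nondecreasing in r when D >= 1. *)
wlog qr : r q / q <= r.
  move=> W; case: (leP q r) => [/W//|/ltW/W].
  by rewrite distrC [leRHS]distrC.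
have mono : q / (D + `|q|) <= r / (D + `|r|).
  rewrite ler_pdivrMr// mulrAC ler_pdivlMr//.
  by case: (leP 0 q) => q0; case: (leP 0 r) => r0;
    rewrite ?(ger0_norm q0) ?(ltr0_norm q0) ?(ger0_norm r0) ?(ltr0_norm r0); nra.
rewrite (ger0_norm (_ : 0 <= r / _ - _)) ?subr_ge0// (ger0_norm (_ : 0 <= r - q)) ?subr_ge0//.
have -> : q / (D + `|q|) = q - q * (1 - (D + `|q|)^-1) by ring.
have small z : 0 <= 1 - (D + `|z|)^-1.
  rewrite subr_ge0 invf_le1//; have := normr_ge0 z; lra.
have -> : r / (D + `|r|) = r - r * (1 - (D + `|r|)^-1) by ring.
suff : q * (1 - (D + `|q|)^-1) <= r * (1 - (D + `|r|)^-1) by lra.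
case: (leP 0 q) => q0; case: (leP 0 r) => r0.
- apply: ler_pM => //; rewrite lerB// lef_pV2 ?posrE// lerD2l.
  by rewrite !ger0_norm.
- lra.
- apply: (@le_trans _ _ 0); first by rewrite mulr_le0_ge0// ltW.
  by rewrite mulr_ge0.
- rewrite -lerN2 -!mulNr; apply: ler_pM => //; first by rewrite oppr_ge0 ltW.
    by rewrite lerN2.
  rewrite lerB// lef_pV2 ?posrE// lerD2l !ltr0_norm// lerN2//.
Qed.

Definition tilt_prim s : R -> R := projT1 (cid (exists_primitive (@continuous_tilt s))).

Lemma tilt_prim0 s : tilt_prim s 0 = 0.
Proof. by rewrite /tilt_prim; case: cid => G []. Qed.

Lemma is_derive_tilt_prim s y : is_derive y 1 (tilt_prim s) (tilt s y).
Proof. by rewrite /tilt_prim; case: cid => G [? ?] /=. Qed.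

Lemma tilt_prim_lt s : {homo tilt_prim s : x y / x < y}.
Proof. exact: is_derive_gt0_lt (is_derive_tilt_prim s) (tilt_gt0 s). Qed.

Let primitive_unique (f g df : R -> R) : (forall x, is_derive x 1 f (df x)) ->
  (forall x, is_derive x 1 g (df x)) -> f 0 = g 0 -> f =1 g.
Proof.
move=> dfE dgE fg0 x.
have d (z : R) : is_derive z 1 (fun z => f z - g z) 0.
  by rewrite -(subrr (df z)); exact: is_derive_sub.
by have := is_derive_0_is_cst x 0 d; rewrite fg0 subrr => /subr0_eq.
Qed.

Lemma tilt_prim_sym s y : tilt_prim s (- y) = - tilt_prim (- s) y.
Proof.
have d (z : R) : is_derive z 1 (fun z => - tilt_prim s (- z)) (tilt (- s) z).
  rewrite -tilt_sym -[X in is_derive _ _ _ X]opprK.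
  exact: (is_derive_opp (is_derive_flip (is_derive_tilt_prim s (- z)))).
have E := primitive_unique d (is_derive_tilt_prim (- s)) _ y.
by rewrite -E ?opprK// oppr0 !tilt_prim0 oppr0.
Qed.

Context (F : R -> R) (F0 : F 0 = 0) (dF : forall y, is_derive y 1 F (pden p y)^-1).

Lemma tilt_primB s y : tilt_prim s y - tilt_prim s (- y) = 2 * F y.
Proof.
apply: (@primitive_unique (fun y => tilt_prim s y - tilt_prim s (- y))
  (fun y => 2 * F y) (fun y => 2 * (pden p y)^-1)).
- move=> z; rewrite -(tiltD s z) -[tilt s (- z)]opprK.
  exact: (is_derive_sub (is_derive_tilt_prim s z) (is_derive_flip (is_derive_tilt_prim s (- z)))).
- by rewrite oppr0 subrr F0 mulr0.
Qed.

Context (L N : R) (L0 : 0 < L) (N0 : 0 < N).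

Lemma arcpden_gt0 : 0 < F N.
Proof. by rewrite -F0; exact: (arcpden_lt p1 dF N0). Qed.

(** The factor kappa for which a solution of Y' = kappa/tilt s Y goes from -N to
N in time L; by [tilt_primB] it does not depend on s. *)
Definition rate : R := 2 * F N / L.

Lemma rate_gt0 : 0 < rate.
Proof. by rewrite divr_gt0// mulr_gt0// arcpden_gt0. Qed.

(** The time at which the solution starting from -N at time 0 vanishes. *)
Definition split_pt s : R := - tilt_prim s (- N) / rate.

Lemma split_ptE s : rate * split_pt s = - tilt_prim s (- N).
Proof. by rewrite /split_pt mulrC divfK// gt_eqF// rate_gt0. Qed.

Lemma split_ptLE s : rate * (L - split_pt s) = tilt_prim s N.
Proof.
have -> : rate * (L - split_pt s) = 2 * F N - rate * split_pt s.
  by rewrite /rate; field; rewrite gt_eqF.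
by rewrite split_ptE -(tilt_primB s N) opprK subrK.
Qed.

Lemma split_pt_bounds s : 0 < split_pt s < L.
Proof.
have k0 := rate_gt0; apply/andP; split.
  rewrite -(pmulr_rgt0 _ k0) split_ptE oppr_gt0 -(tilt_prim0 s).
  by apply: tilt_prim_lt; rewrite oppr_lt0.
rewrite -subr_gt0 -(pmulr_rgt0 _ k0) split_ptLE -(tilt_prim0 s).
exact: tilt_prim_lt.
Qed.

Lemma split_ptN s : split_pt (- s) = L - split_pt s.
Proof.
have k0 := rate_gt0; apply: (mulfI (lt0r_neq0 k0)).
by rewrite split_ptLE split_ptE tilt_prim_sym !opprK.
Qed.

Lemma split_pt_lipschitz s t : `|split_pt s - split_pt t| <= N ^+ 2 / rate * `|s - t|.
Proof.
have k0 := rate_gt0.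
pose U z := tilt_prim s z - tilt_prim t z.
have dU (z : R) : is_derive z 1 U (tilt s z - tilt t z).
  by apply: is_derive_sub; exact: is_derive_tilt_prim.
have : `|U N - U 0| <= `|s - t| * N * (N - 0).
  apply: (mean_value_norm_le (ltW N0) (is_derive_within dU)) => // z /andP[z0 zN].
  apply: le_trans (tilt_lipschitz s t z) _.
  by rewrite ler_wpM2l// gtr0_norm// ltW.
have -> : U N - U 0 = rate * (split_pt t - split_pt s).
  rewrite /U !tilt_prim0 -!split_ptLE; ring.
rewrite normrM (gtr0_norm k0) distrC subr0 => H.
by rewrite mulrAC ler_pdivlMr// mulrC; apply: le_trans H _; rewrite expr2 -mulrA mulrC.
Qed.

(** For large s the weight is at most 1/(s y) for y > 0, so the way from 0 to
N takes little time and Y vanishes late. *)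
Lemma split_pt_right d : 0 < d -> exists s0, forall s, s0 <= s -> L - d < split_pt s.
Proof.
move=> d0; have k0 := rate_gt0.
(* Up to e the weight is at most 1, beyond e at most 1/(s e). *)
pose e := Num.min N (rate * d / 2).
have e0 : 0 < e by rewrite lt_min N0 divr_gt0// mulr_gt0.
have eN : e <= N by rewrite ge_min lexx.
have ed : e <= rate * d / 2 by rewrite ge_min lexx orbT.
exists (4 * N / (e * (rate * d)) + 1) => s s0.
have kd0 : 0 < rate * d by rewrite mulr_gt0.
have q0 : 0 < e * (rate * d) by rewrite mulr_gt0.
have s1 : 0 < s by apply: lt_le_trans s0; rewrite ltr_wpDl// divr_ge0 ?(ltW q0)// mulr_ge0// ltW.
rewrite ltrBlDr -ltrBlDl -(ltr_pM2l k0) split_ptLE.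
have cG := is_derive_within (is_derive_tilt_prim s).
have h1 : tilt_prim s e - tilt_prim s 0 <= 1 * (e - 0).
  apply: (mean_value_le (ltW e0)) => [|x _|x /andP[x0 _]].
  - exact: cG.
  - exact: is_derive_tilt_prim.
  - by apply: tilt_le1; exact: ltW.
have h2 : tilt_prim s N - tilt_prim s e <= (s * e)^-1 * (N - e).
  apply: (mean_value_le eN) => [|x _|x /andP[x0 _]].
  - exact: cG.
  - exact: is_derive_tilt_prim.
  - apply: le_trans (tilt_le s1 (lt_trans e0 x0)) _.
    by rewrite lef_pV2 ?posrE ?mulr_gt0// ?(lt_trans e0)// ler_pM2l// ltW.
rewrite tilt_prim0 in h1.
have h3 : (s * e)^-1 * (N - e) < rate * d / 2.
  rewrite mulrC ltr_pdivrMr ?mulr_gt0//.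
  have : 4 * N < s * (e * (rate * d)).
    rewrite -ltr_pdivrMr//; apply: lt_le_trans s0; rewrite ltrDl//.
  nra.
lra.
Qed.

Lemma split_pt_left d : 0 < d -> exists s0, forall s, s <= s0 -> split_pt s < d.
Proof.
move=> /split_pt_right[s0 H]; exists (- s0) => s ss0.
have := H (- s); rewrite lerNr => /(_ ss0); rewrite split_ptN; lra.
Qed.

(** Y is the inverse of the primitive of the tilted weight after an affine
change of time. The equation for h is linear, with a coefficient that is a
function of Y times Y', hence h = exp(-H(Y)) for a primitive H in the variable
Y. *)
Lemma hardy_profile s : exists Y h : R -> R, [/\ Y (split_pt s) = 0,
  forall x, 0 <= x <= L -> is_derive x 1 Y (rate * (tilt s (Y x))^-1),
  forall x, 0 <= x <= L ->
    is_derive x 1 h (- (rate * h x * (s + spow p (Y x) / (p - 1)))) &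
  forall x, 0 < h x].
Proof.
have k0 := rate_gt0.
have [g [gK dg]] := exists_inverse (is_derive_tilt_prim s) (tilt_gt0 s).
have cspow : continuous (fun y => s + spow p y / (p - 1)).
  apply: continuous_add; first exact: continuous_cst.
  by apply: continuous_mul; [exact: continuous_spow|exact: continuous_cst].
have cH : continuous (fun y => (s + spow p y / (p - 1)) * tilt s y).
  by apply: continuous_mul => //; exact: continuous_tilt.
have [H [H0 dH]] := exists_primitive cH.
pose Y x := g (rate * (x - split_pt s)).
have dY x : 0 <= x <= L -> is_derive x 1 Y (rate * (tilt s (Y x))^-1).
  move=> /andP[x0 xL].
  have [|||y _ Ey] := @surjective_itv R (tilt_prim s) (- N) N (rate * (x - split_pt s)).
  - by rewrite -subr_ge0 opprK addr_ge0// ltW.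
  - by move=> z; apply: is_derive_continuous (is_derive_tilt_prim s z).
  - rewrite -split_ptLE -[tilt_prim s (- N)]opprK -split_ptE -mulrN !ler_pM2l//.
    by rewrite lerD2r xL andbT lerBrDr addNr.
  rewrite /Y -Ey gK mulrC.
  apply: (@is_derive_comp _ g (fun x => rate * (x - split_pt s))); first by rewrite -Ey.
  exact: is_derive_affine.
exists Y, (fun x => expR (- H (Y x))); split => //.
- by rewrite /Y subrr mulr0 -[in LHS](tilt_prim0 s) gK.
- move=> x x0L; have dYx := dY x x0L.
  have := @is_derive_comp _ expR (fun x => - H (Y x)) _ _ _ (is_derive_expR (- H (Y x)))
    (is_derive_opp (is_derive_comp (dH (Y x)) dYx)).
  congr (is_derive _ _ _ _); rewrite mulrN; congr (- _).
  move: (s + _) (tilt_gt0 s (Y x)) => q t0.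
  by field; rewrite gt_eqF.
- by move=> x; exact: expR_gt0.
Qed.

End Tilt.

(** * The two integral inequalities for the profile *)
Section Profile.
Context {R : realType} (p : R) (p1 : 1 < p) (L kappa s m : R) (Y h : R -> R).
Context (kappa0 : 0 < kappa) (m0L : 0 < m < L) (Ym : Y m = 0).
Context (dY : forall x, 0 <= x <= L -> is_derive x 1 Y (kappa * (tilt p s (Y x))^-1)).
Context (dh : forall x, 0 <= x <= L ->
    is_derive x 1 h (- (kappa * h x * (s + spow p (Y x) / (p - 1))))).
Context (h0 : forall x, 0 < h x).
Implicit Types x t a b : R.
Let mu := @lebesgue_measure R.

Let p0 : 0 < p. Proof. by apply: lt_trans p1. Qed.
Let p10 : 0 < p - 1. Proof. by rewrite subr_gt0. Qed.

Let within_sub (f : R -> R) a b : 0 <= a -> b <= L -> {within `[0, L], continuous f} ->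
  {within `[a, b], continuous f}.
Proof.
move=> a0 bL; apply: continuous_subspaceW => x; rewrite /= !in_itv/= => /andP[ax xb].
by rewrite (le_trans a0 ax) (le_trans xb bL).
Qed.

Lemma within_profileY : {within `[0, L], continuous Y}.
Proof. exact: is_derive_itv_within dY. Qed.

Lemma within_profileh : {within `[0, L], continuous h}.
Proof. exact: is_derive_itv_within dh. Qed.

Lemma profileY_le a b : 0 <= a -> a <= b -> b <= L -> Y a <= Y b.
Proof.
move=> a0 ab bL; rewrite -subr_ge0 -(mul0r (b - a)).
apply: (mean_value_ge ab (within_sub a0 bL within_profileY)).
  by move=> x /andP[ax xb]; apply: dY; rewrite (le_trans a0 (ltW ax)) (le_trans (ltW xb)).
by move=> x _; rewrite mulr_ge0 ?invr_ge0 ?ltW ?tilt_gt0.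
Qed.

Definition profile_bound x : R := `|Y x| * h x / kappa.

Lemma profile_bound_gt0 x : 0 <= x <= L -> x != m -> 0 < profile_bound x.
Proof.
move=> /andP[x0 xL] xm; rewrite !mulr_gt0 ?invr_gt0// normr_gt0.
have /andP[m0 mL] := m0L.
have [z _] : exists2 z, (0 <= z <= L) & (Y x - Y m = kappa * (tilt p s (Y z))^-1 * (x - m)).
  move: xm; rewrite neq_lt => /orP[xm|mx].
    have dY' z : z \in `]x, m[%R -> is_derive z 1 Y (kappa * (tilt p s (Y z))^-1).
      rewrite in_itv/= => /andP[xz zm]; apply: dY.
      by rewrite (le_trans x0 (ltW xz)) (le_trans (ltW zm))// ltW.
    have [z] := MVT xm dY' (within_sub x0 (ltW mL) within_profileY).
    rewrite in_itv/= => /andP[xz zm] E; exists z.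
      by rewrite (le_trans x0 (ltW xz)) (le_trans (ltW zm))// ltW.
    by rewrite -[LHS]opprB E -mulrN opprB.
  have dY' z : z \in `]m, x[%R -> is_derive z 1 Y (kappa * (tilt p s (Y z))^-1).
    rewrite in_itv/= => /andP[xz zm]; apply: dY.
    by rewrite (le_trans (ltW m0) (ltW xz)) (le_trans (ltW zm)).
  have [z] := MVT mx dY' (within_sub (ltW m0) xL within_profileY).
  rewrite in_itv/= => /andP[xz zm] E; exists z => //.
  by rewrite (le_trans (ltW m0) (ltW xz)) (le_trans (ltW zm)).
rewrite Ym subr0 => ->; rewrite !mulf_neq0//; last by rewrite subr_eq0.
  by rewrite gt_eqF.
by rewrite invr_neq0// gt_eqF// tilt_gt0.
Qed.

(** (Y h/kappa)' = h (1/tilt s Y - s Y - |Y|^p/(p-1)) >= h by [tiltV_ge]. As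
Y m = 0, the integral of h between m and x is at most [profile_bound] x. *)
Lemma integral_profileh a b : 0 <= a -> a <= b -> b <= L ->
  (\int[mu]_(x in `[a, b]) (h x)%:E <= (Y b * h b / kappa - Y a * h a / kappa)%:E)%E.
Proof.
move=> a0 ab bL.
pose d x := kappa^-1 * (kappa * (tilt p s (Y x))^-1 * h x +
  Y x * - (kappa * h x * (s + spow p (Y x) / (p - 1)))).
have sub x : a <= x <= b -> 0 <= x <= L.
  by move=> /andP[ax xb]; rewrite (le_trans a0 ax) (le_trans xb).
have dG x : a <= x <= b -> is_derive x 1 (fun x => kappa^-1 * (Y x * h x)) (d x).
  move=> /sub x0L; apply: is_derive_mulc.
  exact: is_derive_mul (dY x0L) (dh x0L).
have cY := within_sub a0 bL within_profileY.
have ch := within_sub a0 bL within_profileh.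
rewrite -!mulrA ![_ * kappa^-1]mulrC mulrCA [X in (_ <= (_ - X)%:E)%E]mulrCA.
apply: (integral_le_derive ab dG) => //.
- apply: withinM; first exact: within_cst.
  rewrite /=.
  have c1 : {within `[a, b], continuous (fun x => kappa * (tilt p s (Y x))^-1)}.
    apply: (@within_comp _ (fun y => kappa * (tilt p s y)^-1)) => //.
    apply: continuous_mul; first exact: continuous_cst.
    apply: continuous_inv => [|y]; first exact: continuous_tilt.
    by rewrite gt_eqF// tilt_gt0.
  have c2 : {within `[a, b], continuous (fun x => s + spow p (Y x) / (p - 1))}.
    apply: (@within_comp _ (fun y => s + spow p y / (p - 1))) => //.
    apply: continuous_add; first exact: continuous_cst.
    by apply: continuous_mul; [exact: continuous_spow|exact: continuous_cst].
  apply: withinD; first exact: withinM.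
  apply: withinM => //; apply: withinN; apply: withinM => //; apply: withinM => //.
  exact: within_cst.
- move=> x _; rewrite ltW//= /d.
  have -> : kappa^-1 * (kappa * (tilt p s (Y x))^-1 * h x +
      Y x * - (kappa * h x * (s + spow p (Y x) / (p - 1)))) =
      h x * ((tilt p s (Y x))^-1 - s * Y x - spow p (Y x) * Y x / (p - 1)).
    by field; rewrite !gt_eqF// tilt_gt0.
  apply: ler_peMr; rewrite ?spow_mul//; first exact: ltW.
  have := tiltV_ge p1 s (Y x); rewrite /pden; lra.
Qed.

(* The logarithmic derivative of h^(p-1) is -(p-1) kappa s - kappa spow Y; the
   exponential removes its first term. *)
Let P x := h x `^ (p - 1) * expR ((p - 1) * kappa * s * x).

Let dP x : 0 <= x <= L -> is_derive x 1 P (- (kappa * spow p (Y x) * P x)).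
Proof.
move=> x0L; have d1 : is_derive x 1 (fun x => h x `^ (p - 1))
    ((p - 1) * h x `^ (p - 1 - 1) * - (kappa * h x * (s + spow p (Y x) / (p - 1)))).
  apply: (@is_derive_comp _ (fun z => z `^ (p - 1)) h); last exact: dh.
  by apply: is_derive1_powR.
have d2 : is_derive x 1 (fun x => expR ((p - 1) * kappa * s * x))
    (expR ((p - 1) * kappa * s * x) * ((p - 1) * kappa * s)).
  apply: (@is_derive_comp _ expR (fun x => (p - 1) * kappa * s * x)).
  exact: is_derive_linear.
have := is_derive_mul d1 d2; congr (is_derive _ _ _ _); rewrite /P.
have -> : h x `^ (p - 1) = h x `^ (p - 1 - 1) * h x.
  rewrite -[X in _ * X](powRr1 (ltW (h0 x))) -powRD ?subrK//.
  by apply/implyP => _; rewrite gt_eqF.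
move: (h x) (expR _) (spow p _) (h x `^ _) => A B C D.
by field; rewrite gt_eqF.
Qed.

Let P0 x : 0 < P x. Proof. by rewrite mulr_gt0 ?powR_gt0 ?expR_gt0. Qed.

Let boundP x : profile_bound x `^ (p - 1) * expR ((p - 1) * kappa * s * x) =
  kappa `^ (1 - p) * `|spow p (Y x)| * P x.
Proof.
rewrite /profile_bound /P norm_spow// !powRM ?mulr_ge0 ?invr_ge0 ?(ltW (h0 x)) ?(ltW kappa0)//.
rewrite -powR_inv1 ?(ltW kappa0)// -powRrM mulN1r opprB; ring.
Qed.

Let cdP a b : 0 <= a -> b <= L ->
  {within `[a, b], continuous (fun x => - (kappa * spow p (Y x) * P x))}.
Proof.
move=> a0 bL; apply: within_sub => //.
have cP : {within `[0, L], continuous P} by exact: is_derive_itv_within dP.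
have cY : {within `[0, L], continuous (fun x => kappa * spow p (Y x))}.
  apply: (@within_comp _ (fun y => kappa * spow p y)); last exact: within_profileY.
  by apply: continuous_mul; [exact: continuous_cst|exact: continuous_spow].
exact: (withinN (withinM cY cP)).
Qed.

Let kappaE : kappa `^ (1 - p) = kappa `^ (- p) * kappa.
Proof.
rewrite -[X in _ * X](powRr1 (ltW kappa0)) -powRD 1?addrC//.
by apply/implyP => _; rewrite gt_eqF.
Qed.

(** The integrand is -kappa^(-p) P' with P = h^(p-1) exp((p-1) kappa s x), which
decreases after m because Y >= 0 there. *)
Lemma integral_profile_bound_right t : m <= t <= L ->
  (\int[mu]_(x in `[t, L]) (profile_bound x `^ (p - 1) *
     expR ((p - 1) * kappa * s * x))%:E <=
   (kappa `^ (- p) * h t `^ (p - 1) * expR ((p - 1) * kappa * s * t))%:E)%E.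
Proof.
move=> /andP[mt tL]; have /andP[m0 mL] := m0L; have t0 := le_trans (ltW m0) mt.
under eq_integral => x.
  rewrite inE/= in_itv/= => /andP[tx xL].
  have Y0 : 0 <= Y x by rewrite -Ym profileY_le ?(le_trans mt)// ltW.
  rewrite boundP ger0_norm; last by rewrite spow_ge0E// powR_ge0.
  have -> : kappa `^ (1 - p) * spow p (Y x) * P x =
    - kappa `^ (- p) * - (kappa * spow p (Y x) * P x) by rewrite kappaE; ring.
  over.
have dE x : t <= x <= L -> is_derive x 1 (fun x => - kappa `^ (- p) * P x)
    (- kappa `^ (- p) * - (kappa * spow p (Y x) * P x)).
  move=> /andP[x1 x2]; apply: is_derive_mulc; apply: dP.
  by rewrite (le_trans t0 x1).
rewrite (integral_derive tL dE).
  have := P0 L; have := powR_gt0 (- p) kappa0; rewrite lee_fin -mulrA -/(P t).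
  nra.
apply: withinM; first exact: within_cst.
exact: cdP.
Qed.

(** The mirror image of [integral_profile_bound_right]: before m, P increases. *)
Lemma integral_profile_bound_left t : 0 <= t <= m ->
  (\int[mu]_(x in `[0%R, t]) (profile_bound x `^ (p - 1) *
     expR ((p - 1) * kappa * s * x))%:E <=
   (kappa `^ (- p) * h t `^ (p - 1) * expR ((p - 1) * kappa * s * t))%:E)%E.
Proof.
move=> /andP[t0 tm]; have /andP[m0 mL] := m0L; have tL := le_trans tm (ltW mL).
under eq_integral => x.
  rewrite inE/= in_itv/= => /andP[x0 xt].
  have Y0 : Y x <= 0 by rewrite -Ym profileY_le ?(le_trans xt)// ltW.
  have -> : profile_bound x `^ (p - 1) * expR ((p - 1) * kappa * s * x) =
    kappa `^ (- p) * - (kappa * spow p (Y x) * P x).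
    rewrite boundP ler0_norm; last by rewrite -(spow0 p) spow_le.
    by rewrite kappaE; ring.
  over.
have dE x : 0 <= x <= t -> is_derive x 1 (fun x => kappa `^ (- p) * P x)
    (kappa `^ (- p) * - (kappa * spow p (Y x) * P x)).
  move=> /andP[x1 x2]; apply: is_derive_mulc; apply: dP.
  by rewrite x1 (le_trans x2).
rewrite (integral_derive t0 dE).
  have := P0 0; have := powR_gt0 (- p) kappa0; rewrite lee_fin -mulrA -/(P t).
  nra.
apply: withinM; first exact: within_cst.
exact: cdP.
Qed.

End Profile.

(** * A Schur test *)
Section Schur.
Context {R : realType} (p : R) (p1 : 1 < p).
Let mu := @lebesgue_measure R.
Let T := measurableTypeR R.
Let p0 : 0 < p. Proof. by apply: lt_trans p1. Qed.

(** Hoelder's inequality for the average of v/h with respect to the weight e h.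
It follows by integrating the tangent inequality at the point W/Phi. *)
Lemma jensen_weighted (v h e : T -> R) (W Phi : R) :
  measurable_fun setT v -> measurable_fun setT h -> measurable_fun setT e ->
  (forall t, 0 <= v t) -> (forall t, 0 < h t) -> (forall t, 0 <= e t) ->
  (\int[mu]_t (e t * v t)%:E = W%:E)%E ->
  (\int[mu]_t (e t * h t)%:E <= Phi%:E)%E -> 0 < Phi ->
  ((W `^ p)%:E <= (Phi `^ (p - 1))%:E * \int[mu]_t (e t * (v t `^ p * h t `^ (1 - p)))%:E)%E.
Proof.
move=> mv mh me v0 h0 e0 WE Phi_ge Phi0.
set A := (\int[mu]_t (e t * (v t `^ p * h t `^ (1 - p)))%:E)%E.
have A0 : (0 <= A)%E.
  by apply: integral_ge0 => t _; rewrite lee_fin !mulr_ge0// powR_ge0.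
have W0 : 0 <= W.
  by rewrite -lee_fin -WE; apply: integral_ge0 => t _; rewrite lee_fin mulr_ge0.
have [W00|Wn0] := eqVneq W 0.
  by rewrite W00 powR0 ?gt_eqF// mule_ge0// lee_fin powR_ge0.
have {}W0 : 0 < W by rewrite lt_def Wn0.
pose z := W / Phi; have z0 : 0 < z by rewrite divr_gt0.
have pw t : p * z `^ (p - 1) * v t <= v t `^ p * h t `^ (1 - p) + (p - 1) * z `^ p * h t.
  have := norm_powR_tangent p1 z (v t / h t).
  rewrite (gtr0_norm z0) ger0_norm ?divr_ge0 ?(ltW (h0 t))//.
  rewrite spow_ge0E ?(ltW z0)// => H.
  have hv : (v t / h t) `^ p * h t = v t `^ p * h t `^ (1 - p).
    rewrite powRM ?invr_ge0 ?(ltW (h0 t))// -powR_inv1 ?(ltW (h0 t))// -powRrM mulN1r.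
    rewrite -mulrA -[X in _ * (_ * X)](powRr1 (ltW (h0 t))) -powRD; last first.
      by apply/implyP => _; rewrite gt_eqF.
    by rewrite addrC.
  have zp : z * z `^ (p - 1) = z `^ p by rewrite mulr_powRB1// ltW.
  rewrite -hv -zp; have := ler_wpM2r (ltW (h0 t)) H; rewrite -zp.
  have -> : (z * z `^ (p - 1) + p * z `^ (p - 1) * (v t / h t - z)) * h t =
    p * z `^ (p - 1) * v t - (p - 1) * (z * z `^ (p - 1)) * h t.
    by field; rewrite gt_eqF.
  lra.
have mP (q : R) (g : T -> R) : measurable_fun setT g -> measurable_fun setT (fun t => g t `^ q).
  by move=> mg; exact: (measurableT_comp (measurable_powR q) mg).
have HA : ((p * z `^ (p - 1) * W)%:E <= A + ((p - 1) * z `^ p * Phi)%:E)%E.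
  rewrite EFinM -WE -ge0_integralZl_EFin//; last 3 first.
  - by move=> t _; rewrite lee_fin mulr_ge0.
  - by apply/measurable_EFinP; exact: measurable_funM.
  - by rewrite !mulr_ge0 ?powR_ge0// ltW.
  apply: (@le_trans _ _ (\int[mu]_t ((e t * (v t `^ p * h t `^ (1 - p)))%:E +
      ((p - 1) * z `^ p)%:E * (e t * h t)%:E))%E).
    apply: ge0_le_integral => //.
    - by move=> t _; rewrite -EFinM lee_fin !mulr_ge0 ?powR_ge0// ltW.
    - apply: measurable_funeM; apply/measurable_EFinP; exact: measurable_funM.
    - apply: emeasurable_funD.
        apply/measurable_EFinP; apply: measurable_funM => //.
        by apply: measurable_funM; exact: mP.
      apply: measurable_funeM; apply/measurable_EFinP; exact: measurable_funM.
    - move=> t _; rewrite -!EFinM -EFinD lee_fin.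
      have := ler_wpM2l (e0 t) (pw t); lra.
  have pz0 : 0 <= (p - 1) * z `^ p by rewrite mulr_ge0 ?powR_ge0// subr_ge0 ltW.
  rewrite ge0_integralD//; last 4 first.
  - by move=> t _; rewrite lee_fin !mulr_ge0 ?powR_ge0.
  - apply/measurable_EFinP; apply: measurable_funM => //.
    by apply: measurable_funM; exact: mP.
  - by move=> t _; rewrite -EFinM lee_fin mulr_ge0// mulr_ge0// ltW.
  - apply: measurable_funeM; apply/measurable_EFinP; exact: measurable_funM.
  rewrite leeD2l// ge0_integralZl_EFin//; last 2 first.
  - by move=> t _; rewrite lee_fin mulr_ge0// ltW.
  - by apply/measurable_EFinP; exact: measurable_funM.
  by rewrite [leRHS]EFinM lee_pmul2l// lte_fin mulr_gt0 ?powR_gt0// subr_gt0.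
move: HA A0; case: A => [a| |]//.
- rewrite -EFinD -EFinM !lee_fin => HA a0.
  have zp : z * z `^ (p - 1) = z `^ p by rewrite mulr_powRB1// ltW.
  have WzP : W = z * Phi by rewrite /z divfK// gt_eqF.
  have ha : z `^ (p - 1) * W <= a.
    by move: HA; rewrite -zp WzP; lra.
  have -> : W `^ p = Phi `^ (p - 1) * (z `^ (p - 1) * W).
    by rewrite mulrA -powRM ?(ltW z0) ?(ltW Phi0)// [Phi * z]mulrC -WzP mulrC mulr_powRB1// ltW.
  by rewrite ler_wpM2l// powR_ge0.
- by move=> _ _; rewrite gt0_muley ?leey// lte_fin powR_gt0.
Qed.

Lemma measurable_section_integral (S : set (T * T)) (v W : T -> R) :
  measurable S -> measurable_fun setT v -> (forall t, 0 <= v t) ->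
  (forall x, \int[mu]_t (\1_S (x, t) * v t)%:E = (W x)%:E)%E ->
  measurable_fun setT W.
Proof.
move=> mS mv v0 WE.
have : measurable_fun setT (fun x => \int[mu]_t (\1_S (x, t) * v t)%:E)%E.
  apply: (@measurable_fun_fubini_tonelli_F _ _ T T R mu (fun z => (\1_S z * v z.2)%:E)).
  - apply/measurable_EFinP; apply: measurable_funM; first exact: measurable_indic.
    exact: (measurableT_comp mv measurable_snd).
  - by move=> z; rewrite lee_fin mulr_ge0.
by under eq_fun do rewrite WE; move/measurable_EFinP.
Qed.

(** Apply [jensen_weighted] for each x, integrate against f, exchange the
integrals and apply the dual condition. *)
Lemma schur_test (S : set (T * T)) (v h f Phi W : T -> R) (C : R) :
  measurable S ->
  measurable_fun setT v -> measurable_fun setT h -> measurable_fun setT f ->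
  measurable_fun setT Phi ->
  (forall t, 0 <= v t) -> (forall t, 0 < h t) -> (forall t, 0 <= f t) ->
  (forall t, 0 <= Phi t) -> 0 <= C ->
  (forall x, \int[mu]_t (\1_S (x, t) * v t)%:E = (W x)%:E)%E ->
  (forall x, f x != 0 -> W x != 0 ->
    0 < Phi x /\ (\int[mu]_t (\1_S (x, t) * h t)%:E <= (Phi x)%:E)%E) ->
  (forall t, v t != 0 ->
    (\int[mu]_x (\1_S (x, t) * (Phi x `^ (p - 1) * f x))%:E <=
      (C * h t `^ (p - 1) * f t)%:E)%E) ->
  (\int[mu]_x (W x `^ p * f x)%:E <= C%:E * \int[mu]_t (v t `^ p * f t)%:E)%E.
Proof.
move=> mS mv mh mf mPhi v0 h0 f0 Phi0 C0 WE HPhi Hdual.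
have mP (q : R) (g : T -> R) : measurable_fun setT g -> measurable_fun setT (fun t => g t `^ q).
  by move=> mg; exact: (measurableT_comp (measurable_powR q) mg).
have m1 : measurable_fun setT (\1_S : T * T -> R) by exact: measurable_indic.
have mfst (g : T -> R) : measurable_fun setT g -> measurable_fun setT (fun z : T * T => g z.1).
  by move=> mg; exact: (measurableT_comp mg measurable_fst).
have msnd (g : T -> R) : measurable_fun setT g -> measurable_fun setT (fun z : T * T => g z.2).
  by move=> mg; exact: (measurableT_comp mg measurable_snd).
pose K (z : T * T) : R := \1_S z * (Phi z.1 `^ (p - 1) * f z.1) * (v z.2 `^ p * h z.2 `^ (1 - p)).
have K0 z : 0 <= K z by rewrite !mulr_ge0 ?powR_ge0.
have mK : measurable_fun setT K.
  apply: measurable_funM.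
    apply: measurable_funM => //; apply: (mfst (fun x => Phi x `^ (p - 1) * f x)).
    by apply: measurable_funM => //; exact: mP.
  apply: (msnd (fun t => v t `^ p * h t `^ (1 - p))).
  by apply: measurable_funM; exact: mP.
have mEK : measurable_fun setT (EFin \o K) by exact/measurable_EFinP.
have EK0 z : (0 <= (EFin \o K) z)%E by rewrite lee_fin.
have m1x x : measurable_fun setT (fun t : T => \1_S (x, t) : R).
  exact: (measurableT_comp m1 (measurable_pair1 x)).
have m1t t : measurable_fun setT (fun x : T => \1_S (x, t) : R).
  exact: (measurableT_comp m1 (measurable_pair2 t)).
have W0 x : 0 <= W x.
  by rewrite -lee_fin -WE; apply: integral_ge0 => t _; rewrite lee_fin mulr_ge0.
have mW := measurable_section_integral mS mv v0 WE.
apply: (@le_trans _ _ (\int[mu]_x \int[mu]_t (EFin \o K) (x, t))%E).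
  apply: ge0_le_integral => //.
  - by move=> x _; rewrite lee_fin mulr_ge0// powR_ge0.
  - by apply/measurable_EFinP; apply: measurable_funM => //; exact: mP.
  - exact: measurable_fun_fubini_tonelli_F.
  move=> x _; have [->|fx] := eqVneq (f x) 0.
    by rewrite mulr0; apply: integral_ge0.
  have [->|Wx] := eqVneq (W x) 0.
    by rewrite powR0 ?mul0r ?gt_eqF//; apply: integral_ge0.
  have [Px Px1] := HPhi x fx Wx.
  have := jensen_weighted mv mh (m1x x) v0 h0 _ (WE x) Px1 Px.
  move=> /(_ _)/wrap[//|J].
  have -> : (\int[mu]_t (EFin \o K) (x, t) =
     (f x)%:E * ((Phi x `^ (p - 1))%:E * \int[mu]_t (\1_S (x, t) * (v t `^ p * h t `^ (1 - p)))%:E))%E.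
    rewrite muleA -EFinM -ge0_integralZl_EFin//; last 3 first.
    - by move=> t _; rewrite lee_fin !mulr_ge0 ?powR_ge0.
    - apply/measurable_EFinP; apply: measurable_funM => //.
      by apply: measurable_funM; exact: mP.
    - by rewrite mulr_ge0// powR_ge0.
    by apply: eq_integral => t _; rewrite -EFinM /= /K/=; congr (_%:E); ring.
  by rewrite mulrC EFinM lee_wpmul2l// lee_fin.
rewrite fubini_tonelli// -ge0_integralZl_EFin//; last 2 first.
- by move=> t _; rewrite lee_fin mulr_ge0// powR_ge0.
- by apply/measurable_EFinP; apply: measurable_funM => //; exact: mP.
apply: ge0_le_integral => //.
- by move=> t _; apply: integral_ge0.
- exact: measurable_fun_fubini_tonelli_G.
- apply: measurable_funeM; apply/measurable_EFinP; apply: measurable_funM => //; exact: mP.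
move=> t _; have [vt|vt] := eqVneq (v t) 0.
  rewrite integral0_eq; first by rewrite -EFinM lee_fin !mulr_ge0 ?powR_ge0.
  by move=> x _; rewrite /= /K/= vt powR0 ?gt_eqF// mul0r mulr0.
have -> : (\int[mu]_x (EFin \o K) (x, t) = (v t `^ p * h t `^ (1 - p))%:E *
    \int[mu]_x (\1_S (x, t) * (Phi x `^ (p - 1) * f x))%:E)%E.
  rewrite -ge0_integralZl_EFin//; last 3 first.
  - by move=> x _; rewrite lee_fin !mulr_ge0 ?powR_ge0.
  - apply/measurable_EFinP; apply: measurable_funM => //.
    by apply: measurable_funM => //; exact: mP.
  - by rewrite mulr_ge0// powR_ge0.
  by apply: eq_integral => x _; rewrite -EFinM /= /K/=; congr (_%:E); ring.
apply: le_trans (lee_wpmul2l _ (Hdual t vt)) _; first by rewrite lee_fin mulr_ge0 ?powR_ge0.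
rewrite -!EFinM lee_fin.
have hh : h t `^ (1 - p) * h t `^ (p - 1) = 1.
  rewrite -powRD; last by apply/implyP => _; rewrite gt_eqF.
  have -> : 1 - p + (p - 1) = 0 by ring.
  by rewrite powRr0.
have -> : v t `^ p * h t `^ (1 - p) * (C * h t `^ (p - 1) * f t) =
  C * (v t `^ p * f t) * (h t `^ (1 - p) * h t `^ (p - 1)) by ring.
by rewrite hh mulr1.
Qed.

End Schur.

(** * Smooth plateau functions *)
Section Flat.
Context {R : realType}.
Implicit Types (k j n : nat) (x y a b c : R).

(** The functions x^(-k) exp(-1/x), extended by 0. Their linear span is stable
under differentiation ([is_derive_flat]), so they are smooth; k = 0 is the usual
flat function. *)
Definition flat k x : R := if 0 < x then x^-1 ^+ k * expR (- x^-1) else 0.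

Lemma flat_le0 k x : x <= 0 -> flat k x = 0.
Proof. by rewrite /flat ltNge => ->. Qed.

Lemma flat_ge0 k x : 0 <= flat k x.
Proof.
rewrite /flat; case: ifPn => // x0.
by rewrite mulr_ge0 ?exprn_ge0 ?invr_ge0 ?ltW// expR_gt0.
Qed.

Lemma flat_gt0 k x : 0 < x -> 0 < flat k x.
Proof. by move=> x0; rewrite /flat x0 mulr_gt0 ?exprn_gt0 ?invr_gt0 ?expR_gt0. Qed.

Lemma flat_mul k x : flat k.+1 x * x = flat k x.
Proof.
rewrite /flat; case: ifPn => x0; last by rewrite mul0r.
by rewrite exprS; field; rewrite gt_eqF.
Qed.

Lemma flat_bound k x : `|flat k x| <= k.+1`!%:R * `|x|.
Proof.
rewrite ger0_norm ?flat_ge0// /flat; case: ifPn => x0; last by rewrite mulr_ge0.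
rewrite (gtr0_norm x0).
have y0 : 0 < x^-1 by rewrite invr_gt0.
have := expR_ge1Dxn k (ltW y0).
have f0 : 0 < k.+1`!%:R :> R by rewrite ltr0n fact_gt0.
rewrite expRN; move: (expR_gt0 x^-1); move: (expR _) => e e0 H.
rewrite ler_pdivrMr// -[leLHS](mulfK (lt0r_neq0 y0)) -exprSr -mulrA invrK.
have -> : k.+1`!%:R * (x * e) = k.+1`!%:R * e * x by ring.
rewrite ler_pM2r//.
by rewrite -ler_pdivrMl// mulrC; apply: le_trans H; rewrite lerDr.
Qed.

Lemma is_derive_flat k x : is_derive x 1 (flat k) (flat k.+2 x - k%:R * flat k.+1 x).
Proof.
have [x0|x0|->] := ltgtP x 0.
- rewrite !flat_le0 ?ltW// mulr0 subr0.
  have d : is_derive x 1 (cst 0 : R -> R) 0 by exact: is_derive_cst.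
  apply: near_eq_is_derive d => //; near=> z; rewrite /= flat_le0// ltW//.
  by near: z; exact: lt_nbhsl.
- have xn0 := lt0r_neq0 x0.
  have dV : is_derive x 1 (fun z : R => z^-1) (- x ^- 2).
    have := @is_deriveV _ id x 1 1 xn0 (is_derive_id x 1).
    by rewrite /GRing.scale/= mulr1.
  have d1 : is_derive x 1 (fun z : R => z^-1 ^+ k) (k%:R * x^-1 ^+ k.-1 * (- x ^- 2)).
    apply: (@is_derive_comp _ (fun z => z ^+ k) (fun z => z^-1)) => //.
    apply: DeriveDef; first exact: exprn_derivable.
    by rewrite exp_derive /GRing.scale/= mulr1.
  have d2 : is_derive x 1 (fun z : R => expR (- z^-1)) (expR (- x^-1) * (- - x ^- 2)).
    exact: (@is_derive_comp _ expR (fun z => - z^-1) _ _ _ (is_derive_expR _) (is_derive_opp dV)).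
  have d := is_derive_mul d1 d2.
  have E : k%:R * x^-1 ^+ k.-1 * (- x ^- 2) * expR (- x^-1) +
    x^-1 ^+ k * (expR (- x^-1) * (- - x ^- 2)) = flat k.+2 x - k%:R * flat k.+1 x.
    rewrite /flat x0; case: k {d1 d} => [|k] /=.
      by rewrite !mul0r subr0 !exprS expr0; field.
    by rewrite !exprS; field.
  rewrite -E; apply: near_eq_is_derive d => //; near=> z; rewrite /flat ifT//.
  by near: z; exact: lt_nbhsr.
- rewrite !flat_le0// mulr0 subr0; apply/is_derive1_caratheodory.
  exists (flat k.+1); split; last by rewrite flat_le0.
    by move=> z; rewrite (flat_le0 k (lexx 0)) !subr0 flat_mul.
  apply/cvgrPdist_lt => e e0.
  have d0 : 0 < e / k.+2`!%:R by rewrite divr_gt0// ltr0n fact_gt0.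
  apply: (filterS _ (nbhsx_ballx (0 : R) _ d0)) => z.
  rewrite /ball/= sub0r normrN => zd.
  rewrite flat_le0// sub0r normrN; apply: le_lt_trans (flat_bound _ _) _.
  by rewrite mulrC -ltr_pdivlMr// ltr0n fact_gt0.
Unshelve. all: by end_near. Qed.

Lemma continuous_flat k : continuous (flat k).
Proof. by move=> x; apply: is_derive_continuous (is_derive_flat k x). Qed.

Definition bump x : R := flat 0 x * flat 0 (1 - x).

Let continuous_bump : continuous bump.
Proof.
apply: continuous_mul; first exact: continuous_flat.
move=> x; apply: (@continuous_comp _ _ _ (fun x => 1 - x) (flat 0)); last exact: continuous_flat.
by apply: continuousB; [exact: cst_continuous|exact: cvg_id].
Qed.

Lemma bump_ge0 x : 0 <= bump x.
Proof. by rewrite mulr_ge0 ?flat_ge0. Qed.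

Lemma bump_out x : x <= 0 \/ 1 <= x -> bump x = 0.
Proof.
move=> [x0|x1]; rewrite /bump; first by rewrite flat_le0// mul0r.
by rewrite [flat _ (1 - x)]flat_le0 ?mulr0// subr_le0.
Qed.

Lemma bump_le1 x : bump x <= 1.
Proof.
have H y : flat 0 y <= 1.
  rewrite /flat; case: ifPn => // y0; rewrite expr0 mul1r expR_le1 oppr_le0.
  by rewrite invr_ge0 ltW.
by rewrite mulr_ile1 ?flat_ge0.
Qed.

Definition bump_prim : R -> R := projT1 (cid (exists_primitive continuous_bump)).

Lemma bump_prim0 : bump_prim 0 = 0.
Proof. by rewrite /bump_prim; case: cid => G []. Qed.

Lemma is_derive_bump_prim x : is_derive x 1 bump_prim (bump x).
Proof. by rewrite /bump_prim; case: cid => G [? ?] /=. Qed.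

Definition bump_mass : R := bump_prim 1.

Let bump_prim_const a b : a <= b -> (forall x, a < x < b -> bump x = 0) ->
  bump_prim a = bump_prim b.
Proof.
move=> ab H; apply/eqP; rewrite eq_sym -subr_eq0 -normr_le0.
rewrite -[leRHS](mul0r (b - a)).
apply: (mean_value_norm_le ab (is_derive_within is_derive_bump_prim)).
  by move=> x _; exact: is_derive_bump_prim.
by move=> x /H ->; rewrite normr0.
Qed.

Lemma bump_mass_gt0 : 0 < bump_mass.
Proof.
rewrite /bump_mass -bump_prim0 -subr_gt0.
have dE (x : R) : x \in `]0, 1[%R -> is_derive x 1 bump_prim (bump x).
  by move=> _; exact: is_derive_bump_prim.
have [c] := MVT ltr01 dE (is_derive_within is_derive_bump_prim).
rewrite in_itv/= => /andP[c0 c1] ->.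
by rewrite subr0 mulr1 mulr_gt0 ?flat_gt0// subr_gt0.
Qed.

Definition step x : R := bump_prim x / bump_mass.

Lemma is_derive_step x : is_derive x 1 step (bump x / bump_mass).
Proof.
rewrite /step mulrC; under eq_fun do rewrite mulrC.
by apply: is_derive_mulc; exact: is_derive_bump_prim.
Qed.

Lemma step_le0 x : x <= 0 -> step x = 0.
Proof.
move=> x0; rewrite /step (bump_prim_const x0) ?bump_prim0 ?mul0r// => z /andP[_ z0].
by rewrite bump_out//; left; exact: ltW.
Qed.

Lemma step_ge1 x : 1 <= x -> step x = 1.
Proof.
move=> x1; rewrite /step -(bump_prim_const x1) ?mulfV ?gt_eqF ?bump_mass_gt0//.
by move=> z /andP[z0 _]; rewrite bump_out//; right; exact: ltW.
Qed.

Lemma step_homo : {homo step : x y / x <= y}.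
Proof.
move=> x y xy; rewrite -subr_ge0 -(mul0r (y - x)).
apply: (mean_value_ge xy (is_derive_within is_derive_step)).
  by move=> z _; exact: is_derive_step.
by move=> z _; rewrite divr_ge0 ?bump_ge0// ltW// bump_mass_gt0.
Qed.

Lemma step_01 x : 0 <= step x <= 1.
Proof.
apply/andP; split; [case: (leP x 0) => [/step_le0 ->//|/ltW /step_homo]|].
  by rewrite (step_le0 (lexx 0)).
by case: (leP 1 x) => [/step_ge1 ->//|/ltW /step_homo]; rewrite (step_ge1 (lexx 1)).
Qed.

(** A class of functions stable under differentiation that contains the plateau
functions: smoothness of its members then follows by induction on the order. *)
Inductive bumpy : (R -> R) -> Prop :=
| bumpy_flat c a b j k :
    bumpy (fun x => c * (flat j (a * (x - b)) * flat k (1 - a * (x - b))))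
| bumpy_step c a b : bumpy (fun x => c * step (a * (x - b)))
| bumpy_add f g : bumpy f -> bumpy g -> bumpy (fun x => f x + g x).

Lemma bumpy_derive f : bumpy f ->
  exists2 g, bumpy g & forall x, is_derive x 1 f (g x).
Proof.
elim=> {f} [c a b j k|c a b|f g _ [f' bf' df'] _ [g' bg' dg']].
- exists (fun x => (c * a * (flat j.+2 (a * (x - b)) * flat k (1 - a * (x - b))) +
     - (c * a * j%:R) * (flat j.+1 (a * (x - b)) * flat k (1 - a * (x - b)))) +
     (- (c * a) * (flat j (a * (x - b)) * flat k.+2 (1 - a * (x - b))) +
     c * a * k%:R * (flat j (a * (x - b)) * flat k.+1 (1 - a * (x - b))))).
    by do 2?apply: bumpy_add; exact: bumpy_flat.
  move=> x; have da := is_derive_affine a b x.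
  have d1 := @is_derive_comp _ (flat j) (fun x => a * (x - b)) _ _ _ (is_derive_flat j (a * (x - b))) da.
  have db := is_derive_sub (is_derive_cst (1 : R) x 1) da.
  have d2 := @is_derive_comp _ (flat k) (fun x => 1 - a * (x - b)) _ _ _
    (is_derive_flat k (1 - a * (x - b))) db.
  have := is_derive_mulc c (is_derive_mul d1 d2).
  by congr (is_derive _ _ _ _); ring.
- exists (fun x => c * a / bump_mass * (flat 0 (a * (x - b)) * flat 0 (1 - a * (x - b)))).
    exact: bumpy_flat.
  move=> x; have := is_derive_mulc c (@is_derive_comp _ step (fun x => a * (x - b)) _ _ _
    (is_derive_step (a * (x - b))) (is_derive_affine a b x)).
  by congr (is_derive _ _ _ _); rewrite /bump; ring.
- exists (fun x => f' x + g' x); first exact: bumpy_add.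
  by move=> x; exact: is_derive_add.
Qed.

Lemma bumpy_smooth f : bumpy f -> forall n x, derivable (derive1n n f) x 1.
Proof.
move=> bf n; have : bumpy (derive1n n f).
  elim: n => [//|n IH]; rewrite derive1nS.
  have [g bg dg] := bumpy_derive IH.
  by have -> : derive1 (derive1n n f) = g; first by apply/funext => x; exact: derive1_val (dg x).
by move=> /bumpy_derive[g _ dg] x; exact: derivable_val (dg x).
Qed.

(** Equal to 1 on [a + e, b - e] and to 0 outside ]a, b[. The coefficients 1 and
-1 display it as a member of [bumpy]. Its derivative is the difference of two
mollifiers, one in [a, a + e] and one in [b - e, b]. *)
Definition plateau a b e x : R := 1 * step (e^-1 * (x - a)) + -1 * step (e^-1 * (x - (b - e))).

Definition kernel e a x : R := e^-1 * (bump (e^-1 * (x - a)) / bump_mass).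

Lemma is_derive_plateau a b e x :
  is_derive x 1 (plateau a b e) (kernel e a x - kernel e (b - e) x).
Proof.
have H d : is_derive x 1 (fun x => step (e^-1 * (x - d))) (kernel e d x).
  rewrite /kernel mulrC; apply: (@is_derive_comp _ step (fun x => e^-1 * (x - d))).
    exact: is_derive_step.
  exact: is_derive_affine.
have := is_derive_add (is_derive_mulc 1 (H a)) (is_derive_mulc (-1) (H (b - e))).
by congr (is_derive _ _ _ _); ring.
Qed.

Lemma plateau_out a b e x : 0 < e -> e <= b - a -> x <= a \/ b <= x -> plateau a b e x = 0.
Proof.
move=> e0 eab [xa|bx]; rewrite /plateau.
  rewrite !step_le0 ?mulr0 ?addr0//; rewrite pmulr_rle0 ?invr_gt0//; lra.
rewrite !step_ge1; first by ring.
  by rewrite mulrC ler_pdivlMr//; lra.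
by rewrite mulrC ler_pdivlMr//; lra.
Qed.

Lemma plateau_norm a b e x : 0 < e -> e <= b - a -> `|plateau a b e x| <= 1.
Proof.
move=> e0 eab; rewrite /plateau.
have := step_01 (e^-1 * (x - a)); have := step_01 (e^-1 * (x - (b - e))).
move: (step _) (step _) => u v /andP[? ?] /andP[? ?].
by rewrite ler_norml; apply/andP; split; lra.
Qed.

Lemma plateau_test L a b e : 0 < a -> b < L -> 0 < e -> e <= b - a ->
  test_function L (plateau a b e).
Proof.
move=> a0 bL e0 eab.
have sub : closure [set x | plateau a b e x != 0] `<=` `[a, b].
  rewrite [X in _ `<=` X](closure_id _).1; last exact: interval_closed.
  apply: closure_subset => x /= /eqP px; rewrite in_itv/=; apply/andP; split.
    by rewrite leNgt; apply/negP => /ltW xa; apply: px; apply: plateau_out => //; left.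
  by rewrite leNgt; apply/negP => /ltW xa; apply: px; apply: plateau_out => //; right.
split.
- by apply: bumpy_smooth; apply: bumpy_add; exact: bumpy_step.
- by apply: subclosed_compact sub; [exact: closed_closure|exact: segment_compact].
- move=> x /sub /=; rewrite !in_itv/= => /andP[ax xb].
  by rewrite (lt_le_trans a0 ax) (le_lt_trans xb bL).
Qed.

Lemma kernel_ge0 e a x : 0 < e -> 0 <= kernel e a x.
Proof.
by move=> e0; rewrite /kernel mulr_ge0 ?invr_ge0 ?divr_ge0 ?bump_ge0// ltW// bump_mass_gt0.
Qed.

Lemma kernel_le e a x : 0 < e -> kernel e a x <= (e * bump_mass)^-1.
Proof.
move=> e0; rewrite /kernel invfM ler_pM2l ?invr_gt0//.
by rewrite ler_piMl ?bump_le1// invr_ge0 ltW// bump_mass_gt0.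
Qed.

Lemma kernel_out e a x : 0 < e -> x <= a \/ a + e <= x -> kernel e a x = 0.
Proof.
move=> e0 xa; rewrite /kernel bump_out ?mul0r ?mulr0//; case: xa => xa.
  by left; rewrite pmulr_rle0 ?invr_gt0//; lra.
by right; rewrite mulrC ler_pdivlMr//; lra.
Qed.

Lemma continuous_kernel e a : continuous (kernel e a).
Proof.
apply: continuous_mul; first exact: continuous_cst.
apply: continuous_mul; last exact: continuous_cst.
move=> x; apply: (@continuous_comp _ _ _ (fun x => e^-1 * (x - a)) bump).
  exact: is_derive_continuous (is_derive_affine _ _ _).
exact: continuous_bump.
Qed.

Lemma measurable_kernel e a (D : set (measurableTypeR R)) : measurable_fun D (kernel e a).
Proof.
apply: measurable_funTS; apply: continuous_measurable_fun => x.
exact: continuous_kernel.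
Qed.

Lemma integral_kernel L e a : 0 < e -> 0 <= a -> a + e <= L ->
  (\int[lebesgue_measure]_(x in `]0%R, L[) (kernel e a x)%:E = 1)%E.
Proof.
move=> e0 a0 aeL; rewrite -(@integral_itv_bndoo _ 0 L _ true false); last first.
  by apply/measurable_EFinP; exact: measurable_kernel.
have dE x : 0 <= x <= L -> is_derive x 1 (fun x => step (e^-1 * (x - a))) (kernel e a x).
  move=> _; rewrite /kernel mulrC; apply: (@is_derive_comp _ step (fun x => e^-1 * (x - a))).
    exact: is_derive_step.
  exact: is_derive_affine.
rewrite (integral_derive _ dE); last 2 first.
- lra.
- by apply: continuous_subspaceT; exact: continuous_kernel.
rewrite step_ge1; last by rewrite mulrC ler_pdivlMr//; lra.
by rewrite step_le0 ?subr0// pmulr_rle0 ?invr_gt0//; lra.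
Qed.

End Flat.

(** * Oscillation of a Sobolev function *)
Section SobolevControl.
Context {R : realType} (p L : R) (p1 : 1 < p) (L0 : 0 < L) (u v : R -> R).
Context (huv : sobolev_with_derivative p L u v).
Let mu := @lebesgue_measure R.
Let D : set R := `]0, L[.
Let mD : measurable (D : set (measurableTypeR R)). Proof. exact: measurable_itv. Qed.

Lemma Lp_itv_integrable (w : R -> R) : Lp_itv p L w -> mu.-integrable D (EFin \o w).
Proof.
rewrite /Lp_itv => Lw.
have mw : measurable_fun setT (w \_ D).
  by have := sub_Lfun_mfun Lw; rewrite inE.
have iw := Lfun_integrable (ltW p1 : 1 <= p) Lw.
have mw' : measurable_fun D w by apply/(measurable_restrictT _ mD).
apply/integrableP; split; first exact/measurable_EFinP.
apply: (@le_lt_trans _ _ (\int[mu]_(x in D) (1 + `|(w \_ D) x| `^ p)%:E)%E).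
  apply: ge0_le_integral => //=.
  - by apply/measurable_EFinP; exact: (measurableT_comp _ mw').
  - apply/measurable_EFinP; apply: measurable_funD => //.
    apply: (measurableT_comp (measurable_powR p)); apply: measurableT_comp => //.
    exact: measurable_funTS.
  move=> x Dx; rewrite lee_fin patchE mem_set//.
  case: (leP 1 `|w x|) => [w1|/ltW w1]; last by rewrite ler_wpDr ?powR_ge0.
  by rewrite ler_wpDl// le1r_powR// ltW.
under eq_integral do rewrite EFinD.
rewrite ge0_integralD//; last first.
  apply/measurable_EFinP.
  apply: (measurableT_comp (measurable_powR p)); apply: measurableT_comp => //.
  exact: measurable_funTS.
rewrite lte_add_pinfty//.
  by rewrite integral_cst//= mul1e lebesgue_measure_itv /= lte_fin L0 -EFinD ltry.
case/integrableP: iw => _; apply: le_lt_trans.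
under [leRHS]eq_integral do rewrite gee0_abs ?lee_fin ?powR_ge0//.
apply: ge0_subset_integral => //.
- apply/measurable_EFinP; apply: (measurableT_comp (measurable_powR p)).
  exact: measurableT_comp.
Qed.

Let iu : mu.-integrable D (EFin \o u). Proof. by case: huv => + _ _; exact: Lp_itv_integrable. Qed.
Let iv : mu.-integrable D (EFin \o v). Proof. by case: huv => _ + _; exact: Lp_itv_integrable. Qed.

Lemma locally_integrable_itv : locally_integrable setT (u \_ D).
Proof. exact: integrable_locally_restrict. Qed.

Let bounded_mul (w g : R -> R) (M : R) : mu.-integrable D (EFin \o w) ->
  measurable_fun D g -> (forall x, `|g x| <= M) -> mu.-integrable D (fun x => (w x * g x)%:E).
Proof.
move=> iw mg gM; have /integrableP[mw _] := iw.
have M0 : 0 <= M by apply: le_trans (gM 0).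
have iM : mu.-integrable D (fun x => (M * w x)%:E).
  by under eq_fun do rewrite EFinM; exact: integrableZl.
apply: le_integrable iM => //.
  by apply/measurable_EFinP; apply: measurable_funM => //; exact/measurable_EFinP.
by move=> x _; rewrite /= lee_fin !normrM mulrC ler_wpM2r// (ger0_norm M0).
Qed.

(* The mollifier is at most a constant times 1/e and lives in the ball of radius
   e around x, so the average of u against it differs from u x by at most a
   constant times the mean oscillation of u on this ball. *)
Let avg_kernel (x c e : R) : D x -> 0 < e -> 0 <= c -> c + e <= L ->
  (forall y, c < y < c + e -> `|y - x| < e) ->
  (`| \int[mu]_(y in D) (u y * kernel e c y) - u x |%:E <=
    (2 / bump_mass)%:E * davg (u \_ D) x e)%E.
Proof.
move=> Dx e0 c0 ceL near_x.
have B0 := @bump_mass_gt0 R.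
have mk : measurable_fun D (kernel e c).
  exact: measurable_kernel.
have kM y : `|kernel e c y| <= (e * bump_mass)^-1.
  by rewrite ger0_norm ?kernel_ge0// kernel_le.
have ik := integral_kernel e0 c0 ceL.
have iuk := bounded_mul iu mk kM.
have i1 : mu.-integrable D (EFin \o (fun _ => 1)).
  apply/integrableP; split; first by apply/measurable_EFinP; exact: measurable_cst.
  by rewrite integral_cst//= lebesgue_measure_itv/= lte_fin L0 -EFinD -EFinM ltry.
have ik1 : mu.-integrable D (EFin \o kernel e c).
  by have := bounded_mul i1 mk kM; under eq_fun do rewrite mul1r.
have ixk : mu.-integrable D (EFin \o (fun y => u x * kernel e c y)).
  exact: (integrableZl mD (u x) ik1).
have uxE : u x = \int[mu]_(y in D) (u x * kernel e c y).
  by rewrite RintegralZl// /Rintegral ik /= mulr1.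
rewrite [X in _ - X]uxE -RintegralB//.
have iB : mu.-integrable D (EFin \o (fun y => u y * kernel e c y - u x * kernel e c y)).
  exact: (integrableB mD iuk ixk).
rewrite EFin_normr_Rintegral//.
have mI : measurable_fun D (fun y => (u y * kernel e c y - u x * kernel e c y)%:E).
  by case/integrableP: iB.
apply: le_trans (le_abse_integral mu mD mI) _.
have mu' : measurable_fun setT (u \_ D).
  by case: locally_integrable_itv.
pose G (y : R) := ((e * bump_mass)^-1 * `|(u \_ D) y - (u \_ D) x|)%:E.
have mG : measurable_fun setT G.
  apply/measurable_EFinP; apply: measurable_funM => //.
  by apply: measurableT_comp => //; exact: measurable_funB.
have G0 y : (0 <= G y)%E.
  by rewrite lee_fin mulr_ge0// invr_ge0 mulr_ge0// ltW.
have mB : measurable (ball x e : set (measurableTypeR R)) by exact: measurable_ball.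
apply: (@le_trans _ _ (\int[mu]_(y in ball x e) G y)%E); last first.
  rewrite /G; under eq_integral do rewrite EFinM.
  rewrite ge0_integralZl_EFin//; last 2 first.
  - by apply/measurable_EFinP/measurable_funTS; apply: measurableT_comp => //; exact: measurable_funB.
  - by rewrite invr_ge0 mulr_ge0// ltW.
  rewrite /davg /iavg lebesgue_measure_ball ?(ltW e0)// muleA.
  apply: lee_wpmul2r; first exact: integral_ge0.
  rewrite inver gt_eqF ?mulrn_wgt0// -EFinM lee_fin.
  rewrite invfM -[e *+ 2]mulr_natl invfM.
  by rewrite le_eqVlt; apply/orP; left; apply/eqP; field; rewrite !gt_eqF.
rewrite [leLHS]integral_mkcond [leRHS]integral_mkcond.
apply: ge0_le_integral => //.
- by move=> y _; apply: erestrict_ge0.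
- by apply/(measurable_restrictT _ mD); exact: measurableT_comp.
- by apply/(measurable_restrictT _ mB); exact: measurable_funTS.
move=> y _; rewrite !patchE; case: ifPn => [|_]; last by case: ifPn.
rewrite inE => Dy; case: ifPn => [|].
  rewrite inE => By; rewrite /G lee_fin !patchE !mem_set// -mulrBl normrM mulrC.
  by rewrite ler_wpM2r.
rewrite notin_setE /ball/= => yB.
suff -> : kernel e c y = 0 by rewrite !mulr0 subr0 normr0.
apply: kernel_out => //; case: (leP y c) => yc; first by left.
right; rewrite leNgt; apply/negP => yce; apply: yB.
by rewrite distrC; apply: near_x; rewrite yc.
Qed.

Let DP x : D x -> 0 < x < L. Proof. by rewrite /D /= in_itv. Qed.

(** Testing the weak derivative against the plateau on [a, b] gives the
difference of the averages of u near a and near b on one side, and at most the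
integral of |v| over [a, b] on the other. *)
Lemma lebesgue_pt_increment (a b : R) : D a -> D b -> a < b ->
  lebesgue_pt (u \_ D) a -> lebesgue_pt (u \_ D) b ->
  (`|u a - u b|%:E <= \int[mu]_(x in `]a, b[) `|v x|%:E)%E.
Proof.
move=> Da Db ab la lb; have /andP[a0 aL] := DP Da; have /andP[b0 bL] := DP Db.
have B0 := @bump_mass_gt0 R.
set V := (\int[mu]_(x in `]a, b[) `|v x|%:E)%E.
apply/lee_addgt0Pr => d d0.
(* The factor 2/bump_mass of avg_kernel turns d' into d/2. *)
pose d' := d * bump_mass / 4; have d'0 : 0 < d' by rewrite divr_gt0// mulr_gt0.
have [e [e0 eab ea eb]] : exists e, [/\ 0 < e, e <= b - a,
    (davg (u \_ D) a e < d'%:E)%E & (davg (u \_ D) b e < d'%:E)%E].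
  have near_lt c : lebesgue_pt (u \_ D) c -> \forall r \near (0 : R)^'+, (davg (u \_ D) c r < d'%:E)%E.
    move=> lc; have := lc; rewrite /lebesgue_pt => H.
    by apply: (H [set z | (z < d'%:E)%E]); exact: (@nbhs_open_ereal_lt _ 0 (fun=> d')).
  near (0 : R)^'+ => e; exists e; split.
  - by near: e; exact: nbhs_right_gt.
  - by near: e; apply: nbhs_right_le; rewrite subr_gt0.
  - by near: e; exact: near_lt.
  - by near: e; exact: near_lt.
have Ka := @avg_kernel a a e Da e0 (ltW a0).
have {}Ka := Ka ltac:(lra) ltac:(by move=> y /andP[? ?]; rewrite ger0_norm; lra).
have Kb := @avg_kernel b (b - e) e Db e0.
have {}Kb := Kb ltac:(lra) ltac:(lra) ltac:(by move=> y /andP[? ?]; rewrite ler0_norm; lra).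
have H1 z : (davg (u \_ D) z e < d'%:E)%E -> ((2 / bump_mass)%:E * davg (u \_ D) z e <= (d / 2)%:E)%E.
  move=> /ltW H; apply: le_trans (lee_wpmul2l _ H) _; first by rewrite lee_fin divr_ge0// ltW.
  rewrite -EFinM lee_fin le_eqVlt /d'; apply/orP; left; apply/eqP; field.
  by rewrite gt_eqF.
have {Ka}Ka := le_trans Ka (H1 a ea); have {Kb}Kb := le_trans Kb (H1 b eb).
rewrite !lee_fin in Ka Kb.
have := plateau_test a0 bL e0 eab => tp.
case: huv => _ _ /(_ _ tp).
have dp x : derive1 (plateau a b e) x = kernel e a x - kernel e (b - e) x.
  exact: derive1_val (is_derive_plateau a b e x).
under eq_Rintegral do rewrite dp mulrBr.
have kM c y : `|kernel e c y| <= (e * bump_mass)^-1.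
  by rewrite ger0_norm ?kernel_ge0// kernel_le.
rewrite RintegralB//; last 2 first.
- by apply: bounded_mul (kM a) => //; exact: measurable_kernel.
- by apply: bounded_mul (kM (b - e)) => //; exact: measurable_kernel.
move: Ka Kb; rewrite -/mu -/D.
set A := \int[mu]_(y in D) _; set A' := \int[mu]_(y in D) _; set V' := \int[mu]_(y in D) _.
move=> Ka Kb AV.
have mpl : measurable_fun D (plateau a b e).
  apply: measurable_funTS; apply: continuous_measurable_fun => x.
  exact: is_derive_continuous (is_derive_plateau a b e x).
have V'V : (`|V'|%:E <= V)%E.
  have iVp : mu.-integrable D (EFin \o (fun x => v x * plateau a b e x)).
    exact: (bounded_mul iv mpl (fun x => plateau_norm x e0 eab)).
  rewrite EFin_normr_Rintegral//.
  have mI : measurable_fun D (EFin \o (fun x => v x * plateau a b e x)).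
    by case/integrableP: iVp.
  apply: le_trans (le_abse_integral mu mD mI) _.
  have sab : `]a, b[ `<=` D.
    move=> x /=; rewrite /D /= !in_itv/= => /andP[ax xb].
    by rewrite (lt_trans a0 ax) (lt_trans xb bL).
  have mv : measurable_fun D v by apply/measurable_EFinP; case/integrableP: iv.
  rewrite [leLHS]integral_mkcond /V [leRHS]integral_mkcond.
  apply: ge0_le_integral => //.
  - by move=> y _; apply: erestrict_ge0.
  - by apply/(measurable_restrictT _ mD); exact: measurableT_comp.
  - apply/(measurable_restrictT _ (measurable_itv _)).
    apply/measurable_EFinP; apply: measurableT_comp => //.
    exact: measurable_funS sab mv.
  move=> y _; rewrite !patchE; case: ifPn => [|_]; last by case: ifPn => // _; rewrite lee_fin.
  rewrite inE => Dy; case: ifPn => [|].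
    by rewrite inE => _; rewrite /= lee_fin normrM ler_piMr// plateau_norm.
  rewrite notin_setE /= in_itv/= => yab.
  rewrite plateau_out ?mulr0 ?normr0//; case: (leP y a) => ya; first by left.
  right; rewrite leNgt; apply/negP => yb; apply: yab.
  by rewrite ya yb.
have : (`|u a - u b| <= `|V'| + d).
  have -> : u a - u b = - (A - u a) + (A' - u b) + - V' by rewrite -AV; ring.
  apply: le_trans (ler_normD _ _) _; rewrite normrN addrC lerD2l.
  apply: le_trans (ler_normD _ _) _; rewrite normrN; lra.
rewrite -lee_fin => /le_trans; apply; rewrite EFinD.
by rewrite leeD2r.
Unshelve. all: by end_near. Qed.

(** The value at m is set to 0: no direction points away from m there, so that
the dual condition of the Schur test can only be expected for t <> m. *)
Definition cut_norm (m : R) : R -> R := (fun t => `|v t| * (t != m)%:R) \_ D.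

(** The kernel of the Hardy operator centred at m. *)
Definition between (m : R) : set (measurableTypeR R * measurableTypeR R) :=
  [set z | m < z.2 < z.1 \/ z.1 < z.2 < m].

Definition centred_prim (m x : R) : R :=
  \int[mu]_t (\1_(between m) (x, t) * cut_norm m t).

Lemma measurable_between m : measurable (between m).
Proof.
have m1 : measurable_fun setT (fun z : measurableTypeR R * measurableTypeR R => z.1 : R).
  exact: measurable_fst.
have m2 : measurable_fun setT (fun z : measurableTypeR R * measurableTypeR R => z.2 : R).
  exact: measurable_snd.
have mc c : measurable_fun setT (fun z : measurableTypeR R * measurableTypeR R => (c : R)).
  exact: measurable_cst.
have -> : between m = (fun z => ((m < z.2) && (z.2 < z.1)) || ((z.1 < z.2) && (z.2 < m))) @^-1` [set true].
  by apply/seteqP; split => z /=; [move=> [->|->]; rewrite ?orbT|move=> /orP].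
rewrite -[X in measurable X]setTI.
have H : measurable_fun setT (fun z : measurableTypeR R * measurableTypeR R =>
  ((m < z.2) && (z.2 < z.1)) || ((z.1 < z.2) && (z.2 < m)) : bool).
  apply: measurable_or; apply: measurable_and; apply: measurable_fun_ltr => //; exact: mc.
exact: H.
Qed.

Let mv : measurable_fun D v. Proof. by apply/measurable_EFinP; case/integrableP: iv. Qed.

Lemma cut_norm_ge0 m t : 0 <= cut_norm m t.
Proof. by rewrite /cut_norm patchE; case: ifPn => // _; rewrite mulr_ge0. Qed.

Lemma cut_norm_eq m t : D t -> t != m -> cut_norm m t = `|v t|.
Proof. by move=> Dt tm; rewrite /cut_norm patchE mem_set// tm mulr1. Qed.

Lemma cut_norm_le m t : cut_norm m t <= `|(v \_ D) t|.
Proof.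
rewrite /cut_norm !patchE; case: ifPn => [_|_]; last by rewrite normr0.
by rewrite ler_piMr// lern1 leq_b1.
Qed.

Lemma cut_norm_neq0 m t : cut_norm m t != 0 -> D t /\ t != m.
Proof.
rewrite /cut_norm patchE; case: ifPn => [|_]; last by rewrite eqxx.
rewrite inE => Dt H; split=> //; apply: contraNneq H => ->.
by rewrite eqxx mulr0.
Qed.

Lemma measurable_cut_norm m : measurable_fun (setT : set (measurableTypeR R)) (cut_norm m).
Proof.
apply/(measurable_restrictT _ mD); apply: measurable_funM.
  exact: measurableT_comp.
have -> : (fun t : R => (t != m)%:R : R) = \1_(~` [set m]).
  apply/funext => t; rewrite indicE; congr ((nat_of_bool _)%:R).
  by apply/idP/idP => tm; [rewrite inE; exact/eqP|apply/eqP; rewrite inE in tm].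
apply: measurable_indic; apply: measurableC; exact: measurable_set1.
Qed.

Let measurable_section m x :
  measurable_fun (setT : set (measurableTypeR R)) (fun t => \1_(between m) (x, t) * cut_norm m t).
Proof.
apply: measurable_funM; last exact: measurable_cut_norm.
have mi : measurable_fun setT (\1_(between m) : _ -> R).
  by apply: measurable_indic; exact: measurable_between.
exact: (measurableT_comp mi (pair1_measurable x)).
Qed.

Let section_ge0 m x t : 0 <= \1_(between m) (x, t) * cut_norm m t.
Proof. by rewrite mulr_ge0// cut_norm_ge0. Qed.

Let integrable_section m x : mu.-integrable setT (fun t => (\1_(between m) (x, t) * cut_norm m t)%:E).
Proof.
have ivD : mu.-integrable setT (EFin \o (v \_ D)).
  by rewrite -restrict_EFin; apply/(integrable_mkcond _ mD).
apply: le_integrable ivD => //; first by apply/measurable_EFinP; exact: measurable_section.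
move=> t _ /=; rewrite lee_fin ger0_norm ?section_ge0//.
apply: le_trans (cut_norm_le m t).
by rewrite ler_piMl ?cut_norm_ge0// indicE lern1 leq_b1.
Qed.

Lemma centred_primE m x :
  (\int[mu]_t (\1_(between m) (x, t) * cut_norm m t)%:E = (centred_prim m x)%:E)%E.
Proof. by rewrite /centred_prim /Rintegral fineK//; apply: integrable_fin_num; last exact: integrable_section. Qed.

Lemma centred_prim_ge0 m x : 0 <= centred_prim m x.
Proof. by rewrite -lee_fin -centred_primE integral_ge0// => t _; rewrite lee_fin. Qed.

(* A point of ]a, b[ other than m lies between m and a or between m and b. *)
Let increment_le m (a b : R) : D a -> D b -> a < b ->
  lebesgue_pt (u \_ D) a -> lebesgue_pt (u \_ D) b ->
  `|u a - u b| <= centred_prim m a + centred_prim m b.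
Proof.
move=> Da Db ab la lb; rewrite -lee_fin.
apply: le_trans (lebesgue_pt_increment Da Db ab la lb) _.
rewrite EFinD -!centred_primE -ge0_integralD//; last 4 first.
- by move=> t _; rewrite lee_fin.
- by apply/measurable_EFinP; exact: measurable_section.
- by move=> t _; rewrite lee_fin.
- by apply/measurable_EFinP; exact: measurable_section.
have mab : measurable (`]a, b[ : set (measurableTypeR R)) by exact: measurable_itv.
have sab : `]a, b[ `<=` D.
  move=> x /=; rewrite /D /= !in_itv/= => /andP[ax xb].
  have /andP[a0 _] := DP Da; have /andP[_ bL] := DP Db.
  by rewrite (lt_trans a0 ax) (lt_trans xb bL).
rewrite [leLHS]integral_mkcond.
apply: ae_ge0_le_integral => //.
- by move=> t _; apply: erestrict_ge0.
- apply/(measurable_restrictT _ mab).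
  by apply/measurable_EFinP; apply: measurableT_comp => //; exact: measurable_funS sab mv.
- by move=> t _; rewrite adde_ge0// lee_fin.
- by apply: emeasurable_funD; by apply/measurable_EFinP; exact: measurable_section.
exists [set m]; split => //; first exact: lebesgue_measure_set1.
move=> t /=; apply: contra_notP => /eqP tm _; rewrite patchE.
case: ifPn => [|_]; last by rewrite adde_ge0// lee_fin.
rewrite inE => tab; rewrite -EFinD lee_fin -mulrDl cut_norm_eq//; last exact: sab.
move: tab; rewrite /= in_itv/= => /andP[at' tb].
rewrite ler_peMl// !indicE /between.
have [tm'|mt] : t < m \/ m < t by case: ltgtP tm => //; [left|right].
  by rewrite mem_set ?lerDl//=; right; rewrite at' tm'.
rewrite addrC mem_set ?lerDl//=; left; by rewrite mt tb.
Qed.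

(** By [increment_le] the intervals [u z - W z, u z + W z], z a Lebesgue point
and W the integral of |v| from m, intersect pairwise. Hence they have a common
point, for instance the infimum of their right ends. *)
Lemma sobolev_control m :
  exists c : R, {ae mu, forall x, D x -> `|u x - c| <= centred_prim m x}.
Proof.
have [D1 [mD1 lD1 sD1]] := lebesgue_differentiation locally_integrable_itv.
pose P := [set z | D z /\ lebesgue_pt (u \_ D) z].
suff [c cP] : exists c, forall x, P x -> `|u x - c| <= centred_prim m x.
  exists c; exists D1; split => // x /= H; apply: sD1 => /= lx; apply: H => Dx.
  exact: cP.
have [[z0 Pz0]|noP] := pselect (exists z, P z); last first.
  by exists 0 => x Px; exfalso; apply: noP; exists x.
pose A := [set u z + centred_prim m z | z in P].
have lbA x : P x -> lbound A (u x - centred_prim m x).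
  move=> [Dx lx] _ [z [Dz lz] <-]; rewrite lerBlDr -addrA -lerBlDl.
  apply: le_trans (ler_norm _) _; have [xz|zx|->] := ltgtP x z.
  - by rewrite addrC; exact: increment_le.
  - by rewrite distrC; exact: increment_le.
  - by rewrite subrr normr0 addr_ge0// centred_prim_ge0.
have infA : has_inf A.
  by split; [exists (u z0 + centred_prim m z0), z0|exists (u z0 - centred_prim m z0); exact: lbA].
exists (inf A) => x Px; rewrite ler_distlC; apply/andP; split.
  by apply: lb_le_inf; [case: infA|exact: lbA].
by apply: ge_inf; [case: infA|exists x].
Qed.

End SobolevControl.

(** * Exponential tilts of a log-concave function *)
Section LogConcave.
Context {R : realType} (L : R) (f : R -> R).
Context (f_ge0 : forall x : R, x \in `[0, L] -> 0 <= f x) (f_lc : log_concave L f).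

Definition tilted (s x : R) : R := f x * expR (- (s * x)).

Let f0 x : 0 <= x <= L -> 0 <= f x.
Proof. by move=> xL; apply: f_ge0; rewrite in_itv. Qed.

(** Log-concavity is preserved by exponential factors, and the weighted
geometric mean of two numbers is at least the smaller one. *)
Lemma tilted_quasiconcave s x y z : 0 <= x -> x <= y -> y <= z -> z <= L ->
  Num.min (tilted s x) (tilted s z) <= tilted s y.
Proof.
move=> x0 xy yz zL.
have [<-|xny] := eqVneq x y; first by rewrite ge_min lexx.
have [<-|ynz] := eqVneq y z; first by rewrite ge_min lexx orbT.
have {xny}xy : x < y by rewrite lt_neqAle xny.
have {ynz}yz : y < z by rewrite lt_neqAle ynz.
have xz : 0 < z - x by rewrite subr_gt0 (lt_trans xy).
pose t := (y - x) / (z - x).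
have t01 : t \in `]0, 1[.
  by rewrite in_itv/= /t ltr_pdivrMr// mul1r ltrD2r yz divr_gt0// subr_gt0.
have yE : y = (1 - t) * x + t * z by rewrite /t; field; rewrite gt_eqF.
have := f_lc (x := x) (y := z) (t := t); rewrite -yE !in_itv/=.
move=> /(_ ltac:(apply/andP; split; lra) ltac:(apply/andP; split; lra) t01).
move: t01; rewrite in_itv/= => /andP[t0 t1] fle.
have fx0 : 0 <= f x by apply: f0; apply/andP; split; lra.
have fz0 : 0 <= f z by apply: f0; apply/andP; split; lra.
have rE w : 0 <= f w -> forall r, tilted s w `^ r = f w `^ r * expR (- (s * w) * r).
  by move=> fw r; rewrite /tilted powRM ?expR_ge0// -expRM.
apply: (@le_trans _ _ (tilted s x `^ (1 - t) * tilted s z `^ t)); last first.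
  rewrite !rE// mulrACA -expRD.
  have -> : - (s * x) * (1 - t) + - (s * z) * t = - (s * y) by rewrite [in RHS]yE; ring.
  by rewrite /tilted ler_wpM2r// expR_ge0.
have tx0 : 0 <= tilted s x by rewrite mulr_ge0// expR_ge0.
have tz0 : 0 <= tilted s z by rewrite mulr_ge0// expR_ge0.
set q := Num.min _ _.
have q0 : 0 <= q by rewrite le_min tx0.
have {1}-> : q = q `^ (1 - t) * q `^ t.
  by rewrite -powRD ?subrK ?powRr1// oner_eq0.
by apply: ler_pM; rewrite ?powR_ge0//; apply: ge0_ler_powR;
  rewrite ?nnegrE// ?ge_min ?lexx ?orbT//; lra.
Qed.

Lemma tilted0 x : tilted 0 x = f x.
Proof. by rewrite /tilted mul0r oppr0 expR0 mulr1. Qed.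

(** The superlevel sets are intervals. *)
Lemma log_concave_measurable :
  measurable_fun (`]0, L[ : set (measurableTypeR R)) (f : measurableTypeR R -> R).
Proof.
move=> mD.
have : measurable_fun (`]0, L[ : set (measurableTypeR R)) f.
  apply: (measurability (@RGenCInfty.G R)) => [|/= _ [_] [r] -> <-].
    exact: RGenCInfty.measurableE.
  apply: is_interval_measurable => s t/=.
  rewrite !in_itv/= !andbT => -[/andP[s0 sL] fs] [/andP[t0 tL] ft] u /andP[su ut].
  split; first by rewrite in_itv/= (lt_le_trans s0 su) (le_lt_trans ut tL).
  have := @tilted_quasiconcave 0 s u t (ltW s0) su ut (ltW tL).
  by rewrite !tilted0 in_itv/= andbT; apply: le_trans; rewrite le_min fs.
exact.
Qed.

Section TwoPoints.
Context (a b : R) (ab : a < b).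

Lemma tilted_lt_right : 0 < f a -> exists S, forall s, S <= s -> tilted s b < tilted s a.
Proof.
move=> fa0; have ba0 : 0 < b - a by rewrite subr_gt0.
exists (f b / f a / (b - a)) => s; rewrite ler_pdivrMr// => sS.
rewrite /tilted.
have -> : - (s * a) = s * (b - a) + - (s * b) by ring.
rewrite expRD mulrA ltr_pM2r ?expR_gt0//.
rewrite -ltr_pdivrMl// mulrC; apply: le_lt_trans sS _.
by apply: lt_le_trans (expR_ge1Dx _); rewrite ltrDr.
Qed.

Lemma tilted_lt_left : 0 < f b -> exists S, forall s, s <= S -> tilted s a < tilted s b.
Proof.
move=> fb0; have ba0 : 0 < b - a by rewrite subr_gt0.
exists (- (f a / f b / (b - a))) => s; rewrite lerNr ler_pdivrMr// => sS.
rewrite /tilted.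
have -> : - (s * b) = - s * (b - a) + - (s * a) by ring.
rewrite expRD mulrA ltr_pM2r ?expR_gt0//.
rewrite -ltr_pdivrMl// mulrC; apply: le_lt_trans sS _.
by apply: lt_le_trans (expR_ge1Dx _); rewrite ltrDr.
Qed.

End TwoPoints.

(** Take a third point c between a and b. A steep exponential makes the tilted
value at c smaller than at b; by quasiconcavity the tilted values to the left
of c are then at most the one at c. To the right of c use a instead of b. *)
Lemma log_concave_bounded (a b : R) : 0 < a -> a < b -> b < L -> 0 < f a -> 0 < f b ->
  exists M, forall x, 0 <= x <= L -> f x <= M.
Proof.
move=> a0 ab bL fa0 fb0.
pose c := (a + b) / 2.
have ac : a < c by rewrite /c; lra.
have cb : c < b by rewrite /c; lra.
have fc0 : 0 < f c.
  have := @tilted_quasiconcave 0 a c b (ltW a0) (ltW ac) (ltW cb) (ltW bL).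
  by rewrite !tilted0; apply: lt_le_trans; rewrite lt_min fa0.
have [S1 /(_ _ (lexx _)) h1] := tilted_lt_right ac fa0.
have [S2 /(_ _ (lexx _)) h2] := tilted_lt_left cb fb0.
exists (f c * (expR (`|S1| * L) + expR (`|S2| * L))) => x /andP[x0 xL].
have H s : tilted s x <= tilted s c -> f x <= f c * expR (`|s| * L).
  rewrite /tilted -ler_pdivlMr ?expR_gt0// -expRN opprK -mulrA -expRD => /le_trans; apply.
  rewrite ler_pM2l// ler_expR.
  have -> : - (s * c) + s * x = s * (x - c) by ring.
  apply: le_trans (ler_norm _) _; rewrite normrM ler_wpM2l// ler_norml.
  by apply/andP; split; lra.
have [xc|cx] := leP x c.
  rewrite mulrDr ler_wpDl ?mulr_ge0 ?expR_ge0 ?(ltW fc0)//; apply: H.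
  have := @tilted_quasiconcave S2 x c b x0 xc (ltW cb) (ltW bL).
  by rewrite ge_min => /orP[//|]; rewrite leNgt h2.
rewrite mulrDr ler_wpDr ?mulr_ge0 ?expR_ge0 ?(ltW fc0)//; apply: H.
have := @tilted_quasiconcave S1 a c x (ltW a0) (ltW ac) (ltW cx) xL.
by rewrite ge_min => /orP[|//]; rewrite leNgt h1.
Qed.

Section Balance.
Context (c : R) (m : R -> R) (c0 : 0 < c).
Context (m_cont : continuous m).
Context (m_left : forall d, 0 < d -> exists s0, forall s, s <= s0 -> m s < d).
Context (m_right : forall d, 0 < d -> exists s0, forall s, s0 <= s -> L - d < m s).

Definition up_to s := forall x y, 0 < x -> x <= y -> y < m s -> tilted (c * s) x <= tilted (c * s) y.
Definition down_from s := forall x y, m s < x -> x <= y -> y < L -> tilted (c * s) y <= tilted (c * s) x.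

(** Two violations, a strict decrease from x0 to y0 < m and a strict increase
from x1 > m to y1, would make the tilted function smaller at y0 or x1 than at
both x0 and y1, against quasiconcavity. *)
Lemma up_or_down s : up_to s \/ down_from s.
Proof.
have [|/existsNP[x0 /existsNP[y0]]] := pselect (up_to s); first by left.
move=> /not_implyP[x00 /not_implyP[xy0 /not_implyP[y0m /negP]]]; rewrite -ltNge => r0.
right => x1 y1 mx1 xy1 y1L; rewrite leNgt; apply/negP => r1.
have y0x1 : y0 <= x1 by rewrite ltW// (lt_trans y0m).
have := @tilted_quasiconcave (c * s) x0 y0 y1 (ltW x00) xy0 (le_trans y0x1 xy1) (ltW y1L).
have := @tilted_quasiconcave (c * s) x0 x1 y1 (ltW x00) (le_trans xy0 y0x1) xy1 (ltW y1L).
rewrite !ge_min => /orP[] h1 /orP[] h2; lra.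
Qed.

Let cont_tilted x : continuous (fun s => tilted (c * s) x).
Proof.
move=> s; rewrite /tilted; apply: cvgM; first exact: cvg_cst.
apply: (@continuous_comp _ _ _ (fun s => - (c * s * x)) expR); last exact: continuous_expR.
by apply: cvgN; apply: cvgM; [apply: cvgM; [exact: cvg_cst|exact: cvg_id]|exact: cvg_cst].
Qed.

Let near_tilted x y s0 : tilted (c * s0) x < tilted (c * s0) y ->
  \forall s \near s0, tilted (c * s) x < tilted (c * s) y.
Proof.
rewrite -subr_gt0 => r.
have H : (tilted (c * s) y - tilted (c * s) x) @[s --> s0] -->
    tilted (c * s0) y - tilted (c * s0) x.
  by apply: cvgB; exact: cont_tilted.
by apply: filterS (cvgr_gt _ H _ r) => s; rewrite subr_gt0.
Qed.

(** The set of s with [up_to] contains all very negative s, for which m is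
close to 0 and the tilted function increases from a to b, whence [down_from]
fails; symmetrically it is bounded above. Both conditions are closed in s, so
both hold at its supremum. *)
Lemma exists_balance (a b : R) : 0 < a -> a < b -> b < L -> 0 < f a -> 0 < f b ->
  exists s, up_to s /\ down_from s.
Proof.
move=> a0 ab bL fa0 fb0.
have [S1 h1] := tilted_lt_right ab fa0.
have [S2 h2] := tilted_lt_left ab fb0.
have [T1 k1] := m_right (d := L - b) ltac:(lra).
have [T2 k2] := m_left a0.
have bd s : up_to s -> s <= Num.max (S1 / c) T1.
  move=> us; rewrite leNgt; apply/negP; rewrite gt_max => /andP[s1 t1].
  have := us a b a0 (ltW ab); rewrite leNgt h1; last by rewrite mulrC -ler_pdivrMr// ltW.
  by move=> /(_ ltac:(have := k1 s (ltW t1); lra)).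
have ne : up_to (Num.min (S2 / c) T2).
  set s := Num.min _ _; have [//|ds] := up_or_down s; exfalso.
  have := ds a b; rewrite (leNgt (tilted _ b)) h2; last by rewrite mulrC -ler_pdivlMr// /s ge_min lexx.
  move=> H; suff : false by []; apply: H => //; last exact: ltW.
  by apply: k2; rewrite /s ge_min lexx orbT.
have hs : has_sup [set s | up_to s].
  by split; [exists (Num.min (S2 / c) T2)|exists (Num.max (S1 / c) T1); exact: bd].
exists (sup [set s | up_to s]); set s0 := sup _; split => x y.
- move=> x0 xy ym; rewrite leNgt; apply/negP => r.
  have near1 : \forall s \near s0, y < m s by exact: (cvgr_gt (m s0) (m_cont (x := s0))).
  have near2 := near_tilted r.
  have /nbhs_ballP[e /= e0 He] : nbhs s0 [set s | y < m s /\ tilted (c * s) y < tilted (c * s) x].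
    exact: filterI near1 near2.
  have [s us se] := sup_adherent e0 hs.
  have ss0 : s <= s0 by exact: (sup_upper_bound hs).
  have [] := He s.
    by rewrite /ball/= ger0_norm ?subr_ge0// ltrBlDr -ltrBlDl.
  by move=> ym' ys; move: (us x y x0 xy ym'); rewrite leNgt ys.
- move=> mx xy yL; rewrite leNgt; apply/negP => r.
  have near1 : \forall s \near s0, m s < x by exact: (cvgr_lt (m s0) (m_cont (x := s0))).
  have near2 := near_tilted r.
  have /nbhs_ballP[e /= e0 He] : nbhs s0 [set s | m s < x /\ tilted (c * s) x < tilted (c * s) y].
    exact: filterI near1 near2.
  have [] := He (s0 + e / 2).
    rewrite /ball/= opprD addrA subrr sub0r normrN gtr0_norm; lra.
  have [us|ds] := up_or_down (s0 + e / 2).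
    have := sup_upper_bound hs us; rewrite -/s0; lra.
  by move=> mx' xs; move: (ds x y mx' xy yL); rewrite leNgt xs.
Qed.

End Balance.

End LogConcave.

(** * The lower bound *)
Section WeightedHardy.
Context {R : realType} (p L : R) (p1 : 1 < p) (L0 : 0 < L) (f : R -> R).
Context (f_ge0 : forall x : R, x \in `[0, L] -> 0 <= f x) (f_lc : log_concave L f).
Context (F : R -> R) (F0 : F 0 = 0) (dF : forall y : R, is_derive y 1 F (pden p y)^-1).
Context (u v : R -> R) (huv : sobolev_with_derivative p L u v).
Let mu := @lebesgue_measure R.
Let D : set R := `]0, L[.
Let T := measurableTypeR R.
Let mD : measurable (D : set T). Proof. exact: measurable_itv. Qed.
Let f' : R -> R := f \_ D.

Let f'_ge0 t : 0 <= f' t.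
Proof.
rewrite /f' patchE; case: ifPn => //; rewrite inE /D /= in_itv/= => /andP[t0 tL].
by apply: f_ge0; rewrite in_itv/= !ltW.
Qed.

Let mf' : measurable_fun (setT : set T) f'.
Proof. apply/(measurable_restrictT _ mD); exact: log_concave_measurable f_ge0 f_lc. Qed.

Let mS1 m (x : R) (g : R -> R) : measurable_fun (setT : set T) g ->
  measurable_fun (setT : set T) (fun t => \1_(between m) (x, t) * g t).
Proof.
move=> mg; apply: measurable_funM => //.
have mi : measurable_fun setT (\1_(between m) : _ -> R).
  by apply: measurable_indic; exact: measurable_between.
exact: (measurableT_comp mi (pair1_measurable x)).
Qed.

Let mS2 m (t : R) (g : R -> R) : measurable_fun (setT : set T) g ->
  measurable_fun (setT : set T) (fun x => \1_(between m) (x, t) * g x).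
Proof.
move=> mg; apply: measurable_funM => //.
have mi : measurable_fun setT (\1_(between m) : _ -> R).
  by apply: measurable_indic; exact: measurable_between.
exact: (measurableT_comp mi (pair2_measurable t)).
Qed.

Let in_between m (x t : R) : (\1_(between m) (x, t) : R) != 0 ->
  \1_(between m) (x, t) = 1 :> R /\ (m < t < x \/ x < t < m).
Proof.
rewrite indicE; have [|_] := boolP ((x, t) \in between m); last by rewrite eqxx.
by rewrite inE.
Qed.

(** The Schur test with the profile of slope s. Its exponential weight is
replaced by f: beyond t, as seen from m, f x exp(-sigma x) <= f t exp(-sigma t)
with sigma = (p-1) rate s, by the assumed monotonicity. *)
Lemma weighted_hardy N s : 0 < N ->
  up_to f ((p - 1) * rate F L N) (split_pt p1 F L N) s ->
  down_from L f ((p - 1) * rate F L N) (split_pt p1 F L N) s ->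
  (\int[mu]_x (centred_prim L v (split_pt p1 F L N s) x `^ p * f' x)%:E <=
   (rate F L N `^ (- p))%:E * p_energy p L f v)%E.
Proof.
move=> N0; have kappa0 := rate_gt0 p1 F0 dF L0 N0.
have m0L := split_pt_bounds p1 F0 dF L0 N0 s.
have [Y [h [Ym dY dh h0]]] := hardy_profile p1 F0 dF L0 N0 s.
rewrite /up_to /down_from.
move: (split_pt p1 F L N s) m0L Ym => m m0L Ym.
move: (rate F L N) kappa0 dY dh => kappa kappa0 dY dh up down.
have /andP[m0 mL] := m0L.
pose I : set R := `[0, L]%classic.
have mI : measurable (I : set T) by exact: measurable_itv.
have DI : D `<=` I by move=> x; rewrite /D /I /= !in_itv/= => /andP[? ?]; rewrite !ltW.
have IP x : I x -> 0 <= x <= L by rewrite /I /= in_itv.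
have mYI : measurable_fun (I : set T) Y by exact: within_measurable (within_profileY dY).
have mhI : measurable_fun (I : set T) h by exact: within_measurable (within_profileh dh).
(* The profile is defined on [0, L]; outside, the value 1 keeps it positive as
   the Schur test on the whole line requires. *)
pose h' : R -> R := (h \_ I) \+ \1_(~` I).
have mh' : measurable_fun (setT : set T) h'.
  apply: measurable_funD; first exact/(measurable_restrictT _ mI).
  by apply: measurable_indic; exact: measurableC.
have h'E t : I t -> h' t = h t.
  by move=> It; rewrite /h' /= patchE indicE in_setC mem_set//= addr0.
have h'0 t : 0 < h' t.
  rewrite /h' /= patchE indicE in_setC; case: (t \in I) => /=; first by rewrite addr0.
  by rewrite add0r.
pose B := profile_bound kappa Y h.
have B0 t : 0 <= B t by rewrite /B /profile_bound divr_ge0 ?mulr_ge0// ltW.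
have mBI : measurable_fun (I : set T) B.
  by apply: measurable_funM => //; apply: measurable_funM => //; exact: measurableT_comp.
pose Phi := B \_ D.
have mPhi : measurable_fun (setT : set T) Phi.
  by apply/(measurable_restrictT _ mD); exact: measurable_funS mBI.
have Phi0 t : 0 <= Phi t by rewrite /Phi patchE; case: ifPn.
have PhiE t : D t -> Phi t = B t by move=> Dt; rewrite /Phi patchE mem_set.
have C0 : 0 <= kappa `^ (- p) by exact: powR_ge0.
have f'D t : f' t != 0 -> D t.
  by rewrite /f' patchE; case: ifPn => [|_]; rewrite ?eqxx// inE.
have f'E t : D t -> f' t = f t by move=> Dt; rewrite /f' patchE mem_set.
have int_h x a b : 0 <= a -> b <= L -> (forall t, m < t < x \/ x < t < m -> a <= t <= b) ->
    (\int[mu]_t (\1_(between m) (x, t) * h' t)%:E <= \int[mu]_(t in `[a, b]) (h t)%:E)%E.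
  move=> a0 bL Hab.
  have mab : measurable (`[a, b] : set T) by exact: measurable_itv.
  have sab : `[a, b] `<=` I.
    move=> t; rewrite /I /= !in_itv/= => /andP[at' tb].
    by rewrite (le_trans a0 at') (le_trans tb bL).
  rewrite [leRHS]integral_mkcond; apply: ge0_le_integral => //.
  - by move=> t _; rewrite lee_fin mulr_ge0// ltW.
  - by apply/measurable_EFinP; exact: mS1.
  - apply/(measurable_restrictT _ mab); apply/measurable_EFinP.
    exact: measurable_funS mhI.
  move=> t _; have [->|Hx] := eqVneq (\1_(between m) (x, t) : R) 0.
    by rewrite mul0r; apply: erestrict_ge0 => z _; rewrite lee_fin ltW.
  have [-> xt] := in_between Hx; have tab := Hab t xt.
  have t_in : `[a, b]%classic t by rewrite /= in_itv.
  by rewrite mul1r h'E; [rewrite patchE mem_set|exact: sab].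
have int_B t a b : 0 <= a -> b <= L -> D t ->
   (forall x, D x -> m < t < x \/ x < t < m ->
      a <= x <= b /\ tilted f ((p - 1) * kappa * s) x <= tilted f ((p - 1) * kappa * s) t) ->
   (\int[mu]_(x in `[a, b]) (B x `^ (p - 1) * expR ((p - 1) * kappa * s * x))%:E <=
     (kappa `^ (- p) * h t `^ (p - 1) * expR ((p - 1) * kappa * s * t))%:E)%E ->
   (\int[mu]_x (\1_(between m) (x, t) * (Phi x `^ (p - 1) * f' x))%:E <=
      (kappa `^ (- p) * h' t `^ (p - 1) * f' t)%:E)%E.
  move=> a0 bL Dt Hab HB.
  have mab : measurable (`[a, b] : set T) by exact: measurable_itv.
  have sab : `[a, b] `<=` I.
    move=> x; rewrite /I /= !in_itv/= => /andP[at' tb].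
    by rewrite (le_trans a0 at') (le_trans tb bL).
  set w := tilted f ((p - 1) * kappa * s) in Hab.
  have wE x : w x * expR ((p - 1) * kappa * s * x) = f x.
    by rewrite /w /tilted -mulrA -expRD addNr expR0 mulr1.
  have w0 : 0 <= w t.
    by rewrite /w /tilted mulr_ge0 ?expR_ge0// -f'E.
  have mBe : measurable_fun (`[a, b] : set T) (fun x => B x `^ (p - 1) * expR ((p - 1) * kappa * s * x)).
    apply: measurable_funM.
      by apply: (measurableT_comp (measurable_powR (p - 1))); exact: measurable_funS mBI.
    apply: measurableT_comp => //; exact: measurable_funM.
  apply: (@le_trans _ _ ((w t)%:E * \int[mu]_(x in `[a, b]) (B x `^ (p - 1) * expR ((p - 1) * kappa * s * x))%:E)%E); last first.
    apply: le_trans (lee_wpmul2l _ HB) _; first by rewrite lee_fin.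
    rewrite -EFinM lee_fin h'E; last exact: DI.
    by rewrite f'E// -wE le_eqVlt; apply/orP; left; apply/eqP; ring.
  rewrite -ge0_integralZl_EFin//; last 2 first.
  - by move=> x _; rewrite lee_fin mulr_ge0 ?powR_ge0 ?expR_ge0.
  - exact/measurable_EFinP.
  rewrite [leRHS]integral_mkcond; apply: ge0_le_integral => //.
  - by move=> x _; rewrite lee_fin !mulr_ge0 ?powR_ge0.
  - apply/measurable_EFinP; apply: mS2; apply: measurable_funM => //.
    exact: (measurableT_comp (measurable_powR (p - 1)) mPhi).
  - apply/(measurable_restrictT _ mab); apply: measurable_funeM; exact/measurable_EFinP.
  have R0 x : (0 <= ((fun x => (w t)%:E * (B x `^ (p - 1) * expR ((p - 1) * kappa * s * x))%:E) \_ `[a, b]) x)%E.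
    by apply: erestrict_ge0 => z _; rewrite -EFinM lee_fin mulr_ge0// mulr_ge0 ?powR_ge0 ?expR_ge0.
  move=> x _; have [->|Hx] := eqVneq (\1_(between m) (x, t) : R) 0.
    by rewrite mul0r.
  have [->|/f'D Dx] := eqVneq (f' x) 0; first by rewrite !mulr0.
  have [-> xt] := in_between Hx; have [xab xw] := Hab x Dx xt.
  have x_in : `[a, b]%classic x by rewrite /= in_itv.
  rewrite mul1r patchE mem_set// PhiE// f'E// -EFinM lee_fin.
  by rewrite -(wE x) [leRHS]mulrCA ler_wpM2l ?powR_ge0// ler_wpM2r ?expR_ge0.
apply: (@le_trans _ _ ((kappa `^ (- p))%:E * \int[mu]_t (cut_norm L v m t `^ p * f' t)%:E)%E).
  apply: (schur_test p1 (S := between m) (h := h') (Phi := Phi)) => //.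
  - exact: measurable_between.
  - exact: (measurable_cut_norm p1 L0 huv m).
  - by move=> t; exact: cut_norm_ge0.
  - by move=> x; exact: (centred_primE p1 L0 huv m x).
  - move=> x /f'D Dx Wx; have Ix := DI _ Dx; have /andP[x0 xL] := IP _ Ix.
    have xm : x != m.
      apply: contraNneq Wx => ->; rewrite -eqe -(centred_primE p1 L0 huv).
      rewrite integral0_eq// => t _.
      have [->|/in_between[_]] := eqVneq (\1_(between m) (m, t) : R) 0; first by rewrite mul0r.
      by move=> [] /andP[a b]; have := lt_trans a b; rewrite ltxx.
    rewrite PhiE//; split; first exact: (profile_bound_gt0 p1 kappa0 m0L Ym dY h0).
    have [xm'|mx|/eqP] := ltgtP x m; last by rewrite (negbTE xm).
      apply: le_trans (int_h x x m x0 (ltW mL) _) _.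
        by move=> t [/andP[a b]|/andP[a b]]; apply/andP; split; lra.
      apply: le_trans (integral_profileh p1 kappa0 dY dh h0 x0 (ltW xm') (ltW mL)) _.
      rewrite lee_fin Ym !mul0r sub0r /B /profile_bound -!mulNr ler_pM2r ?invr_gt0//.
      by rewrite ler_pM2r// ler_normr lexx orbT.
    apply: le_trans (int_h x m x (ltW m0) xL _) _.
      by move=> t [/andP[a b]|/andP[a b]]; apply/andP; split; lra.
    apply: le_trans (integral_profileh p1 kappa0 dY dh h0 (ltW m0) (ltW mx) xL) _.
    rewrite lee_fin Ym !mul0r subr0 /B /profile_bound ler_pM2r ?invr_gt0//.
    by rewrite ler_pM2r// ler_norm.
  - move=> t /cut_norm_neq0[Dt tm]; have /andP[t0 tL] := IP _ (DI _ Dt).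
    have DP x : D x -> 0 < x < L by rewrite /D /= in_itv.
    have [tm'|mt|/eqP] := ltgtP t m; last by rewrite (negbTE tm).
      apply: (@int_B t 0 t) => //.
        move=> x /DP/andP[x0 xL] [/andP[a b]|/andP[a b]]; first by exfalso; lra.
        by split; [rewrite !ltW|apply: up => //; exact: ltW].
      apply: (integral_profile_bound_left p1 kappa0 m0L Ym dY dh h0).
      by rewrite t0 ltW.
    apply: (@int_B t t L) => //.
      move=> x /DP/andP[x0 xL] [/andP[a b]|/andP[a b]]; last by exfalso; lra.
      by split; [rewrite !ltW|apply: down => //; exact: ltW].
    apply: (integral_profile_bound_right p1 kappa0 m0L Ym dY dh h0).
    by rewrite tL ltW.
apply: lee_wpmul2l; first by rewrite lee_fin.
rewrite /p_energy [leRHS]integral_mkcond.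
have mv : measurable_fun (D : set T) v.
  by apply/measurable_EFinP; case: huv => _ /(Lp_itv_integrable p1 L0)/integrableP[].
apply: ge0_le_integral => //.
- by move=> t _; rewrite lee_fin mulr_ge0 ?powR_ge0.
- apply/measurable_EFinP; apply: measurable_funM => //.
  apply: (measurableT_comp (measurable_powR p)); exact: (measurable_cut_norm p1 L0 huv m).
- apply/(measurable_restrictT _ mD); apply/measurable_EFinP; apply: measurable_funM.
    by apply: (measurableT_comp (measurable_powR p)); exact: measurableT_comp.
  exact: log_concave_measurable f_ge0 f_lc.
move=> t _; rewrite patchE; case: ifPn => [|tD].
  rewrite inE => Dt; rewrite lee_fin f'E// ler_wpM2r -?f'E//.
  apply: ge0_ler_powR; rewrite ?nnegrE ?cut_norm_ge0//; first by have := p1; lra.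
  by rewrite /cut_norm patchE mem_set// ler_piMr// lern1 leq_b1.
by rewrite /f' patchE (negbTE tD) mulr0.
Qed.

Section TwoPoints.
Context (a b : R) (a0 : 0 < a) (ab : a < b) (bL : b < L) (fa0 : 0 < f a) (fb0 : 0 < f b).

Let mf : measurable_fun (D : set T) f.
Proof. exact: log_concave_measurable f_ge0 f_lc. Qed.

Let fD t : D t -> 0 <= f t.
Proof. by rewrite /D /= in_itv/= => /andP[t0 tL]; apply: f_ge0; rewrite in_itv/= !ltW. Qed.

Let mu_ : measurable_fun (D : set T) u.
Proof. by apply/measurable_EFinP; case: huv => /(Lp_itv_integrable p1 L0)/integrableP[]. Qed.

Let integrable_powu : mu.-integrable D (fun x => (`|u x| `^ p)%:E).
Proof.
case: huv => Lu _ _; have iw := Lfun_integrable (ltW p1 : 1 <= p) Lu.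
apply: (eq_integrable mD (fun x => (`|(u \_ `]0, L[) x| `^ p)%:E)).
  by move=> x Dx; rewrite patchE Dx.
exact: integrableS iw.
Qed.

Let integrable_weighted (w : R -> R) : mu.-integrable D (EFin \o w) ->
  mu.-integrable D (fun x => (w x * f x)%:E).
Proof.
move=> iw; have [M fM] := log_concave_bounded f_ge0 f_lc a0 ab bL fa0 fb0.
have /integrableP[/measurable_EFinP mw _] := iw.
apply: (le_integrable mD _ _ (integrableZl mD M iw)).
  by apply/measurable_EFinP; exact: measurable_funM.
move=> x Dx; rewrite /= lee_fin !normrM mulrC ler_wpM2r// ger0_norm ?fD//.
apply: le_trans (ler_norm _); apply: fM.
by move: Dx; rewrite /D /= in_itv/= => /andP[? ?]; rewrite !ltW.
Qed.

Let integrable_powuf : mu.-integrable D (fun x => (`|u x| `^ p * f x)%:E).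
Proof. exact: (integrable_weighted integrable_powu). Qed.

Let integrable_spowuf : mu.-integrable D (fun x => (spow p (u x) * f x)%:E).
Proof.
apply: (integrable_weighted (w := fun x => spow p (u x))).
have i1 : mu.-integrable D (EFin \o (fun _ => 1)).
  apply/integrableP; split; first by apply/measurable_EFinP; exact: measurable_cst.
  by rewrite integral_cst//= lebesgue_measure_itv/= lte_fin L0 -EFinD -EFinM ltry.
apply: (le_integrable mD _ _ (integrableD mD i1 integrable_powu)).
  apply/measurable_EFinP; apply: measurable_funM => //.
  apply: (measurableT_comp (measurable_powR (p - 2))); exact: measurableT_comp.
move=> x Dx; rewrite /= lee_fin norm_spow// [leRHS]ger0_norm ?addr_ge0 ?powR_ge0//.
have [u1|u1] := leP 1 `|u x|.
  by rewrite ler_wpDl// ler_powR//; have := p1; lra.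
have E1 : 1 `^ (p - 1) = 1 :> R by rewrite powR1.
rewrite ler_wpDr ?powR_ge0// -[leRHS]E1.
apply: ge0_ler_powR; rewrite ?nnegrE ?(ltW u1)//; have := p1; lra.
Qed.

Lemma p_energy_lty : (p_energy p L f u < +oo)%E.
Proof.
have /integrableP[_] := integrable_powuf; rewrite /p_energy; congr (_ < _)%E.
by apply: eq_integral => x; rewrite inE => Dx; rewrite gee0_abs// lee_fin mulr_ge0 ?powR_ge0 ?fD.
Qed.

(** Integrate [norm_powR_tangent] between u x and u x - c against f: the linear
term is c times the p-mean of u, which vanishes. *)
Lemma p_energy_le_shift c : p_mean_zero p L f u ->
  (p_energy p L f u <= p_energy p L f (fun x => (u x - c)%R))%E.
Proof.
move=> mz.
have mpf : measurable_fun (D : set T) (fun x => `|u x - c| `^ p * f x).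
  apply: measurable_funM => //; apply: (measurableT_comp (measurable_powR p)).
  by apply: measurableT_comp => //; exact: measurable_funB.
have pos x : D x -> 0 <= `|u x - c| `^ p * f x by move=> Dx; rewrite mulr_ge0 ?powR_ge0 ?fD.
have [->|fin] := eqVneq (p_energy p L f (fun x => (u x - c)%R)) +oo%E; first exact: leey.
have ir : mu.-integrable D (fun x => (`|u x - c| `^ p * f x)%:E).
  apply/integrableP; split; first exact/measurable_EFinP.
  rewrite ltey; apply: contraNneq fin => <-; apply/eqP.
  by apply: eq_integral => x; rewrite inE => Dx; rewrite gee0_abs// lee_fin pos.
have is' := integrableZl mD (p * c) integrable_spowuf.
have -> : p_energy p L f u =
    (\int[mu]_(x in D) ((`|u x| `^ p * f x)%:E - (p * c * (spow p (u x) * f x))%:E))%E.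
  rewrite (integralB_EFin mD integrable_powuf is').
  under [X in (_ - X)%E]eq_integral do rewrite EFinM.
  rewrite (integralZl mD integrable_spowuf).
  have -> : (\int[mu]_(x in D) (spow p (u x) * f x)%:E = 0)%E by exact: mz.
  by rewrite mule0 sube0.
apply: le_integral => //.
  exact: (integrableB mD integrable_powuf is').
move=> x; rewrite inE => Dx; rewrite -EFinB lee_fin.
have := ler_wpM2r (fD Dx) (norm_powR_tangent p1 (u x) (u x - c)).
lra.
Qed.

Lemma p_energy_rate_le N : 0 < N -> p_mean_zero p L f u ->
  (p_energy p L f u <= (rate F L N `^ (- p))%:E * p_energy p L f v)%E.
Proof.
move=> N0 mz; have kappa0 := rate_gt0 p1 F0 dF L0 N0.
have c0 : 0 < (p - 1) * rate F L N by rewrite mulr_gt0// subr_gt0.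
have m_cont : continuous (split_pt p1 F L N).
  move=> s; apply/cvgrPdist_lt => e e0.
  have K0 : 0 < N ^+ 2 / rate F L N by rewrite divr_gt0// exprn_gt0.
  have d0 : 0 < e / (N ^+ 2 / rate F L N) by rewrite divr_gt0.
  apply: (filterS _ (nbhsx_ballx (s : R) _ d0)) => z; rewrite /ball/= => zd.
  apply: le_lt_trans (split_pt_lipschitz p1 F0 dF L0 N0 s z) _.
  by rewrite mulrC -ltr_pdivlMr.
have [s [up down]] := exists_balance f_ge0 f_lc c0 m_cont
  (split_pt_left p1 F0 dF L0 N0) (split_pt_right p1 F0 dF L0 N0) a0 ab bL fa0 fb0.
have [c uc] := sobolev_control p1 L0 huv (split_pt p1 F L N s).
apply: le_trans (p_energy_le_shift c mz) _.
apply: le_trans (weighted_hardy N0 up down).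
set m := split_pt _ _ _ _ _ in uc *.
have W0 x : 0 <= centred_prim L v m x by exact: (centred_prim_ge0 p1 L0 huv m x).
have mW : measurable_fun (setT : set T) (centred_prim L v m).
  apply: (measurable_section_integral (S := between m) (v := cut_norm L v m)).
  - exact: measurable_between.
  - exact: (measurable_cut_norm p1 L0 huv m).
  - by move=> t; exact: cut_norm_ge0.
  - by move=> x; exact: (centred_primE p1 L0 huv m x).
have mWp : measurable_fun (setT : set T) (fun x => centred_prim L v m x `^ p).
  exact: (measurableT_comp (measurable_powR p)).
rewrite /p_energy [leLHS]integral_mkcond.
apply: ae_ge0_le_integral => //.
- by move=> x _; apply: erestrict_ge0 => y Dy; rewrite lee_fin mulr_ge0 ?powR_ge0 ?fD.
- apply/(measurable_restrictT _ mD); apply/measurable_EFinP.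
  apply: measurable_funM => //; apply: (measurableT_comp (measurable_powR p)).
  by apply: measurableT_comp => //; exact: measurable_funB.
- by move=> x _; rewrite lee_fin mulr_ge0 ?powR_ge0.
- by apply/measurable_EFinP; exact: measurable_funM.
case: uc => Z [mZ Z0 sZ]; exists Z; split => // x /= bad; apply: sZ => /= good.
apply: bad => _; rewrite /f' !patchE; case: ifPn => [|_].
  rewrite inE => Dx; rewrite lee_fin ler_wpM2r ?fD//.
  by apply: ge0_ler_powR; rewrite ?nnegrE ?good//; have := p1; lra.
by rewrite mulr0.
Qed.

End TwoPoints.

(** Otherwise the weight is zero up to a single point. *)
Lemma exists_two_points : p_energy p L f u != 0%E ->
  exists a b, [/\ 0 < a, a < b, b < L, 0 < f a & 0 < f b].
Proof.
apply: contra_neqP => noab.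
have fD t : D t -> 0 <= f t.
  by rewrite /D /= in_itv/= => /andP[t0 tL]; apply: f_ge0; rewrite in_itv/= !ltW.
have [[z [Dz fz]]|noz] := pselect (exists z, D z /\ 0 < f z); last first.
  rewrite /p_energy integral0_eq// => x Dx.
  suff -> : f x = 0 by rewrite mulr0.
  apply/eqP; rewrite eq_le fD// andbT leNgt; apply/negP => fx.
  by apply: noz; exists x.
have f1 x : D x -> x != z -> f x = 0.
  move=> Dx xz; apply/eqP; rewrite eq_le fD// andbT leNgt; apply/negP => fx.
  have DP t : D t -> 0 < t < L by rewrite /D /= in_itv.
  have /andP[x0 xL] := DP _ Dx; have /andP[z0 zL] := DP _ Dz.
  by apply: noab; case: ltgtP xz => // ? _; [exists x, z|exists z, x].
rewrite /p_energy.
transitivity (\int[mu]_(x in D) ((`|u z| `^ p * f z) * \1_[set z] x)%:E)%E.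
  apply: eq_integral => x; rewrite inE => Dx; congr (_%:E).
  have [->|xz] := eqVneq x z; first by rewrite indicE mem_set// mulr1.
  by rewrite f1// mulr0 indicE memNset ?mulr0//; exact/eqP.
under eq_integral do rewrite EFinM.
have mz : measurable ([set z] : set T) by exact: measurable_set1.
rewrite ge0_integralZl_EFin//; last 2 first.
- by apply/measurable_EFinP; exact: measurable_indic.
- by rewrite mulr_ge0 ?powR_ge0 ?ltW.
rewrite integral_indic//.
have zD0 : (mu ([set z] `&` D) = 0)%E.
  apply/eqP; rewrite -measure_le0 -(lebesgue_measure_set1 z).
  by apply: le_measure; rewrite ?inE//; exact: measurableI.
by rewrite [X in (_ * X)%E]zD0 mule0.
Qed.

(** The bound of [p_energy_rate_le] holds for every N; take the supremum of
rate F L N. *)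
Lemma rayleigh_ge_pi_p : p_mean_zero p L f u -> p_energy p L f u != 0%E ->
  (((pi_p p / L) `^ p)%:E <= p_energy p L f v / p_energy p L f u)%E.
Proof.
move=> mz En0; have [a [b [a0 ab bL fa0 fb0]]] := exists_two_points En0.
have fD t : D t -> 0 <= f t.
  by rewrite /D /= in_itv/= => /andP[t0 tL]; apply: f_ge0; rewrite in_itv/= !ltW.
have E0 w : (0 <= p_energy p L f w)%E.
  by apply: integral_ge0 => x Dx; rewrite lee_fin mulr_ge0 ?powR_ge0// fD.
have := p_energy_lty a0 ab bL fa0 fb0.
have := fun N N0 => @p_energy_rate_le a b a0 ab bL fa0 fb0 N N0 mz.
move: (E0 u) (E0 v) En0.
case: (p_energy p L f u) => [e| |]//; rewrite eqe lee_fin => e0 Ev0 en0 H _.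
have {en0}e0 : 0 < e by rewrite lt_neqAle eq_sym en0.
rewrite inver gt_eqF// lee_pdivlMr//.
case: (p_energy p L f v) Ev0 H => [g| |]//; last by move=> _ _; exact: leey.
rewrite lee_fin => g0 H; rewrite -EFinM lee_fin.
have p0 : 0 < p by have := p1; lra.
have rN N : 0 < N -> rate F L N <= (g / e) `^ p^-1.
  move=> N0; have k0 := rate_gt0 p1 F0 dF L0 N0.
  have := H N N0; rewrite -EFinM lee_fin powRN mulrC ler_pdivlMr ?powR_gt0// => h.
  rewrite -(powRr1 (ltW k0)) -(mulfV (lt0r_neq0 p0)) powRrM.
  apply: ge0_ler_powR; rewrite ?nnegrE ?powR_ge0 ?invr_ge0 ?(ltW p0)//.
    by rewrite divr_ge0// ltW.
  by rewrite ler_pdivlMr// mulrC.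
have piL : pi_p p / L <= (g / e) `^ p^-1.
  rewrite (pi_pE p1 F0 dF) ler_pdivrMr// mulrC -ler_pdivlMr//.
  apply: ge_sup; first by exists (F 0), 0.
  move=> _ [y _ <-]; apply: (@le_trans _ _ (F (Num.max y 1))).
    by apply: (arcpden_le p1 dF); rewrite le_max lexx.
  rewrite ler_pdivlMr// mulrC -ler_pdivrMr//.
  by apply: rN; rewrite lt_max ltr01 orbT.
rewrite -ler_pdivlMr//.
have ge0 : 0 <= g / e by rewrite divr_ge0// ltW.
rewrite -[leRHS](powRr1 ge0) -(mulVf (lt0r_neq0 p0)) powRrM.
apply: ge0_ler_powR; rewrite ?nnegrE ?powR_ge0 ?(ltW p0)//.
rewrite (pi_pE p1 F0 dF) divr_ge0 ?(ltW L0)// mulr_ge0//.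
by have := arcpden_lt_lim p1 dF 0; rewrite F0 => /ltW.
Qed.

End WeightedHardy.

(** * Absolute continuity on the open interval *)
Section OpenInterval.
Context {R : realType} (L : R) (L0 : 0 < L).
Let mu := @lebesgue_measure R.
Let D : set R := `]0, L[.
Let T := measurableTypeR R.
Let mD : measurable (D : set T). Proof. exact: measurable_itv. Qed.
Let DP x : D x -> 0 < x < L. Proof. by rewrite /D /= in_itv. Qed.

Lemma continuous_on_measurable_oo (g : R -> R) :
  (forall x, D x -> {for x, continuous g}) -> measurable_fun (D : set T) g.
Proof.
move=> cg; apply: open_continuous_measurable_fun; first exact: interval_open.
by move=> x; rewrite inE => /cg.
Qed.

Lemma bounded_integrable_oo (g : R -> R) (M : R) : measurable_fun (D : set T) g ->
  (forall x, D x -> `|g x| <= M) -> mu.-integrable D (EFin \o g).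
Proof.
move=> mg gM.
have i1 : mu.-integrable D (EFin \o (fun _ => M)).
  apply/integrableP; split; first by apply/measurable_EFinP; exact: measurable_cst.
  by rewrite integral_cst//= lebesgue_measure_itv/= lte_fin L0 -EFinD -EFinM ltry.
apply: (le_integrable mD _ _ i1); first exact/measurable_EFinP.
by move=> x /gM gx; rewrite /= lee_fin (le_trans gx)// ler_norm.
Qed.

(* For a bound M of g, M + g is nonnegative, so its integral over ]0, L[ is at
   least the one over [c, L - c], which G computes up to an error that vanishes
   with c. *)
Let integral_oo_ge0 (g G : R -> R) (M : R) :
  (forall x, D x -> `|g x| <= M) -> (forall x, D x -> {for x, continuous g}) ->
  (forall x, D x -> is_derive x 1 G (g x)) ->
  (forall e, 0 < e -> exists2 d, 0 < d &
     forall x, D x -> x < d \/ L - d < x -> `|G x| <= e) ->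
  (0 <= \int[mu]_(x in D) (g x)%:E)%E.
Proof.
move=> gM cg dG Gend.
have L1 : 0 < L := L0.
have mg := continuous_on_measurable_oo cg.
have ig := bounded_integrable_oo mg gM.
have M0 : 0 <= M by apply: le_trans (gM (L / 2) _); rewrite // /D /= in_itv/=; apply/andP; split; lra.
have iM : mu.-integrable D (EFin \o (fun _ => M)).
  by apply: (@bounded_integrable_oo _ M); [exact: measurable_cst|move=> x _; rewrite ger0_norm].
apply/lee_addgt0Pr => e e0.
have e4 : 0 < e / 4 by rewrite divr_gt0.
have [d d0 Gd] := Gend _ e4.
pose c := Num.min (Num.min (d / 2) (L / 4)) (e / (4 * (M + 1))).
have c0 : 0 < c by rewrite !lt_min !divr_gt0//= mulr_gt0//; lra.
have cd : c <= d / 2 by rewrite /c !ge_min lexx.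
have cL : c <= L / 4 by rewrite /c !ge_min lexx orbT.
have cM : M * c <= e / 4.
  have : c <= e / (4 * (M + 1)) by rewrite /c ge_min lexx orbT.
  rewrite ler_pdivlMr; last by rewrite mulr_gt0//; lra.
  lra.
have mcc : measurable (`[c, L - c] : set T) by exact: measurable_itv.
have scc : `[c, L - c] `<=` D.
  by move=> x; rewrite /D /= !in_itv/= => /andP[cx xc]; apply/andP; split; lra.
have HA : (\int[mu]_(x in `[c, (L - c)%R]) (M + g x)%:E =
    ((M * (L - c) + G (L - c)) - (M * c + G c))%R%:E)%E.
  apply: (@integral_derive _ (fun x => M * x + G x) (fun x => M + g x)); first lra.
    move=> x xc; apply: is_derive_add; first by have := is_derive_mulc M (is_derive_id x 1); rewrite mulr1.
    by apply: dG; apply: scc; rewrite /= in_itv.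
  apply: continuous_in_subspaceT => x; rewrite inE => /scc Dx.
  by apply: cvgD; [exact: cvg_cst|exact: cg].
have HD : (\int[mu]_(x in D) (M + g x)%:E = (M * L)%:E + \int[mu]_(x in D) (g x)%:E)%E.
  under eq_integral do rewrite EFinD.
  rewrite (integralD mD iM ig) integral_cst//=; congr (_ + _)%E.
  by rewrite lebesgue_measure_itv/= lte_fin L0 -EFinD -EFinM subr0.
have : (\int[mu]_(x in `[c, (L - c)%R]) (M + g x)%:E <= \int[mu]_(x in D) (M + g x)%:E)%E.
  apply: ge0_subset_integral => //.
    by apply/measurable_EFinP; apply: measurable_funD.
  move=> x Dx; rewrite lee_fin; have := gM x Dx; rewrite ler_norml => /andP[? _]; lra.
rewrite HA HD.
have : (\int[mu]_(x in D) (g x)%:E)%E \is a fin_num by exact: integrable_fin_num.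
case: (\int[mu]_(x in D) (g x)%:E)%E => // I _.
rewrite -!EFinD !lee_fin.
have Dc : D c by rewrite /D /= in_itv/=; apply/andP; split; lra.
have DLc : D (L - c) by rewrite /D /= in_itv/=; apply/andP; split; lra.
have := Gd c Dc ltac:(left; lra); have := Gd (L - c) DLc ltac:(right; lra).
rewrite !ler_norml => /andP[? ?] /andP[? ?]; lra.
Qed.

Lemma integral_oo_eq0 (g G : R -> R) (M : R) :
  (forall x, D x -> `|g x| <= M) -> (forall x, D x -> {for x, continuous g}) ->
  (forall x, D x -> is_derive x 1 G (g x)) ->
  (forall e, 0 < e -> exists2 d, 0 < d &
     forall x, D x -> x < d \/ L - d < x -> `|G x| <= e) ->
  (\int[mu]_(x in D) (g x)%:E = 0)%E.
Proof.
move=> gM cg dG Gend; apply/eqP; rewrite eq_le; apply/andP; split; last exact: (integral_oo_ge0 gM cg dG Gend).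
rewrite -oppe_ge0 -integralN; last first.
  have ig := bounded_integrable_oo (continuous_on_measurable_oo cg) gM.
  exact: integrable_add_def.
apply: (@integral_oo_ge0 (fun x => - g x) (fun x => - G x) M).
- by move=> x Dx; rewrite normrN gM.
- by move=> x Dx; apply: cvgN; exact: cg.
- by move=> x Dx; apply: is_derive_opp; exact: dG.
- by move=> e /Gend[d d0 H]; exists d => // x Dx xd; rewrite normrN H.
Qed.

Lemma bounded_Lp_itv (p : R) (w : R -> R) (M : R) : 1 < p ->
  measurable_fun (D : set T) w -> (forall x, D x -> `|w x| <= M) -> Lp_itv p L w.
Proof.
move=> p1 mw wM; have p0 : 0 < p by lra.
have mwD : measurable_fun (setT : set T) (w \_ D) by exact/(measurable_restrictT _ mD).
rewrite /Lp_itv inE/=; apply/andP; split; rewrite inE//=.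
rewrite /finite_norm unlock poweR_lty//.
have iw : mu.-integrable D (EFin \o (fun x => `|w x| `^ p)).
  apply: (@bounded_integrable_oo _ (M `^ p)).
    by apply: (measurableT_comp (measurable_powR p)); exact: measurableT_comp.
  move=> x Dx; rewrite ger0_norm ?powR_ge0//; have wx := wM x Dx.
  by apply: ge0_ler_powR; rewrite ?nnegrE ?(ltW p0)// (le_trans _ wx).
have /integrableP[_] := iw; apply: le_lt_trans.
rewrite [leRHS]integral_mkcond le_eqVlt; apply/orP; left; apply/eqP.
apply: eq_integral => x _; rewrite /= !patchE; case: ifPn => [_|_] /=.
  by rewrite [in RHS]ger0_norm ?powR_ge0.
by transitivity ((`|0 : R| `^ p)%:E) => //; rewrite normr0 powR0// gt_eqF.
Qed.

(** For a test function phi, u phi is a primitive of u phi' + v phi that vanishes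
at both ends. *)
Lemma weak_derivative_oo (u v : R -> R) (M K : R) :
  (forall x, D x -> is_derive x 1 u (v x)) -> (forall x, D x -> {for x, continuous v}) ->
  (forall x, D x -> `|u x| <= M) -> (forall x, D x -> `|v x| <= K) ->
  weak_derivative L u v.
Proof.
move=> du cv uM vK.
have cu x : D x -> {for x, continuous u} by move=> Dx; apply: is_derive_continuous (du x Dx).
move=> phi [dphi _ supp].
have d0 (x : R) : is_derive x 1 phi (derive1 phi x).
  have := dphi 0%N x; rewrite derive1n0 => dx.
  by rewrite derive1E; exact/derivableP.
have c0 : continuous phi by move=> x; apply: is_derive_continuous (d0 x).
have c1 : continuous (derive1 phi).
  move=> x; have := dphi 1%N x; rewrite derive1n1 => /derivable1_diffP/differentiable_continuous.
  exact.
have bnd (w : R -> R) : continuous w -> exists M, forall x, D x -> `|w x| <= M.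
  move=> cw; have [|c _ Hc] := @EVT_max R (fun x => `|w x|) 0 L (ltW L0).
    by apply: continuous_subspaceT => x; apply: continuous_comp; [exact: cw|exact: norm_continuous].
  exists `|w c| => x /DP/andP[x0 xL]; apply: Hc.
  by rewrite in_itv/= !ltW.
have [M0 HM0] := bnd _ c0; have [M1 HM1] := bnd _ c1.
have out x : ~ D x -> phi x = 0.
  by apply: contra_notP => /eqP phix; apply: supp; exact: subset_closure.
have phi0 : phi 0 = 0 by apply: out => /DP; rewrite ltxx.
have phiL : phi L = 0 by apply: out => /DP; rewrite ltxx andbF.
have mu_ := continuous_on_measurable_oo cu.
have mv_ := continuous_on_measurable_oo cv.
have mphi : measurable_fun (D : set T) phi by apply: continuous_on_measurable_oo => x _; exact: c0.
have mphi' : measurable_fun (D : set T) (derive1 phi).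
  by apply: continuous_on_measurable_oo => x _; exact: c1.
have B1 x : D x -> `|u x * derive1 phi x| <= M * M1.
  move=> Dx; rewrite normrM; apply: ler_pM; [exact: normr_ge0|exact: normr_ge0|exact: uM|exact: HM1].
have B2 x : D x -> `|v x * phi x| <= K * M0.
  move=> Dx; rewrite normrM; apply: ler_pM; [exact: normr_ge0|exact: normr_ge0|exact: vK|exact: HM0].
have i1 : mu.-integrable D (EFin \o (fun x => u x * derive1 phi x)).
  by apply: (bounded_integrable_oo _ B1); exact: measurable_funM.
have i2 : mu.-integrable D (EFin \o (fun x => v x * phi x)).
  by apply: (bounded_integrable_oo _ B2); exact: measurable_funM.
have Z : (\int[mu]_(x in D) (u x * derive1 phi x + v x * phi x)%:E = 0)%E.
  apply: (@integral_oo_eq0 (fun x => u x * derive1 phi x + v x * phi x)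
    (fun x => u x * phi x) (M * M1 + K * M0)).
  - by move=> x Dx; apply: le_trans (ler_normD _ _) _; apply: lerD; [exact: B1|exact: B2].
  - move=> x Dx; apply: cvgD; apply: cvgM.
    + exact: cu.
    + exact: c1.
    + exact: cv.
    + exact: c0.
  - move=> x Dx; have := is_derive_mul (du x Dx) (d0 x).
    by congr (is_derive _ _ _ _); ring.
  - move=> e e0; have N0 : 0 < `|M| + 1 by rewrite ltr_wpDl.
    have ep0 : 0 < e / (`|M| + 1) by rewrite divr_gt0.
    have near_end z : phi z = 0 -> exists2 d, 0 < d & forall x, `|z - x| < d -> `|phi x| <= e / (`|M| + 1).
      move=> phiz; have := c0 z; move/cvgrPdist_lt => /(_ _ ep0)/nbhs_ballP[d /= d1 Hd].
      by exists d => // x /Hd; rewrite phiz sub0r normrN => /ltW.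
    have [d1 d10 H1] := near_end _ phi0; have [d2 d20 H2] := near_end _ phiL.
    exists (Num.min d1 d2); first by rewrite lt_min d10.
    move=> x Dx xd; rewrite normrM mulrC -[leRHS](divfK (lt0r_neq0 N0)).
    apply: ler_pM; rewrite ?normr_ge0//; last first.
      by apply: le_trans (uM x Dx) _; rewrite (le_trans (ler_norm M))// lerDl.
    have /andP[x0 xL] := DP Dx.
    case: xd => [xd|xd].
      by apply: H1; rewrite sub0r normrN gtr0_norm// (lt_le_trans xd)// ge_min lexx.
    apply: H2; rewrite gtr0_norm ?subr_gt0//; apply: (@lt_le_trans _ _ (Num.min d1 d2)).
      by move: xd; rewrite !ltrBlDl addrC.
    by rewrite ge_min lexx orbT.
apply/eqP; rewrite -addr_eq0 -(RintegralD mD i1 i2); apply/eqP.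
by rewrite /Rintegral Z.
Qed.

End OpenInterval.

(** * Extremal functions for the constant weight *)
Section Minimizer.
Context {R : realType} (p L : R) (p1 : 1 < p) (L0 : 0 < L).
Context (F : R -> R) (F0 : F 0 = 0) (dF : forall y : R, is_derive y 1 F (pden p y)^-1).
Let mu := @lebesgue_measure R.
Let D : set R := `]0, L[.
Let T := measurableTypeR R.
Let mD : measurable (D : set T). Proof. exact: measurable_itv. Qed.
Let DP x : D x -> 0 < x < L. Proof. by rewrite /D /= in_itv. Qed.
Let l := arcpden_lim F.
Let kappa := 2 * l / L.

Let l0 : 0 < l. Proof. by have := arcpden_lt_lim p1 dF 0; rewrite F0. Qed.
Let kappa0 : 0 < kappa. Proof. by rewrite /kappa divr_gt0// mulr_gt0. Qed.
Let p0 : 0 < p. Proof. by have := p1; lra. Qed.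
Let cF : continuous F. Proof. by move=> y; apply: is_derive_continuous (dF y). Qed.

Lemma arcpden_surj z : `|z| < l -> exists y, F y = z.
Proof.
move=> zl.
have hs : has_sup (range F).
  split; first by exists (F 0), 0.
  by exists l => _ [y _ <-]; apply/ltW; exact: arcpden_lt_lim.
have [_ [y _ <-]] := sup_adherent (E := range F) (eps := l - `|z|) ltac:(lra) hs.
rewrite -/(arcpden_lim F) -/l subKr => zy.
have y0 : 0 <= y.
  rewrite leNgt; apply/negP => /ltW /(arcpden_le p1 dF); rewrite F0.
  by have := normr_ge0 z; lra.
have yz : F (- y) <= z <= F y by rewrite (arcpdenN F0 dF) -ler_norml ltW.
have yy : - y <= y by lra.
have [x _ xz] := surjective_itv yy cF yz.
by exists x.
Qed.

(** The analogue of the tangent: it blows up at 0 and at L, as kappa L/2 is the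
limit of the primitive at +oo. *)
Lemma exists_phase : exists tau : R -> R, forall x, D x ->
  F (tau x) = kappa * (x - L / 2) /\ is_derive x 1 tau (kappa * pden p (tau x)).
Proof.
have [|g [gK dg]] := exists_inverse dF; first by move=> y; rewrite invr_gt0 pden_gt0.
exists (fun x => g (kappa * (x - L / 2))) => x /DP/andP[x0 xL].
have [|y yE] := @arcpden_surj (kappa * (x - L / 2)).
  rewrite normrM gtr0_norm// -ltr_pdivlMl//.
  have -> : kappa^-1 * l = L / 2.
    by rewrite /kappa; field; rewrite !gt_eqF.
  by rewrite ltr_norml; apply/andP; split; lra.
rewrite -yE gK; split => //.
have -> : kappa * pden p y = (pden p y)^-1^-1 * kappa by rewrite invrK mulrC.
apply: (@is_derive_comp _ g (fun x => kappa * (x - L / 2))); last exact: is_derive_affine.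
by rewrite -yE.
Qed.

Section Phase.
Context (tau : R -> R).
Context (tauE : forall x, D x -> F (tau x) = kappa * (x - L / 2)).
Context (dtau : forall x, D x -> is_derive x 1 tau (kappa * pden p (tau x))).

(* The power -a of pden(tau). The exponents 1/p and (p-1)/p give the analogue h
   of the cosine and its power h^(p-1). *)
Let H (a x : R) : R := expR (- (a * ln (pden p (tau x)))).
Let h := H p^-1.
Let u x := tau x * h x.

Let dH a x : D x -> is_derive x 1 (H a) (- (a * p / (p - 1)) * kappa * spow p (tau x) * H a x).
Proof.
move=> Dx; have P0 := pden_gt0 p1 (tau x).
have d1 := @is_derive_comp _ (pden p) tau _ _ _ (is_derive_pden p1 (tau x)) (dtau Dx).
have d2 := @is_derive_comp _ (@ln R) (fun x => pden p (tau x)) _ _ _ (is_derive1_ln P0) d1.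
have d3 := is_derive_opp (is_derive_mulc a d2).
have := @is_derive_comp _ expR (fun x => - (a * ln (pden p (tau x)))) _ _ _ (is_derive_expR _) d3.
have p1' : p - 1 != 0 by rewrite subr_eq0 gt_eqF.
by congr (is_derive _ _ _ _); rewrite /H; field; rewrite p1' gt_eqF.
Qed.

Let H_gt0 a x : 0 < H a x. Proof. exact: expR_gt0. Qed.

Let H_le1 a x : 0 <= a -> H a x <= 1.
Proof.
by move=> a0; rewrite /H expR_le1 oppr_le0 mulr_ge0// ln_ge0// pden_ge1.
Qed.

Let h_le1 x : h x <= 1. Proof. by apply: H_le1; rewrite invr_ge0 ltW. Qed.
Let h_gt0 x : 0 < h x. Proof. exact: H_gt0. Qed.

Let kh x : `|kappa * h x| <= kappa.
Proof. by rewrite normrM (gtr0_norm kappa0) (gtr0_norm (h_gt0 x)) ler_piMr ?h_le1// ltW. Qed.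

Let h_powp x : h x `^ p = (pden p (tau x))^-1.
Proof.
rewrite /h /H -expRM mulNr mulrAC mulVf ?gt_eqF// mul1r -lnV ?lnK// posrE ?invr_gt0;
exact: pden_gt0.
Qed.

Let h_powp1 x : H ((p - 1) / p) x = h x `^ (p - 1).
Proof. by rewrite /h /H -expRM; congr expR; ring. Qed.

Let u_powp x : `|u x| `^ p = `|tau x| `^ p * h x `^ p.
Proof. by rewrite /u normrM (gtr0_norm (h_gt0 x)) powRM// ltW. Qed.

(* The analogue of cos^2 + sin^2 = 1. *)
Let pyth x : h x `^ p + `|u x| `^ p / (p - 1) = 1.
Proof.
have p1' : p - 1 != 0 by rewrite subr_eq0 gt_eqF.
rewrite u_powp.
have -> : h x `^ p + `|tau x| `^ p * h x `^ p / (p - 1) = h x `^ p * pden p (tau x).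
  by rewrite /pden; field.
by rewrite h_powp mulVf// gt_eqF// pden_gt0.
Qed.

Let spow_u x : spow p (u x) = spow p (tau x) * h x `^ (p - 1).
Proof.
rewrite /spow /u normrM (gtr0_norm (h_gt0 x)) powRM ?(ltW (h_gt0 x))//.
have -> : h x `^ (p - 1) = h x `^ (p - 2) * h x.
  rewrite -[X in _ * X](powRr1 (ltW (h_gt0 x))) -powRD; last by apply/implyP => _; rewrite gt_eqF.
  by congr (_ `^ _); ring.
by ring.
Qed.

Let h_mul x : h x * h x `^ (p - 1) = h x `^ p.
Proof. by rewrite mulr_powRB1// ltW. Qed.

Let du x : D x -> is_derive x 1 u (kappa * h x).
Proof.
move=> Dx; have := is_derive_mul (dtau Dx) (dH p^-1 Dx).
have p1' : p - 1 != 0 by rewrite subr_eq0 gt_eqF.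
have E : tau x * spow p (tau x) = `|tau x| `^ p by rewrite mulrC spow_mul.
congr (is_derive _ _ _ _); rewrite -/h -/(h x).
transitivity (kappa * h x * (pden p (tau x) - tau x * spow p (tau x) / (p - 1))).
  by field; rewrite p1' gt_eqF.
by rewrite E /pden addrK mulr1.
Qed.

Let dh1 x : D x -> is_derive x 1 (H ((p - 1) / p)) (- kappa * spow p (u x)).
Proof.
move=> Dx; have := dH ((p - 1) / p) Dx.
have p1' : p - 1 != 0 by rewrite subr_eq0 gt_eqF.
by congr (is_derive _ _ _ _); rewrite spow_u h_powp1; field; rewrite p1' gt_eqF.
Qed.

Let duh x : D x -> is_derive x 1 (fun x => u x * H ((p - 1) / p) x)
  (kappa * (h x `^ p - `|u x| `^ p)).
Proof.
move=> Dx; have := is_derive_mul (du Dx) (dh1 Dx).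
congr (is_derive _ _ _ _).
by rewrite h_powp1 -h_mul -(spow_mul p1); ring.
Qed.

Let u_powp_le x : `|u x| `^ p <= p - 1.
Proof.
have pp : 0 < p - 1 by rewrite subr_gt0.
have := pyth x; have := powR_ge0 (h x) p => h0 E.
have : `|u x| `^ p / (p - 1) <= 1 by lra.
by rewrite ler_pdivrMr// mul1r.
Qed.

Let u_le x : `|u x| <= p.
Proof.
rewrite leNgt; apply/negP => up.
have := u_powp_le x; rewrite leNgt => /negP; apply.
have u1 : 1 <= `|u x| by rewrite ltW// (lt_trans p1).
apply: lt_le_trans (le1r_powR u1 (ltW p1)).
by have := p1; lra.
Qed.

(* |u| = |tau| h is bounded and |tau| tends to infinity at the ends. *)
Let h_end e : 0 < e -> exists2 d, 0 < d & forall x, D x -> x < d \/ L - d < x -> h x <= e.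
Proof.
move=> e0; pose N := p / e.
have N0 : 0 < N by rewrite divr_gt0.
have FN := arcpden_lt_lim p1 dF N.
have Fl : F N / kappa < L / 2.
  rewrite ltr_pdivrMr//; have -> : L / 2 * kappa = l by rewrite /kappa; field; rewrite gt_eqF.
  exact: FN.
exists (L / 2 - F N / kappa); first by rewrite subr_gt0.
move=> x Dx xd; have tauN : N <= `|tau x|.
  rewrite leNgt ltr_norml; apply/negP => /andP[t1 t2].
  move: (arcpden_lt p1 dF t1) (arcpden_lt p1 dF t2); rewrite (arcpdenN F0 dF) tauE//.
  move=> h1 h2; case: xd => xd.
    have : F N / kappa < L / 2 - x by lra.
    by rewrite ltr_pdivrMr// mulrC => h3; lra.
  have : F N / kappa < x - L / 2 by lra.
  by rewrite ltr_pdivrMr// mulrC => h3; lra.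
have tau0 : 0 < `|tau x| by apply: lt_le_trans tauN.
have := u_le x; rewrite /u normrM (gtr0_norm (h_gt0 x)) mulrC -ler_pdivlMr// => hx.
apply: le_trans hx _; rewrite ler_pdivrMr//.
by move: tauN; rewrite /N ler_pdivrMr// mulrC.
Qed.

Let cu x : D x -> {for x, continuous u}.
Proof. by move=> Dx; apply: is_derive_continuous (du Dx). Qed.

Let cH a x : D x -> {for x, continuous (H a)}.
Proof. by move=> Dx; apply: is_derive_continuous (dH a Dx). Qed.

Let cup x : D x -> {for x, continuous (fun x => `|u x| `^ p)}.
Proof.
move=> Dx; apply: (@continuous_comp _ _ _ u (fun y => `|y| `^ p)); first exact: cu.
exact: continuous_norm_powR.
Qed.

Let chp x : D x -> {for x, continuous (fun x => h x `^ p)}.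
Proof.
move=> Dx; have -> : (fun x => h x `^ p) = (fun x => `|h x| `^ p).
  by apply/funext => y; rewrite gtr0_norm.
apply: (@continuous_comp _ _ _ h (fun y => `|y| `^ p)); first exact: cH.
exact: continuous_norm_powR.
Qed.

(* -h^(p-1)/kappa is a primitive of spow u that vanishes at both ends. *)
Let mean_zero : p_mean_zero p L (cst 1%R) u.
Proof.
rewrite /p_mean_zero; under eq_integral do rewrite /= mulr1.
apply: (@integral_oo_eq0 _ _ L0 (fun x => spow p (u x)) (fun x => - kappa^-1 * H ((p - 1) / p) x) (p `^ (p - 1))).
- move=> x _; rewrite norm_spow//; apply: ge0_ler_powR; rewrite ?nnegrE ?(ltW p0)//.
  by rewrite subr_ge0 ltW.
- move=> x Dx; apply: (@continuous_comp _ _ _ u (spow p)); first exact: cu.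
  exact: continuous_spow.
- move=> x Dx; have := is_derive_mulc (- kappa^-1) (dh1 Dx).
  by congr (is_derive _ _ _ _); field; rewrite gt_eqF.
- move=> e e0; have pp : 0 < p - 1 by rewrite subr_gt0.
  pose e' := (kappa * e) `^ (p - 1)^-1.
  have e'0 : 0 < e' by rewrite powR_gt0// mulr_gt0.
  have [d d0 Hd] := h_end e'0; exists d => // x Dx /(Hd x Dx) hx.
  rewrite normrM normrN [`|kappa^-1|]gtr0_norm ?invr_gt0// (gtr0_norm (H_gt0 _ _)) ler_pdivrMl//.
  rewrite h_powp1; apply: (@le_trans _ _ (e' `^ (p - 1))).
    by apply: ge0_ler_powR; rewrite ?nnegrE ?(ltW pp)// ltW.
  by rewrite /e' -powRrM mulVf ?gt_eqF// powRr1// mulr_ge0// ltW.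
Qed.

Let ihp : mu.-integrable D (EFin \o (fun x => h x `^ p)).
Proof.
apply: (@bounded_integrable_oo _ _ L0 _ 1); first exact: continuous_on_measurable_oo chp.
by move=> x _; rewrite ger0_norm ?powR_ge0// h_powp invf_le1 ?pden_ge1// pden_gt0.
Qed.

Let iup : mu.-integrable D (EFin \o (fun x => `|u x| `^ p)).
Proof.
apply: (@bounded_integrable_oo _ _ L0 _ (p - 1)); first exact: continuous_on_measurable_oo cup.
by move=> x _; rewrite ger0_norm ?powR_ge0.
Qed.

(* u h^(p-1) is a primitive of kappa (h^p - |u|^p) that vanishes at both ends. *)
Let balance : (\int[mu]_(x in D) (h x `^ p)%:E = \int[mu]_(x in D) (`|u x| `^ p)%:E)%E.
Proof.
have H0 : (\int[mu]_(x in D) (kappa * (h x `^ p - `|u x| `^ p))%:E = 0)%E.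
  apply: (@integral_oo_eq0 _ _ L0 _ (fun x => u x * H ((p - 1) / p) x) (kappa * p)).
  - move=> x _; rewrite normrM gtr0_norm// ler_pM2l// ler_norml.
    have := u_powp_le x; have := powR_ge0 (`|u x|) p; have := powR_ge0 (h x) p.
    have : h x `^ p <= 1 by rewrite h_powp invf_le1 ?pden_ge1// pden_gt0.
    by move=> ? ? ? ?; apply/andP; split; lra.
  - move=> x Dx; apply: cvgM; first exact: cvg_cst.
    by apply: cvgB; [exact: chp|exact: cup].
  - exact: duh.
  - move=> e e0; have pp : 0 < p - 1 by rewrite subr_gt0.
    pose e' := (e / p) `^ (p - 1)^-1.
    have e'0 : 0 < e' by rewrite powR_gt0// divr_gt0.
    have [d d0 Hd] := h_end e'0; exists d => // x Dx /(Hd x Dx) hx.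
    rewrite normrM (gtr0_norm (H_gt0 _ _)) -[leRHS](mulfVK (lt0r_neq0 p0)) mulrC.
    apply: ler_pM => //; first exact: ltW.
    rewrite h_powp1; apply: (@le_trans _ _ (e' `^ (p - 1))).
      by apply: ge0_ler_powR; rewrite ?nnegrE ?(ltW pp)// ltW.
    by rewrite /e' -powRrM mulVf ?gt_eqF// powRr1// divr_ge0// ltW.
move: H0; under eq_integral do rewrite EFinM EFinB.
rewrite (integralZl mD (integrableB mD ihp iup)) (integralB_EFin mD ihp iup).
have : (\int[mu]_(x in D) (h x `^ p)%:E)%E \is a fin_num by exact: integrable_fin_num ihp.
have : (\int[mu]_(x in D) (`|u x| `^ p)%:E)%E \is a fin_num by exact: integrable_fin_num iup.
case: (\int[mu]_(x in D) (`|u x| `^ p)%:E)%E => // a _.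
case: (\int[mu]_(x in D) (h x `^ p)%:E)%E => // b _.
rewrite -EFinB -EFinM => -[] /eqP; rewrite mulf_eq0 gt_eqF//= subr_eq0 => /eqP ->.
by [].
Qed.

Let energy_u : p_energy p L (cst 1%R) u = (\int[mu]_(x in D) (`|u x| `^ p)%:E)%E.
Proof. by apply: eq_integral => x _; rewrite /cst mulr1. Qed.

Let energy_v : p_energy p L (cst 1%R) (fun x => (kappa * h x)%R) =
  ((kappa `^ p)%:E * p_energy p L (cst 1%R) u)%E.
Proof.
rewrite energy_u -balance /p_energy.
rewrite -(integralZl mD ihp); apply: eq_integral => x _ /=.
by rewrite -EFinM mulr1 normrM (gtr0_norm kappa0) (gtr0_norm (h_gt0 x)) (powRM _ (ltW kappa0) (ltW (h_gt0 x))).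
Qed.

(* By the two previous identities the energy is a positive multiple of L. *)
Let energy_u_neq0 : p_energy p L (cst 1%R) u != 0%E.
Proof.
rewrite energy_u; apply/negP => /eqP E.
have p1' : p - 1 != 0 by rewrite subr_eq0 gt_eqF.
have : (\int[mu]_(x in D) 1%:E = 0)%E.
  transitivity (\int[mu]_(x in D) ((h x `^ p)%:E + ((p - 1)^-1)%:E * (`|u x| `^ p)%:E))%E.
    by apply: eq_integral => x _; rewrite -EFinM -EFinD [_^-1 * _]mulrC pyth.
  rewrite (integralD mD ihp (integrableZl mD _ iup)) (integralZl mD iup) balance E.
  by rewrite mule0 adde0.
rewrite integral_cst//= mul1e lebesgue_measure_itv/= lte_fin L0 -EFinD subr0 => -[] L00.
by have := L0; rewrite L00 ltxx.
Qed.

Let weak : weak_derivative L u (fun x => kappa * h x).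
Proof.
apply: (@weak_derivative_oo _ _ L0 _ _ p kappa).
- exact: du.
- by move=> x Dx; apply: cvgM; [exact: cvg_cst|exact: cH].
- by move=> x _; exact: u_le.
- by move=> x _; exact: kh.
Qed.

Lemma phase_minimizer : exists u v : R -> R,
  [/\ sobolev_with_derivative p L u v, p_mean_zero p L (cst 1%R) u,
      p_energy p L (cst 1%R) u != 0%E
    & ((pi_p p / L) `^ p)%:E = (p_energy p L (cst 1%R) v / p_energy p L (cst 1%R) u)%E].
Proof.
exists u, (fun x => kappa * h x); split; [|exact: mean_zero|exact: energy_u_neq0|].
  split; [| |exact: weak].
    apply: (bounded_Lp_itv L0 p1 (continuous_on_measurable_oo cu)) => x _; exact: u_le.
  apply: (@bounded_Lp_itv _ _ L0 _ _ kappa p1).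
    apply: measurable_funM; first exact: measurable_cst.
    exact: continuous_on_measurable_oo (@cH p^-1).
  by move=> x _; exact: kh.
rewrite energy_v (pi_pE p1 F0 dF) -/l -/kappa.
have : p_energy p L (cst 1%R) u \is a fin_num.
  by rewrite energy_u; exact: integrable_fin_num iup.
move: energy_u_neq0; case: (p_energy p L (cst 1%R) u) => // e; rewrite eqe => e0 _.
by rewrite -EFinM inver (negbTE e0) -EFinM mulfK.
Qed.

End Phase.

Lemma constant_weight_minimizer : exists u v : R -> R,
  [/\ sobolev_with_derivative p L u v, p_mean_zero p L (cst 1%R) u,
      p_energy p L (cst 1%R) u != 0%E
    & ((pi_p p / L) `^ p)%:E = (p_energy p L (cst 1%R) v / p_energy p L (cst 1%R) u)%E].
Proof.
have [tau Htau] := exists_phase.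
by apply: (@phase_minimizer tau) => x /Htau[].
Qed.

End Minimizer.

(** * The spectral gap *)

(** The constant 1 is log-concave, so the lower bound applies to it as well as to
f; the extremal function of the constant weight shows that it is attained. *)
Theorem proposition1p1 (R : realType) (L p : R) (f : R -> R)
  (hL : 0 < L) (hp : 1 < p)
  (f_ge0 : forall x : R, x \in `[0, L] -> 0 <= f x)
  (f_lc : log_concave L f) :
  let Q := rayleigh_quotients p L in
  [/\ (ereal_inf (Q (cst 1%R)) <= ereal_inf (Q f))%E,
      (* the right-hand infimum is a minimum *)
      Q (cst 1%R) (ereal_inf (Q (cst 1%R))),
      ereal_inf (Q (cst 1%R)) = ((pi_p p / L) `^ p)%:E
    & pi_p p = 2 * pi * ((p - 1) `^ (p^-1) / (p * sin (pi / p)))].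
Proof.
move=> Q.
have [F [F0 dF]] := exists_primitive (continuous_pdenV hp).
have lower g : (forall x : R, x \in `[0, L] -> 0 <= g x) -> log_concave L g ->
    (((pi_p p / L) `^ p)%:E <= ereal_inf (Q g))%E.
  move=> g0 glc; apply: le_ereal_inf_tmp => _ [u [v [huv mz En0 ->]]].
  exact: (rayleigh_ge_pi_p hp hL g0 glc F0 dF huv).
have lc1 : log_concave L (cst 1 : R -> R) by move=> x y t _ _ _; rewrite !powR1 mulr1.
have min1 : Q (cst 1%R) ((pi_p p / L) `^ p)%:E.
  have [u [v [? ? ? ?]]] := constant_weight_minimizer hp hL F0 dF.
  by exists u, v.
have inf1 : ereal_inf (Q (cst 1%R)) = ((pi_p p / L) `^ p)%:E.
  apply/eqP; rewrite eq_le ereal_inf_lbound//=.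
  by apply: lower => // x _; exact: ler01.
by split; rewrite ?inf1//; [exact: lower|exact: pi_p_formula].
Qed.
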